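(* Let $n\ge 1$. The Tomei manifold $M_0^n$ is maximal with respect to the virtual domination relation: for every oriented connected closed $n$-dimensional manifold $N^n$ there exist a finite-sheeted covering $\widehat M^n$ of $M_0^n$ and a continuous mapping $\widehat M^n\to N^n$ of non-zero degree.
   Context: Write $[n+1]=\{1,\ldots,n+1\}$ and let $\Omega$ be the set of all non-empty proper subsets of $[n+1]$. Permutahedron. Choose positive numbers $\varepsilon_1,\ldots,\varepsilon_n$ with $\varepsilon_1<\frac12$ and $2\varepsilon_k<\varepsilon_{k-1}$ for $2\le k\le n$. The permutahedron $\Pi^n$ is the $n$-dimensional convex polytope in the hyperplane $x_1+\cdots+x_{n+1}=1$ of $\mathbb{R}^{n+1}$ whose $(n+1)!$ vertices are obtained by permuting the coordinates of the point $(1-\varepsilon_1,\varepsilon_1-\varepsilon_2,\ldots,\varepsilon_{n-1}-\varepsilon_n,\varepsilon_n)$. It is a simple polytope, and its facets are in bijection with the elements of $\Omega$: the facet $F_\omega$ corresponding to $\omega\in\Omega$ is the intersection of $\Pi^n$ with the hyperplane $\sum_{i\in\omega}x_i=1-\varepsilon_{|\omega|}$. Coxeter group. Let $W$ be the right-angled Coxeter group with generators $s_\omega$, $\omega\in\Omega$, and defining relations $s_\omega^2=1$ for all $\omega$, and $s_{\omega_1}s_{\omega_2}=s_{\omega_2}s_{\omega_1}$ whenever $\omega_1\subset\omega_2$. Let $\widetilde M^n=(\Pi^n\times W)/\sim$, where $(p,w)\sim(p',w')$ if and only if $p=p'$ and $w'w^{-1}$ belongs to the subgroup of $W$ generated by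 all $s_\omega$ with $p\in F_\omega$. This is an $n$-dimensional manifold, and $W$ acts on it on the right by $[p,w]\cdot w'=[p,ww']$. Tomei manifold. Let $\mathbb{Z}_2^n$ have generators $a_1,\ldots,a_n$, let $\eta\colon W\to\mathbb{Z}_2^n$ be the homomorphism with $\eta(s_\omega)=a_{|\omega|}$, and let $K=\ker\eta$. The group $K$ acts on $\widetilde M^n$ freely and preserving orientation, and $M_0^n=\widetilde M^n/K$ is an oriented closed manifold glued out of $2^n$ permutahedra, called the Tomei manifold. An oriented closed manifold $M^n$ is said to virtually dominate an oriented closed manifold $N^n$ of the same dimension if some finite-sheeted covering of $M^n$ admits a mapping of non-zero degree to $N^n$. *)

(* Defs.v *)
From HB Require Import structures.
From mathcomp Require Import all_boot all_order all_algebra perm.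
From mathcomp Require Import all_classical all_reals all_analysis.
From mathcomp.multinomials Require Import freeg.

Set Implicit Arguments.
Unset Strict Implicit.
Unset Printing Implicit Defensive.

Import Order.TTheory GRing.Theory Num.Theory.
Import numFieldNormedType.Exports.

Local Open Scope classical_set_scope.
Local Open Scope quotient_scope.
Local Open Scope ring_scope.

Section Manifolds.
Variable R : realType.

Definition homeomorphism_between (S T : topologicalType) (A : set S)
    (B : set T) (f : S -> T) (g : T -> S) : Prop :=
  [/\ {within A, continuous f}, {within B, continuous g},
      set_fun A B f & set_fun B A g] /\
  (forall x, A x -> g (f x) = x) /\ (forall y, B y -> f (g y) = y).

Definition locally_euclidean (n : nat) (M : topologicalType) : Prop :=
  forall x : M, exists (U : set M) (V : set 'rV[R]_n)
      (f : M -> 'rV[R]_n) (g : 'rV[R]_n -> M),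
    [/\ open_nbhs x U, open V & homeomorphism_between U V f g].

Definition closed_manifold (n : nat) (M : topologicalType) : Prop :=
  [/\ hausdorff_space M, @second_countable M, compact [set: M]
    & locally_euclidean n M].

Definition finite_sheeted_covering (E B : topologicalType) (p : E -> B) :
    Prop :=
  continuous p /\ exists k : nat, (0 < k)%N /\
  forall b : B, exists (U : set B) (V : 'I_k -> set E),
    [/\ open_nbhs b U, forall i, open (V i), trivIset setT V,
        p @^-1` U = \bigcup_i V i
      & forall i, exists g : B -> E, homeomorphism_between (V i) U p g].

(* Integral singular homology is handled on chains: a class of H_k(X, A) is
   given by a representative c with [relative_cycle A c], and two representatives
   are compared by [homologous_mod A]. *)

Definition std_simplex (k : nat) : set 'rV[R]_k.+1 :=
  [set x | (forall i, 0 <= x 0 i) /\ \sum_i x 0 i = 1].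
Arguments std_simplex : clear implicits.

Definition face_map (k : nat) (i : 'I_k.+2) (x : 'rV[R]_k.+1) :
    'rV[R]_k.+2 :=
  \row_j (if unlift i j is Some j' then x 0 j' else 0).

Lemma face_map_simplex k (i : 'I_k.+2) (x : std_simplex k) :
  face_map i (set_val x) \in std_simplex k.+1.
Proof.
case: x => x xS; rewrite set_valE /=; have [x0 x1] := set_mem xS.
apply/mem_set; split=> [j|].
  by rewrite mxE; case: unliftP.
rewrite (bigD1 i)//= mxE unlift_none add0r -[RHS]x1.
rewrite (reindex (fintype.lift i)); last first.
  exists (fun j => odflt ord0 (unlift i j)) => j; rewrite inE => ij.
    by rewrite liftK.
  by case: unliftP ij => [j' -> //|->]; rewrite eqxx.
apply: eq_big => [j|j _]; first by rewrite eq_sym neq_lift.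
by rewrite mxE liftK.
Qed.

Definition face k (i : 'I_k.+2) (x : std_simplex k) : std_simplex k.+1 :=
  SigSub (face_map_simplex i x).

Lemma face_continuous k (i : 'I_k.+2) : continuous (@face k i).
Proof.
apply: continuous_comp_initial => x.
have cval : {for x, continuous (set_val : std_simplex k -> 'rV[R]_k.+1)}.
  exact: (@initial_continuous (std_simplex k) _ set_val x).
apply: (@continuous_comp (std_simplex k) _ _ set_val (face_map i) x cval).
move: (set_val x) => {cval}x U [P xP PU].
apply: (@filterS _ _ _ [set y | forall j, P 0 j (face_map i y 0 j)]).
  by move=> y yP; apply: PU => i0 j; rewrite ord1; exact: yP.
apply: (@filter_forall _ _ (fun j y => P 0 j (face_map i y 0 j)) (nbhs x)) => j.
have := xP 0 j; rewrite mxE.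
case E: (unlift i j) => [j'|] Pj; last first.
  apply: filterE => y; rewrite /= mxE E; exact: nbhs_singleton.
have Pj' := @coord_continuous _ _ _ 0 j' x _ Pj.
by apply: (@filterS _ (nbhs x) (nbhs_filter x) _ _ _ Pj') => y; rewrite /= mxE E.
Qed.

HB.instance Definition _ k (i : 'I_k.+2) :=
  isContinuous.Build (std_simplex k) (std_simplex k.+1) (@face k i)
    (@face_continuous k i).

Definition singular_simplex (k : nat) (X : topologicalType) :=
  continuousType (std_simplex k) X.

Definition chain (k : nat) (X : topologicalType) :=
  {freeg (singular_simplex k X) / int}.

Definition boundary (k : nat) (X : topologicalType) :
    chain k X -> chain k.-1 X :=
  if k is k'.+1 return chain k X -> chain k.-1 X then
    fglift (fun s : singular_simplex k'.+1 X =>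
      \sum_(i < k'.+2) (-1) ^+ i *: << (s \o @face k' i : singular_simplex k' X) >>)
  else fun=> 0.

Definition pushforward (k : nat) (X Y : topologicalType)
    (f : continuousType X Y) : chain k X -> chain k Y :=
  fglift (fun s : singular_simplex k X => << (f \o s : singular_simplex k Y) >>).

Definition chain_in (k : nat) (X : topologicalType) (A : set X)
    (c : chain k X) : Prop :=
  forall s : singular_simplex k X, s \in dom c -> range s `<=` A.

Definition homologous_mod (k : nat) (X : topologicalType) (A : set X)
    (c c' : chain k X) : Prop :=
  exists b : chain k.+1 X, chain_in A (c - c' - boundary b).

Definition relative_cycle (k : nat) (X : topologicalType) (A : set X)
    (c : chain k X) : Prop :=
  chain_in A (boundary c).

Definition homologous (k : nat) (X : topologicalType) (c c' : chain k X) :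
    Prop :=
  exists b : chain k.+1 X, c - c' = boundary b.

(* [c] represents a generator of the infinite cyclic group H_n(M, M \ {x}). *)
Definition local_generator (n : nat) (M : topologicalType) (x : M)
    (c : chain n M) : Prop :=
  relative_cycle (~` [set x]) c /\
  forall c' : chain n M, relative_cycle (~` [set x]) c' ->
    exists m : int, homologous_mod (~` [set x]) c' (m *: c).

(* An orientation chooses a generator of H_n(M, M \ {x}) at each point x
   (through a representative [o x]), locally coming from a single class of
   H_n(M, M \ U). *)
Definition is_orientation (n : nat) (M : topologicalType)
    (o : M -> chain n M) : Prop :=
  (forall x, local_generator x (o x)) /\
  forall x : M, exists U : set M, nbhs x U /\
    exists c : chain n M, relative_cycle (~` U) c /\
      forall y, U y -> homologous_mod (~` [set y]) c (o y).

Definition fundamental_cycle (n : nat) (M : topologicalType)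
    (o : M -> chain n M) (c : chain n M) : Prop :=
  boundary c = 0 /\ forall x, homologous_mod (~` [set x]) c (o x).

(* f_*[M] = d [N] in H_n(N). *)
Definition has_degree (n : nat) (M N : topologicalType)
    (oM : M -> chain n M) (oN : N -> chain n N) (f : continuousType M N)
    (d : int) : Prop :=
  exists (c : chain n M) (c' : chain n N),
    [/\ fundamental_cycle oM c, fundamental_cycle oN c'
      & homologous (pushforward f c) (d *: c')].

(* [oE] is the orientation of E induced from [oB] by the local homeomorphism
   [p]. The chain [c] represents the orientation class in H_n(U, U \ {x}), where
   [p] is injective on U, so that p_*c is a relative cycle of (B, B \ {p x}). *)
Definition orientation_preserving (n : nat) (E B : topologicalType)
    (oE : E -> chain n E) (oB : B -> chain n B) (p : continuousType E B) :
    Prop :=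
  forall x : E, exists (U : set E) (c : chain n E),
    [/\ open_nbhs x U, {in U &, injective p},
        chain_in U c & chain_in (U `\ x) (boundary c)] /\
    homologous_mod (~` [set x]) c (oE x) /\
    homologous_mod (~` [set p x]) (pushforward p c) (oB (p x)).

Definition virtually_dominates (n : nat) (M N : topologicalType)
    (oM : M -> chain n M) (oN : N -> chain n N) : Prop :=
  exists (E : topologicalType) (p : continuousType E M)
      (oE : E -> chain n E) (f : continuousType E N),
    [/\ finite_sheeted_covering p, is_orientation oE,
        orientation_preserving oE oM p
      & exists d : int, d != 0 /\ has_degree oE oN f d].

End Manifolds.

(* The group presented by involutive generators s : S, where s and t commute
   whenever r s t. Elements are words up to the congruence generated by the
   relations; the inverse of a word is its reversal. *)
Section RightAngledCoxeterGroup.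
Variables (S : choiceType) (r : rel S).

Inductive racg_eq : seq S -> seq S -> Prop :=
| RacgRefl u : racg_eq u u
| RacgSym u v : racg_eq u v -> racg_eq v u
| RacgTrans u v w : racg_eq u v -> racg_eq v w -> racg_eq u w
| RacgCat u u' v v' :
    racg_eq u u' -> racg_eq v v' -> racg_eq (u ++ v) (u' ++ v')
| RacgInvol s : racg_eq [:: s; s] [::]
| RacgComm s t : r s t -> racg_eq [:: s; t] [:: t; s].

Definition racg_rel : rel (seq S) := fun u v => `[< racg_eq u v >].

Lemma racg_rel_equiv : equiv_class_of racg_rel.
Proof.
split=> [u|u v|v u w].
- by apply/asboolP; exact: RacgRefl.
- by apply/asboolP/asboolP; exact: RacgSym.
- by move=> /asboolP uv /asboolP vw; apply/asboolP; exact: RacgTrans uv vw.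
Qed.

Canonical racg_equiv := EquivRelPack racg_rel_equiv.

Definition racg : Type := {eq_quot racg_rel}.

HB.instance Definition _ := Choice.on racg.
HB.instance Definition _ := Quotient.on racg.
HB.instance Definition _ := EqQuotient.on racg.

Lemma racg_piP (u v : seq S) : \pi_racg u = \pi_racg v <-> racg_eq u v.
Proof. by split=> [/eqmodP/asboolP//|uv]; apply/eqmodP/asboolP. Qed.

Lemma racg_reprK (u : seq S) : racg_eq (repr (\pi_racg u)) u.
Proof. by apply/racg_piP; rewrite reprK. Qed.

Definition racg_one : racg := \pi_racg [::].
Definition racg_mul (x y : racg) : racg := \pi_racg (repr x ++ repr y).
Definition racg_inv (x : racg) : racg := \pi_racg (rev (repr x)).

Lemma racg_pi_cat (u v : seq S) :
  \pi_racg (u ++ v) = racg_mul (\pi_racg u) (\pi_racg v).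
Proof.
by apply/racg_piP/RacgSym/RacgCat; exact: racg_reprK.
Qed.

Lemma racg_eq_rev_cat (u : seq S) : racg_eq (rev u ++ u) [::].
Proof.
elim: u => [|s u IH]; first exact: RacgRefl.
rewrite rev_cons cat_rcons; apply: RacgTrans IH.
apply: RacgCat; first exact: RacgRefl.
exact: (RacgCat (RacgInvol s) (RacgRefl u)).
Qed.

Lemma racg_mulA : associative racg_mul.
Proof.
elim/quotW=> x; elim/quotW=> y; elim/quotW=> z.
by rewrite -(racg_pi_cat y z) -(racg_pi_cat x y) -!racg_pi_cat catA.
Qed.

Lemma racg_mul1 : left_id racg_one racg_mul.
Proof. by elim/quotW=> x; rewrite -(racg_pi_cat [::] x). Qed.

Lemma racg_mulr1 : right_id racg_one racg_mul.
Proof. by elim/quotW=> x; rewrite -(racg_pi_cat x [::]) cats0. Qed.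

Lemma racg_mulV : left_inverse racg_one racg_inv racg_mul.
Proof.
move=> x; rewrite -{2}[x]reprK /racg_inv -(racg_pi_cat (rev (repr x))).
exact/racg_piP/racg_eq_rev_cat.
Qed.

Lemma racg_mulrV : right_inverse racg_one racg_inv racg_mul.
Proof.
move=> x; rewrite -{1}[x]reprK /racg_inv -(racg_pi_cat _ (rev (repr x))).
apply/racg_piP; rewrite -{1}[repr x]revK; exact: racg_eq_rev_cat.
Qed.

HB.instance Definition _ := isGroup.Build racg
  racg_mulA racg_mul1 racg_mulr1 racg_mulV racg_mulrV.

Definition racg_gen (s : S) : racg := \pi_racg [:: s].

End RightAngledCoxeterGroup.

Definition generated_subgroup (G : groupType) (A : set G) : set G :=
  smallest (fun H : set G => group_closed [in H]) A.

Lemma generated_subgroup1 (G : groupType) (A : set G) :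
  generated_subgroup A 1%g.
Proof. by move=> H [[H1 _] _]; exact/set_mem. Qed.

Lemma generated_subgroupF (G : groupType) (A : set G) (x y : G) :
  generated_subgroup A x -> generated_subgroup A y ->
  generated_subgroup A (x * y^-1)%g.
Proof.
move=> Ax Ay H HA; have [[_ HF] _] := HA; apply/set_mem.
by apply: HF; apply/mem_set; [exact: Ax|exact: Ay].
Qed.

Section Tomei.
Variables (R : realType) (n : nat) (eps : nat -> R).

(* Only the values eps k for 1 <= k <= n are used. *)
Definition permutahedron_parameters : Prop :=
  [/\ forall k, (1 <= k <= n)%N -> 0 < eps k, eps 1%N < 1 / 2
    & forall k, (2 <= k <= n)%N -> 2 * eps k < eps k.-1].

Definition omega := 
  {w : {set 'I_n.+1} | (w != finset.set0) && (w \proper finset.setT)}.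

(* With indices starting at 0, the coordinates of the base vertex are
   eps j - eps (j + 1), where eps 0 and eps (n + 1) are read as 1 and 0. *)
Definition permutahedron_vertex (s : {perm 'I_n.+1}) : 'rV[R]_n.+1 :=
  \row_i ((if s i == 0%N :> nat then 1 else eps (s i)) -
          (if s i == n :> nat then 0 else eps (s i).+1)).

(* The convex hull of the vertices. *)
Definition permutahedron : set 'rV[R]_n.+1 :=
  smallest (@convex_set R 'rV[R]_n.+1) (range permutahedron_vertex).

Definition facet (w : omega) : set 'rV[R]_n.+1 :=
  permutahedron `&` [set x | \sum_(i in val w) x 0 i = 1 - eps #|val w|].

Definition omega_sub : rel omega := fun w1 w2 => val w1 \subset val w2.

Definition coxeter_W : groupType := racg omega_sub.

Definition coxeter_s (w : omega) : coxeter_W := racg_gen omega_sub w.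

(* The subgroup generated by the reflections in the facets through p. *)
Definition stabilizer (p : permutahedron) : set coxeter_W :=
  generated_subgroup
    [set s | exists2 w : omega, facet w (set_val p) & s = coxeter_s w].

Definition glue_space : topologicalType :=
  (permutahedron * discrete_topology coxeter_W)%type.

Definition glue : rel glue_space := fun x y =>
  `[< x.1 = y.1 /\ stabilizer x.1 ((y.2 : coxeter_W) * (x.2 : coxeter_W)^-1)%g >].

Lemma glue_equiv_class : equiv_class_of glue.
Proof.
split=> [[p u]|[p u] [q v]|[q v] [p u] [p' w]].
- apply/asboolP; split=> //=; rewrite mulgV; exact: generated_subgroup1.
- have sym (p' q' : permutahedron) (u' v' : coxeter_W) :
      glue (p', u') (q', v') -> glue (q', v') (p', u').
    move=> /asboolP[/= <- guv]; apply/asboolP; split=> //=.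
    rewrite -invgF -[X in stabilizer _ X]mul1g.
    by apply: generated_subgroupF => //; exact: generated_subgroup1.
  by apply/idP/idP; exact: sym.
- move=> /asboolP[/= -> guv] /asboolP[/= qp' gvw]; subst p'.
  apply/asboolP; split=> //=.
  have := generated_subgroupF gvw (generated_subgroupF (@generated_subgroup1 _ _) guv).
  by rewrite mul1g invgK mulgA mulgVK.
Qed.

Canonical glue_equiv := EquivRelPack glue_equiv_class.

Definition tomei_cover : topologicalType :=
  quotient_topology {eq_quot glue}.

Definition tomei_class (p : permutahedron) (w : coxeter_W) : tomei_cover :=
  \pi_tomei_cover ((p, w) : glue_space).

(* The right action [p, w] . w' = [p, w w'], see [tomei_actE]. *)
Definition tomei_act (x : tomei_cover) (w : coxeter_W) : tomei_cover :=
  tomei_class (repr x).1 ((repr x).2 * w)%g.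

Lemma tomei_actE p w w' :
  tomei_act (tomei_class p w) w' = tomei_class p (w * w')%g.
Proof.
rewrite /tomei_act /tomei_class.
have : glue (repr (\pi_tomei_cover ((p, w) : glue_space))) (p, w).
  by apply/eqmodP; rewrite reprK.
case: (repr _) => q v /asboolP[/= qp g].
apply/eqmodP/asboolP; split=> //=.
by rewrite invgM mulgA mulgK.
Qed.

Lemma tomei_cover_ind (P : tomei_cover -> Prop) :
  (forall p w, P (tomei_class p w)) -> forall x, P x.
Proof. by move=> IH; elim/quotW=> -[p w]; exact: IH. Qed.

(* Z_2^n is 'rV['F_2]_n; a_k is the basis vector with index k - 1. [eta] is
   computed on a representative word; [eta_s] and [etaM] show that it is the
   homomorphism sending s_w to a_{|w|}. *)
Definition eta_gen (w : omega) : 'rV['F_2]_n :=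
  \row_(k < n) (k.+1 == #|val w|)%:R.

Definition eta (x : coxeter_W) : 'rV['F_2]_n :=
  \sum_(w <- repr x) eta_gen w.

Lemma eta_pi (u : seq omega) :
  eta (\pi_coxeter_W u) = \sum_(w <- u) eta_gen w.
Proof.
suff H (v v' : seq omega) : racg_eq omega_sub v v' ->
    \sum_(w <- v) eta_gen w = \sum_(w <- v') eta_gen w.
  exact/H/racg_reprK.
elim=> {v v'} // [u1 u2 u3 _ -> _ -> //|u1 u2 v1 v2 _ e _ e'|w|w1 w2 _].
- by rewrite !big_cat /= e e'.
- rewrite big_cons big_seq1 big_nil; apply/rowP => k; rewrite !mxE.
  by case: (_ == _); apply: val_inj.
- by rewrite !big_cons big_nil !addr0 addrC.
Qed.

Lemma eta_s w : eta (coxeter_s w) = eta_gen w.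
Proof. by rewrite /coxeter_s /racg_gen eta_pi big_seq1. Qed.

Lemma etaM x y : eta (x * y)%g = eta x + eta y.
Proof. by rewrite -[(x * y)%g]/(racg_mul x y) eta_pi big_cat. Qed.

Lemma eta1 : eta 1%g = 0.
Proof. by rewrite -[1%g]/(racg_one omega_sub) eta_pi big_nil. Qed.

Lemma etaV x : eta x^-1%g = - eta x.
Proof. by apply/eqP; rewrite -addr_eq0 -etaM mulVg eta1. Qed.

Definition eta_ker : set coxeter_W := [set w | eta w = 0].

Definition tomei_orbit_rel : rel tomei_cover := fun x y =>
  `[< exists2 w, eta_ker w & tomei_act x w = y >].

Lemma tomei_orbit_equiv_class : equiv_class_of tomei_orbit_rel.
Proof.
have sym x y : tomei_orbit_rel x y -> tomei_orbit_rel y x.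
  elim/tomei_cover_ind: x => p u /asboolP[w kw <-].
  apply/asboolP; exists w^-1%g; first by rewrite /eta_ker/= etaV kw oppr0.
  by rewrite !tomei_actE mulgK.
split=> [x|x y|y x z].
- elim/tomei_cover_ind: x => p u; apply/asboolP; exists 1%g; first exact: eta1.
  by rewrite tomei_actE mulg1.
- by apply/idP/idP; exact: sym.
- elim/tomei_cover_ind: x => p u /asboolP[w kw <-] /asboolP[w' kw' <-].
  apply/asboolP; exists (w * w')%g; first by rewrite /eta_ker/= etaM kw kw' addr0.
  by rewrite !tomei_actE mulgA.
Qed.

Canonical tomei_orbit_equiv := EquivRelPack tomei_orbit_equiv_class.

Definition tomei_manifold : topologicalType :=
  quotient_topology {eq_quot tomei_orbit_rel}.

End Tomei.

(* Main.v *)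
(* A space glued from permutahedra is described by a finite set of cells with
   involutions act w, one for each facet F_w, commuting for nested facets, and by
   bits recording the parity of the number of crossings of the facets F_w with
   |w| = k. The open stars of the vertices are charts, with the signed slacks of
   the facets as coordinates, and the signed sum of the cells is a cycle generating
   every local homology group, so it determines an orientation. The Tomei manifold
   is the case where a cell is determined by its bits; hence forgetting everything
   but the bits is a covering of the Tomei manifold.

   A fundamental cycle of N, once subdivided, is a signed sum of simplices phi v
   glued by involutions tau k along the faces opposite to the vertex k. Following
   Gaifullin, a cell is a simplex v together with an involution of the set of
   simplices for every facet F_w, composed of maps tau k with k outside w, and with
   bits of the right parity. Crossing F_w applies the involution of w to v and
   conjugates by it the involutions of the facets smaller than w. Collapsing each
   permutahedron to the simplex, F_w going to the face spanned by w, and applying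
   phi v is compatible with the gluing, and maps the signed sum of the cells to a
   non-zero multiple of the fundamental class. *)

Require Import Defs.
From HB Require Import structures.
From mathcomp Require Import all_boot all_order all_algebra perm.
From mathcomp Require Import all_classical all_reals all_analysis.
From mathcomp.multinomials Require Import freeg.
From mathcomp Require Import zify ring lra.

Set Implicit Arguments.
Unset Strict Implicit.
Unset Printing Implicit Defensive.

Import Order.TTheory GRing.Theory Num.Theory.
Import numFieldNormedType.Exports.

Local Open Scope classical_set_scope.
Local Open Scope ring_scope.

(** * Singular chains *)

(** The simplices of a cycle cannot themselves be the cells of a covering: the [tau k] satisfy no
    common relations, and any number of simplices may meet around a face of codimension two. In the
    permutahedron facets meet only when nested, so that commutation of two crossings is the one
    relation to enforce, and this is what the conjugation is for. The involution of F_w may use the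
    [tau k] with k outside w because these do not change [phi v] on the face spanned by w, to which
    F_w is collapsed. All families of such involutions form a finite set stable under conjugation;
    the covering is finite for this reason, and no subgroup of the Coxeter group has to be singled
    out. The parity condition prevents cancellation: all cells over v count with the sign of v, and
    their number does not depend on v. Homology is computed by hand, from cones and covers by convex
    sets. The degree of the collapse is found as in Sperner's lemma: exactly one simplex of the
    subdivided permutahedron carries all the labels. *)

Section FreeGroups.
Variables (K : choiceType).
Implicit Types (P Q : K -> Prop) (c : {freeg K / int}).

Lemma fglift_is_additive (M : lmodType int) (f : K -> M) : additive (fglift f).
Proof. exact: lift_is_additive. Qed.

HB.instance Definition _ (M : lmodType int) (f : K -> M) :=
  GRing.isAdditive.Build {freeg K / int} M (fglift f) (fglift_is_additive f).

Lemma fglift_is_scalable (M : lmodType int) (f : K -> M) : scalable (fglift f).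
Proof.
by move=> m c; rewrite -[m]intz !scaler_int raddfMz.
Qed.

HB.instance Definition _ (M : lmodType int) (f : K -> M) :=
  GRing.isScalable.Build int {freeg K / int} M *:%R (fglift f)
    (fglift_is_scalable f).

Lemma fgliftU (M : lmodType int) (f : K -> M) x : fglift f << x >> = f x.
Proof. by rewrite liftU scale1r. Qed.

Lemma freegZU (m : int) (x : K) : m *: << x >> = << m *g x >> :> {freeg K / int}.
Proof. by apply/eqP/freeg_eqP => y; rewrite coeffZ !coeffU mul1r. Qed.

Lemma freeg_sumZ c : c = \sum_(x <- dom c) coeff x c *: << x >>.
Proof. by rewrite -[LHS]freeg_sumE; apply: eq_bigr => x _; rewrite freegZU. Qed.

(** [chain_in A] is the case where [P s] says that the range of s lies in A, so the closure
    properties below apply to it by conversion. *)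
Definition csupp P c := forall x, x \in dom c -> P x.

Lemma csupp0 P : csupp P 0.
Proof. by move=> x; rewrite dom0. Qed.

Lemma csuppU P x : P x -> csupp P << x >>.
Proof. by move=> Px y; rewrite domU1 inE => /eqP ->. Qed.

Lemma csuppD P c c' : csupp P c -> csupp P c' -> csupp P (c + c').
Proof.
by move=> Pc Pc' x /domD_subset; rewrite mem_cat => /orP[/Pc|/Pc'].
Qed.

Lemma csuppZ P m c : csupp P c -> csupp P (m *: c).
Proof. by move=> Pc x /domZ_subset/Pc. Qed.

Lemma csuppN P c : csupp P c -> csupp P (- c).
Proof. by rewrite -scaleN1r; exact: csuppZ. Qed.

Lemma csuppB P c c' : csupp P c -> csupp P c' -> csupp P (c - c').
Proof. by move=> ? ?; apply: csuppD => //; exact: csuppN. Qed.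

Lemma csupp_sum P (I : Type) (r : seq I) (p : pred I) (F : I -> {freeg K / int}) :
  (forall i, p i -> csupp P (F i)) -> csupp P (\sum_(i <- r | p i) F i).
Proof.
by move=> PF; elim/big_ind: _ => //; [exact: csupp0|exact: csuppD].
Qed.

Lemma csupp_sub P Q c : (forall x, P x -> Q x) -> csupp P c -> csupp Q c.
Proof. by move=> PQ Pc x /Pc/PQ. Qed.

Lemma csupp_and P Q c : csupp P c -> csupp Q c -> csupp (fun x => P x /\ Q x) c.
Proof. by move=> Pc Qc x xc; split; [exact: Pc|exact: Qc]. Qed.

Lemma csupp_split P Q c : csupp (fun x => P x \/ Q x) c ->
  exists u v, [/\ c = u + v, csupp P u & csupp Q v].
Proof.
move=> PQ; exists (\sum_(x <- dom c | `[< P x >]) coeff x c *: << x >>).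
exists (\sum_(x <- dom c | ~~ `[< P x >]) coeff x c *: << x >>); split.
- by rewrite {1}(freeg_sumZ c) (bigID (fun x => `[< P x >])).
- by apply: csupp_sum => x /asboolP Px; apply: csuppZ; apply: csuppU.
- rewrite big_seq_cond; apply: csupp_sum => x /andP[xc /asboolP nPx].
  by apply: csuppZ; apply: csuppU; case: (PQ _ xc).
Qed.

Lemma csupp_ind P (Q : {freeg K / int} -> Prop) :
  Q 0 -> (forall c c', Q c -> Q c' -> Q (c + c')) ->
  (forall m c, Q c -> Q (m *: c)) -> (forall x, P x -> Q << x >>) ->
  forall c, csupp P c -> Q c.
Proof.
move=> Q0 QD QZ QU c Pc; rewrite (freeg_sumZ c) big_seq_cond.
by elim/big_ind: _ => // x /andP[/Pc/QU/QZ].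
Qed.

Lemma csuppT c : csupp (fun=> True) c.
Proof. by []. Qed.

Lemma eq_on_csupp (M : lmodType int) P (f g : {linear {freeg K / int} -> M}) c :
  (forall x, P x -> f << x >> = g << x >>) -> csupp P c -> f c = g c.
Proof.
move=> fg; move: c; apply: csupp_ind; first by rewrite !raddf0.
- by move=> c c' e e'; rewrite !raddfD/= e e'.
- by move=> m c e; rewrite !linearZ/= e.
- exact: fg.
Qed.

Lemma eq_on_freeg (M : lmodType int) (f g : {linear {freeg K / int} -> M}) c :
  (forall x, f << x >> = g << x >>) -> f c = g c.
Proof. by move=> fg; apply: (@eq_on_csupp _ (fun=> True)) => // x _. Qed.

End FreeGroups.

Lemma csupp_linear (K L : choiceType) (P : K -> Prop) (Q : L -> Prop)
    (f : {linear {freeg K / int} -> {freeg L / int}}) c :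
  (forall x, P x -> csupp Q (f << x >>)) -> csupp P c -> csupp Q (f c).
Proof.
move=> PQ; move: c; apply: csupp_ind.
- by rewrite raddf0; exact: csupp0.
- by move=> c c'; rewrite raddfD; exact: csuppD.
- by move=> m c; rewrite linearZ; exact: csuppZ.
- exact: PQ.
Qed.

(** Behind the vanishing of the double boundary: a pair of indices records two deleted vertices in
    their order of deletion. *)
Lemma sum_antisym (V : zmodType) (n : nat) (F : 'I_n -> 'I_n -> V) :
  (forall i j, i != j -> F i j = - F j i) ->
  \sum_i \sum_(j | j != i) F i j = 0.
Proof.
move=> FN; rewrite pair_big_dep/= (bigID (fun p : 'I_n * 'I_n => (p.1 < p.2)%N))/=.
apply/eqP; rewrite addr_eq0; apply/eqP.
rewrite (reindex (fun p => (p.2, p.1)))/=; last first.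
  by exists (fun p => (p.2, p.1)) => -[].
rewrite -sumrN; apply: eq_big => [[i j]/=|[i j]/= /andP[ij _]].
  by rewrite -!val_eqE/=; case: ltngtP.
by rewrite FN// eq_sym.
Qed.

Arguments boundary : simpl never.

(** * Faces and the boundary operator *)

Section Chains.
Variable R : realType.

Local Notation chain := (chain R).
Local Notation simplex := (singular_simplex R).
Local Notation Delta k := (@std_simplex R k).

Lemma face_map_lift k (i : 'I_k.+2) (x : 'rV[R]_k.+1) j :
  face_map i x 0 (fintype.lift i j) = x 0 j.
Proof. by rewrite mxE liftK. Qed.

Lemma face_map_eq k (i : 'I_k.+2) (x : 'rV[R]_k.+1) : face_map i x 0 i = 0.
Proof. by rewrite mxE unlift_none. Qed.

Lemma val_face k (i : 'I_k.+2) (x : Delta k) :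
  set_val (face i x) = face_map i (set_val x).
Proof. by []. Qed.

(** When j is deleted after i, the same face arises by deleting [fintype.lift i j] first;
    [swap_face i j] is the index that i then has. *)
Definition swap_face k (i : 'I_k.+2) (j : 'I_k.+1) : 'I_k.+1 := inord (unbump j i).

Lemma val_swap_face k (i : 'I_k.+2) (j : 'I_k.+1) :
  swap_face i j = unbump j i :> nat.
Proof.
rewrite inordK// /unbump; have := ltn_ord i; have := ltn_ord j.
by case: (ltnP j i) => /=; rewrite ?subn1 ?subn0//; lia.
Qed.

Lemma lift_lift_swap k (i : 'I_k.+3) (j : 'I_k.+2) (e : 'I_k.+1) :
  fintype.lift i (fintype.lift j e) =
  fintype.lift (fintype.lift i j) (fintype.lift (swap_face i j) e).
Proof. by apply: val_inj; rewrite /= val_swap_face bumpC. Qed.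

Lemma lift_swap_face k (i : 'I_k.+2) (j : 'I_k.+1) :
  fintype.lift (fintype.lift i j) (swap_face i j) = i.
Proof.
apply: val_inj; rewrite /= val_swap_face /bump /unbump.
by case: (ltngtP j i) => /=; rewrite ?subn0 ?subn1; lia.
Qed.

Lemma face_map_face k (i : 'I_k.+3) (j : 'I_k.+2) (x : 'rV[R]_k.+1) :
  face_map i (face_map j x) = face_map (fintype.lift i j) (face_map (swap_face i j) x).
Proof.
apply/rowP => c; case: (unliftP i c) => [d|] ->; last first.
  by rewrite face_map_eq -{3}(lift_swap_face i j) face_map_lift face_map_eq.
rewrite face_map_lift; case: (unliftP j d) => [e|] ->; last by rewrite !face_map_eq.
by rewrite face_map_lift lift_lift_swap !face_map_lift.
Qed.

Lemma face_face k (i : 'I_k.+3) (j : 'I_k.+2) (x : Delta k) :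
  face i (face j x) = face (fintype.lift i j) (face (swap_face i j) x).
Proof. by apply: val_inj; exact: face_map_face. Qed.

Section Space.
Variable X : topologicalType.

Lemma boundary_is_linear k : linear (@boundary R k X).
Proof.
case: k => [|k] m c c'; first by rewrite /= scaler0 addr0.
exact: linearP.
Qed.

HB.instance Definition _ k :=
  GRing.isLinear.Build int (chain k X) (chain k.-1 X) *:%R (@boundary R k X)
    (@boundary_is_linear k).

Definition sface k (i : 'I_k.+2) (s : simplex k.+1 X) : simplex k X := s \o @face R k i.

Lemma boundaryU k (s : simplex k.+1 X) :
  boundary << s >> = \sum_(i < k.+2) (-1) ^+ i *: << sface i s >>.
Proof. exact: fgliftU. Qed.

Lemma sface_sface k (i : 'I_k.+3) (j : 'I_k.+2) (s : simplex k.+2 X) :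
  sface j (sface i s) = sface (swap_face i j) (sface (fintype.lift i j) s).
Proof. by apply/continuousEP => x; rewrite /= face_face. Qed.

Lemma boundaryK k (c : chain k.+2 X) : boundary (boundary c) = 0.
Proof.
pose f : {linear chain k.+2 X -> chain k X} := @boundary R k.+1 X \o @boundary R k.+2 X.
rewrite -[LHS]/(f c).
rewrite (eq_on_freeg (g := \0 : {linear chain k.+2 X -> chain k X}))// => s.
rewrite /f/= boundaryU linear_sum /=.
(* The signed face obtained by deleting a, then b, both numbered in the full simplex; 0 is a dummy
   value for a = b. *)
pose F (a b : 'I_k.+3) : chain k X :=
  if unlift a b is Some j then
    (-1) ^+ (a + j) *: << sface j (sface a s) >> else 0.
rewrite [LHS](_ : _ = \sum_a \sum_(b | b != a) F a b).
  apply: sum_antisym => a b; rewrite eq_sym => ab; rewrite /F.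
  case: (unliftP a b) ab => [j ->|->]; last by rewrite eqxx.
  move=> _; have := liftK (fintype.lift a j) (swap_face a j).
  rewrite lift_swap_face => ->; rewrite -sface_sface -scaleNr; congr (_ *: _).
  rewrite -[RHS]mulN1r -exprS -signr_odd -[RHS]signr_odd; congr (_ ^+ _).
  rewrite val_swap_face /= /bump /unbump.
  by case: (leqP a j) => aj /=; rewrite ?subn0 ?subn1 ?add0n ?add1n; congr (nat_of_bool _); lia.
apply: eq_bigr => a _; rewrite linearZ /= boundaryU scaler_sumr.
rewrite [RHS](reindex (fintype.lift a)); last first.
  exists (fun b => odflt ord0 (unlift a b)) => b; rewrite inE => ab.
    by rewrite liftK.
  by case: unliftP ab => [b' -> //|->]; rewrite eqxx.
apply: eq_big => [j|j _]; first by rewrite eq_sym neq_lift.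
by rewrite /F liftK scalerA exprD.
Qed.

End Space.

End Chains.

(* Instance resolution does not see through the topology of a subtype. *)
#[export] Hint Extern 100 (Filter (nbhs_of_open _ _)) => (apply: nbhs_filter) : typeclass_instances.

Section Topology.

Lemma cvg_set_type (X : Type) (T : topologicalType) (A : set T) (f : X -> A)
    (F : set_system X) (a : A) :
  Filter F -> set_val (f x) @[x --> F] --> set_val a -> f x @[x --> F] --> a.
Proof.
move=> FF fa U; rewrite nbhsE => -[V [[W oW WV] Va] VU].
have /fa : nbhs (set_val a) W.
  by apply: open_nbhs_nbhs; split=> //; move: Va; rewrite -WV.
by apply: (@filterS _ F FF) => x Wx; apply: VU; rewrite -WV.
Qed.

Lemma continuous_at_set_type (X T : topologicalType) (A : set T) (f : X -> A) (x : X) :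
  set_val (f y) @[y --> x] --> set_val (f x) -> {for x, continuous f}.
Proof. by move=> fx; apply: (@cvg_set_type _ _ _ _ _ _ (nbhs_filter x)). Qed.

Lemma set_val_continuous (T : topologicalType) (A : set T) :
  continuous (set_val : A -> T).
Proof. exact: initial_continuous. Qed.

Lemma within_continuous_comp (X Y Z : topologicalType) (A : set Y) (f : Y -> Z)
    (g : X -> Y) :
  {within A, continuous f} -> continuous g -> range g `<=` A ->
  continuous (f \o g).
Proof.
move=> /subspace_continuousP fA gc gA x U /(fA _ (gA _ (imageP g I))) AU.
have := gc x _ AU; apply: (@filterS _ _ (nbhs_filter x)) => y /=; apply; exact: gA (imageP g I).
Qed.

Lemma compact_set_type (T : topologicalType) (A : set T) :
  compact A -> compact [set: A].
Proof.
move=> cA F FF _.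
have [|x [Ax xF]] := cA (set_val @ F) _.
  by apply: (@filterS _ F _ setT); [move=> x _; exact: set_valP|exact: filterT].
exists (SigSub (mem_set Ax)); split => // B C FB.
rewrite nbhsE => -[V [[W oW WV] Vx] VC].
have /xF/(_ _) : (set_val @ F) (set_val @` B).
  by apply: (@filterS _ F _ B) => // y By; exists y.
move=> /(_ W); case.
  by apply: open_nbhs_nbhs; split=> //; move: Vx; rewrite -WV.
by move=> _ [[y By <-] Wy]; exists y; split=> //; apply: VC; rewrite -WV.
Qed.

Lemma cvg_rV (R : realType) (X : Type) d (f : X -> 'rV[R]_d)
    (F : set_system X) {FF : Filter F} (l : 'rV[R]_d) :
  (forall j, f x 0 j @[x --> F] --> l 0 j) -> f x @[x --> F] --> l.
Proof.
move=> fl U [P lP PU].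
apply: (@filterS _ F FF [set x | forall j, P 0 j (f x 0 j)]).
  by move=> x xP; apply: PU => i j; rewrite ord1.
by apply: (@filter_forall _ _ (fun j x => P 0 j (f x 0 j))) => j; exact: (fl j _ (lP 0 j)).
Qed.

Lemma continuous_at_rV (R : realType) (X : topologicalType) d (f : X -> 'rV[R]_d) (x : X) :
  (forall j, {for x, continuous (fun y => f y 0 j)}) -> {for x, continuous f}.
Proof. by move=> fx; exact: (@cvg_rV _ _ _ _ _ (nbhs_filter x)). Qed.

End Topology.

(* Locked, because unification otherwise compares the topologies of the targets. *)
HB.lock Definition push (R : realType) (X Y : topologicalType) (f : X -> Y) k :
    chain R k X -> chain R k Y :=
  fglift (fun s : singular_simplex R k X =>
    if pselect (continuous (f \o s)) is left h then
      << (mkcts h : singular_simplex R k Y) >> else 0).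
Arguments push {R X Y} f {k}.

Section Push.
Variable R : realType.
Local Notation chain := (chain R).
Local Notation simplex := (singular_simplex R).

Lemma push_is_linear X Y f k : linear (@push R X Y f k).
Proof. by rewrite push.unlock; exact: linearP. Qed.

HB.instance Definition _ X Y f k :=
  GRing.isLinear.Build int (chain k X) (chain k Y) *:%R (@push R X Y f k)
    (@push_is_linear X Y f k).

Lemma pushU (X Y : topologicalType) (f : X -> Y) k (s : simplex k X) (t : simplex k Y) :
  f \o s =1 t -> push f << s >> = << t >>.
Proof.
move=> fst; rewrite push.unlock fgliftU; case: pselect => [h|h].
  by congr (<< _ >>); apply/continuousEP => x; exact: fst.
by exfalso; apply: h; rewrite (funext fst); exact: cts_fun.
Qed.

Lemma csupp_push (X Y : topologicalType) (f : X -> Y) k (P : simplex k X -> Prop)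
    (Q : simplex k Y -> Prop) c :
  (forall (s : simplex k X) (t : simplex k Y), P s -> f \o s =1 t -> Q t) ->
  csupp P c -> csupp Q (push f c).
Proof.
move=> PQ; apply: csupp_linear => s Ps; rewrite /= push.unlock fgliftU.
case: pselect => [h|h]; last exact: csupp0.
by apply: csuppU; exact: PQ Ps _.
Qed.

Lemma chain_in_push (X Y : topologicalType) (f : X -> Y) k (A : set X) (B : set Y)
    (c : chain k X) :
  (forall x, A x -> B (f x)) -> chain_in A c -> chain_in B (push f c).
Proof.
move=> AB; apply: csupp_push => s t As st _ [x _ <-].
by rewrite -st; apply: AB; apply: As; exact: imageP.
Qed.

Lemma range_sface (X : topologicalType) k (i : 'I_k.+2) (s : simplex k.+1 X) :
  range (sface i s) `<=` range s.
Proof. by move=> _ [x _ <-]; exists (face i x). Qed.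

Lemma csupp_boundary (X : topologicalType) k (P : forall k, simplex k X -> Prop) :
  (forall k i (s : simplex k.+1 X), P k.+1 s -> P k (sface i s)) ->
  forall c : chain k X, csupp (P k) c -> csupp (P k.-1) (boundary c).
Proof.
move=> Pf; case: k => [|k] c; first by move=> _; exact: csupp0.
apply: csupp_linear => s Ps; rewrite /= boundaryU.
by apply: csupp_sum => i _; apply: csuppZ; apply: csuppU; exact: Pf.
Qed.

Lemma chain_in_boundary (X : topologicalType) k (A : set X) (c : chain k X) :
  chain_in A c -> chain_in A (boundary c).
Proof.
apply: (@csupp_boundary X k (fun k s => range s `<=` A)) => k' i s sA.
exact: subset_trans (@range_sface _ _ i s) sA.
Qed.

Lemma push_lift (X Y : topologicalType) (f : X -> Y) (A : set X) k (s : simplex k X) :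
  {within A, continuous f} -> range s `<=` A ->
  exists t : simplex k Y, f \o s =1 t.
Proof.
move=> fA sA; have h := within_continuous_comp fA (@cts_fun _ _ s) sA.
by exists (mkcts h).
Qed.

(** [push] sends a simplex with discontinuous image to 0, while faces of that simplex may well have
    a continuous image. Hence the restriction to chains in a set on which f is continuous. *)
Lemma boundary_push (X Y : topologicalType) (f : X -> Y) (A : set X) k (c : chain k X) :
  {within A, continuous f} -> chain_in A c ->
  boundary (push f c) = push f (boundary c).
Proof.
move=> fA; case: k c => [|k] c; first by rewrite /= raddf0.
pose g1 : {linear chain k.+1 X -> chain k Y} := @boundary R k.+1 Y \o @push R X Y f k.+1.
pose g2 : {linear chain k.+1 X -> chain k Y} := @push R X Y f k \o @boundary R k.+1 X.
apply: (@eq_on_csupp _ _ _ g1 g2) => s sA; rewrite /g1/g2/=.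
have [t st] := push_lift fA sA.
rewrite (pushU st) !boundaryU linear_sum; apply: eq_bigr => i _.
by rewrite linearZ/= (@pushU _ _ _ _ _ (sface i t))// => x /=; rewrite -st.
Qed.

Lemma push_comp (X Y Z : topologicalType) (f : X -> Y) (g : Y -> Z) (A : set X)
    (B : set Y) k (c : chain k X) :
  {within A, continuous f} -> {within B, continuous g} ->
  (forall x, A x -> B (f x)) -> chain_in A c ->
  push g (push f c) = push (g \o f) c.
Proof.
move=> fA gB AB.
pose g1 : {linear chain k X -> chain k Z} := @push R Y Z g k \o @push R X Y f k.
apply: (@eq_on_csupp _ _ _ g1 (push (g \o f))) => s sA; rewrite /g1/=.
have [t st] := push_lift fA sA.
have [|u tu] := @push_lift _ _ g B _ t gB.
  by move=> _ [x _ <-]; rewrite -st; apply: AB; apply: sA; exact: imageP.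
by rewrite (pushU st) (pushU tu) (@pushU _ _ _ _ _ u)// => x; rewrite -tu /= -st.
Qed.

Lemma eq_push (X Y : topologicalType) (f g : X -> Y) (A : set X) k (c : chain k X) :
  {within A, continuous f} -> (forall x, A x -> f x = g x) -> chain_in A c ->
  push f c = push g c.
Proof.
move=> fA fg; apply: (@eq_on_csupp _ _ _ (push f) (push g)) => s sA.
have [t st] := push_lift fA sA.
rewrite /= (pushU st) (@pushU _ _ _ _ _ t)// => x.
by rewrite -st /= fg//; apply: sA; exact: imageP.
Qed.

Lemma push_id (X : topologicalType) k (c : chain k X) : push id c = c.
Proof.
by apply: (@eq_on_freeg _ _ (push id) idfun) => s; rewrite /= (@pushU _ _ _ _ _ s).
Qed.

Lemma pushforwardE (X Y : topologicalType) (f : continuousType X Y) k (c : chain k X) :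
  Defs.pushforward f c = push f c.
Proof.
apply: (@eq_on_freeg _ _ (fglift _) (push f)) => s.
by rewrite /= fgliftU (@pushU _ _ _ _ _ (f \o s : simplex k Y)).
Qed.

Lemma push_eq_id (X : topologicalType) (f : X -> X) (A : set X) k (c : chain k X) :
  {within A, continuous f} -> (forall x, A x -> f x = x) -> chain_in A c -> push f c = c.
Proof. by move=> fA fid cA; rewrite (eq_push fA fid cA) push_id. Qed.

Lemma cont_within (X Y : topologicalType) (f : X -> Y) (A : set X) :
  continuous f -> {within A, continuous f}.
Proof. exact: continuous_subspaceT. Qed.
#[global] Arguments cont_within {X Y f} A _.

Lemma chain_inT (X : topologicalType) k (c : chain k X) : chain_in [set: X] c.
Proof. by []. Qed.

Lemma chain_in_sub (X : topologicalType) k (A B : set X) (c : chain k X) :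
  A `<=` B -> chain_in A c -> chain_in B c.
Proof. by move=> AB; apply: csupp_sub => s /subset_trans; exact. Qed.

Lemma degZ (X : topologicalType) m (u : chain 0 X) : deg (m *: u) = m * deg u.
Proof. by rewrite -[m in LHS]intz scaler_int raddfMz/= -mulrzl intz. Qed.

(** [deg], the sum of the coefficients, serves as the augmentation of 0-chains. *)
Lemma deg_boundary (X : topologicalType) (c : chain 1 X) : deg (boundary c) = 0.
Proof.
have := @csuppT _ c; move: c; apply: csupp_ind => [|c c'|m c|s _].
- by rewrite !raddf0.
- by rewrite !raddfD/= => -> ->.
- by rewrite linearZ/= degZ => ->; rewrite mulr0.
- rewrite boundaryU !big_ord_recl big_ord0 raddfD/= raddfD/= !degZ !degU raddf0.
  by rewrite addr0 !mulr1 expr0 [X in _ + X](_ : _ = -1) ?subrr// expr1.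
Qed.

Lemma boundary0 (X : topologicalType) (c : chain 0 X) : boundary c = 0.
Proof. by []. Qed.

Lemma boundary_boundary (X : topologicalType) k (c : chain k X) : boundary (boundary c) = 0.
Proof. by case: k c => [|[|k]] c; [rewrite !boundary0|rewrite boundary0|exact: boundaryK]. Qed.

Lemma chain_inD (X : topologicalType) k (A : set X) (c c' : chain k X) :
  chain_in A c -> chain_in A c' -> chain_in A (c + c').
Proof. exact: csuppD. Qed.

Lemma chain_inB (X : topologicalType) k (A : set X) (c c' : chain k X) :
  chain_in A c -> chain_in A c' -> chain_in A (c - c').
Proof. exact: csuppB. Qed.

Lemma chain_inN (X : topologicalType) k (A : set X) (c : chain k X) :
  chain_in A c -> chain_in A (- c).
Proof. exact: csuppN. Qed.

Lemma chain_inZ (X : topologicalType) k (A : set X) m (c : chain k X) :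
  chain_in A c -> chain_in A (m *: c).
Proof. exact: csuppZ. Qed.

Lemma chain_inU (X : topologicalType) k (A : set X) (s : simplex k X) :
  range s `<=` A -> chain_in A << s >>.
Proof. by move=> sA t; rewrite domU1 inE => /eqP ->. Qed.

Lemma boundary_pushT (X Y : topologicalType) (f : X -> Y) k (c : chain k X) :
  continuous f -> boundary (push f c) = push f (boundary c).
Proof. by move=> fc; exact: (boundary_push (cont_within setT fc) (@chain_inT _ _ c)). Qed.

Lemma boundaryB (X : topologicalType) k (c c' : chain k X) :
  boundary (c - c') = boundary c - boundary c'.
Proof. exact: linearB. Qed.

Lemma boundaryD (X : topologicalType) k (c c' : chain k X) :
  boundary (c + c') = boundary c + boundary c'.
Proof. exact: linearD. Qed.

Lemma boundaryZ (X : topologicalType) k m (c : chain k X) :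
  boundary (m *: c) = m *: boundary c.
Proof. exact: linearZ. Qed.

Lemma pushB (X Y : topologicalType) (f : X -> Y) k (c c' : chain k X) :
  push f (c - c') = push f c - push f c'.
Proof. exact: linearB. Qed.

Lemma pushD (X Y : topologicalType) (f : X -> Y) k (c c' : chain k X) :
  push f (c + c') = push f c + push f c'.
Proof. exact: linearD. Qed.

Lemma pushZ (X Y : topologicalType) (f : X -> Y) k m (c : chain k X) :
  push f (m *: c) = m *: push f c.
Proof. exact: linearZ. Qed.

End Push.

Lemma cvg_bigsum (R : realType) (X I : Type) (F : set_system X) {FF : Filter F}
    (r : seq I) (P : pred I) (f : I -> X -> R) (l : I -> R) :
  (forall i, f i x @[x --> F] --> l i) ->
  \sum_(i <- r | P i) f i x @[x --> F] --> \sum_(i <- r | P i) l i.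
Proof.
move=> fl; elim: r => [|i r IH].
  by rewrite big_nil; under eq_cvg do rewrite big_nil; exact: cvg_cst.
rewrite big_cons; under eq_cvg do rewrite big_cons.
by case: (P i) => //; apply: cvgD => //; exact: fl.
Qed.

(** * Cones and affine simplices *)

Section Simplex.
Variable R : realType.
Local Notation chain := (chain R).
Local Notation simplex := (singular_simplex R).
Local Notation Delta k := (@std_simplex R k).

Lemma Delta_ge0 k (x : Delta k) j : 0 <= set_val x 0 j.
Proof. by have [+ _] := set_valP x; exact. Qed.

Lemma Delta_sum k (x : Delta k) : \sum_j set_val x 0 j = 1.
Proof. by have [] := set_valP x. Qed.

Lemma Delta_le1 k (x : Delta k) j : set_val x 0 j <= 1.
Proof.
rewrite -(Delta_sum x) (bigD1 j)//= lerDl; apply: sumr_ge0 => i _.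
exact: Delta_ge0.
Qed.

Lemma Delta_coord_continuous k (j : 'I_k.+1) :
  continuous (fun x : Delta k => set_val x 0 j).
Proof.
move=> x; apply: (@continuous_comp _ _ _ set_val (fun y : 'rV[R]_k.+1 => y 0 j)).
  exact: set_val_continuous.
exact: coord_continuous.
Qed.

Lemma std_simplex_compact k : compact (Delta k).
Proof.
have cA : compact [set v : 'rV[R]_k.+1 | forall i, `[0 : R, 1]%classic (v ord0 i)].
  by apply: (@rV_compact _ _ (fun=> `[0 : R, 1]%classic)) => i; exact: segment_compact.
have cB : closed [set v : 'rV[R]_k.+1 | \sum_i v 0 i = 1].
  apply: (@preimage_closed _ _ (fun v : 'rV[R]_k.+1 => \sum_i v 0 i) [set 1]).
    move=> v _; apply: (@cvg_bigsum R _ _ (nbhs v) _ _ _ (fun i v => v 0 i)) => i.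
    exact: coord_continuous.
  exact: closed_eq.
have -> : Delta k = [set v : 'rV[R]_k.+1 | forall i, `[0 : R, 1]%classic (v ord0 i)] `&`
    [set v : 'rV[R]_k.+1 | \sum_i v 0 i = 1].
  apply/seteqP; split=> v [v0 v1]; split=> // i.
    rewrite /= in_itv/= v0/= -[leRHS]v1 (bigD1 i)//= lerDl.
    by apply: sumr_ge0 => j _; exact: v0.
  by have := v0 i; rewrite /= in_itv/= => /andP[].
exact: compact_closedI.
Qed.

Lemma Delta_compact k : compact [set: Delta k].
Proof. exact/compact_set_type/std_simplex_compact. Qed.

Lemma range_simplex_compact k (X : topologicalType) (s : simplex k X) :
  compact (range s).
Proof.
apply: continuous_compact; last exact: Delta_compact.
by apply: continuous_subspaceT; exact: cts_fun.
Qed.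

Lemma vertex_in k (i : 'I_k.+1) : (delta_mx 0 i : 'rV[R]_k.+1) \in Delta k.
Proof.
apply/mem_set; split=> [j|]; first by rewrite mxE ler0n.
rewrite (bigD1 i)//= mxE !eqxx/= big1 ?addr0// => j ji.
by rewrite mxE (negbTE ji) andbF.
Qed.

Definition vertex k (i : 'I_k.+1) : Delta k := SigSub (vertex_in i).

Definition cone_base0 k (x : 'rV[R]_k.+2) : 'rV[R]_k.+1 :=
  \row_j (x 0 (fintype.lift ord0 j) / (1 - x 0 0)).

Lemma cone_base0E k (x : 'rV[R]_k.+2) j :
  cone_base0 x 0 j = x 0 (fintype.lift ord0 j) / (1 - x 0 0).
Proof. by rewrite mxE. Qed.

(** Projection from the vertex 0 to the opposite face. At the vertex itself the quotients are 0 by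
    convention, which is no point of the simplex, and [insubd] returns [vertex ord0]. *)
Definition cone_base k (x : Delta k.+1) : Delta k :=
  insubd (vertex ord0) (cone_base0 (set_val x)).

Lemma Delta_sum_lift k (x : Delta k.+1) :
  \sum_j set_val x 0 (fintype.lift ord0 j) = 1 - set_val x 0 0.
Proof. by have := Delta_sum x; rewrite big_ord_recl => <-; rewrite addrAC subrr add0r. Qed.

Lemma val_cone_base k (x : Delta k.+1) : set_val x 0 0 != 1 ->
  set_val (cone_base x) = cone_base0 (set_val x).
Proof.
move=> x1; rewrite set_valE /cone_base insubdK// inE; split=> [j|].
  by rewrite mxE divr_ge0 ?Delta_ge0// subr_ge0 Delta_le1.
under eq_bigr do rewrite mxE.
by rewrite -mulr_suml Delta_sum_lift mulfV// subr_eq0 eq_sym.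
Qed.

Lemma cone_base_continuous k (x : Delta k.+1) : set_val x 0 0 != 1 ->
  {for x, continuous (@cone_base k)}.
Proof.
move=> x1; apply: continuous_at_set_type; rewrite val_cone_base//.
have c0 := @Delta_coord_continuous k.+1 0.
apply: (@cvg_trans _ (cone_base0 (set_val y) @[y --> x])).
  apply: near_eq_cvg.
  have : \forall y \near x, set_val (y : Delta k.+1) 0 0 != 1.
    have cc : 1 - set_val (y : Delta k.+1) 0 0 @[y --> x] --> 1 - set_val x 0 0.
      by apply: cvgB; [exact: cvg_cst|exact: c0].
    have := cvgr_neq0 _ cc; rewrite subr_eq0 eq_sym => /(_ _ x1).
    by apply: filterS => y; rewrite subr_eq0 eq_sym.
  by apply: filterS => y y1; rewrite val_cone_base.
apply: (@continuous_at_rV _ _ _ (fun y : Delta k.+1 => cone_base0 (set_val y))) => j.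
rewrite /prop_for/continuous_at mxE; under eq_cvg do rewrite mxE.
apply: cvgM; first exact: (@Delta_coord_continuous k.+1 (fintype.lift ord0 j) x).
apply: cvgV; first by rewrite subr_eq0 eq_sym.
by apply: cvgB; [exact: cvg_cst|exact: c0].
Qed.

Section Cone.
Variable d : nat.
Local Notation V := 'rV[R]_d.

Definition cone_fun (p : V) k (s : simplex k V) (x : Delta k.+1) : V :=
  p + (1 - set_val x 0 0) *: (s (cone_base x) - p).

Lemma cone_fun_continuous p k (s : simplex k V) : continuous (cone_fun p s).
Proof.
move=> x; have c0 := @Delta_coord_continuous k.+1 0 x.
rewrite /continuous_at; have [x1|x1] := eqVneq (set_val x 0 0) 1; last first.
  apply: cvgD; first exact: cvg_cst.
  apply: cvgZ; first by apply: cvgB; [exact: cvg_cst|exact: c0].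
  apply: cvgB; last exact: cvg_cst.
  apply: (@continuous_comp _ _ _ (@cone_base k) s); first exact: cone_base_continuous.
  exact: cts_fun.
rewrite /cone_fun x1 subrr scale0r addr0.
(* At the apex [cone_base] may be discontinuous, but its factor [1 - x 0 0] tends to 0 and s is
   bounded on the compact simplex. *)
have [M [_ /(_ (`|M| + 1))MP]] := compact_bounded (@range_simplex_compact _ _ s).
have {}MP y : `|s y - p| <= `|M| + 1 + `|p|.
  rewrite (le_trans (ler_normB _ _))// lerD2r; apply: MP; last exact: imageP.
  by rewrite (le_lt_trans (ler_norm M))// ltrDl.
have C0 : 0 < `|M| + 1 + `|p| by rewrite ltr_wpDr// ltr_wpDl.
apply/cvgrPdist_lt => e e0.
have : \forall y \near x, `|1 - set_val (y : Delta k.+1) 0 0| < e / (`|M| + 1 + `|p|).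
  by have /cvgrPdist_lt/(_ _ (divr_gt0 e0 C0)) := c0; rewrite x1.
apply: filterS => y ye; rewrite opprD addrA subrr add0r normrN normrZ.
rewrite (le_lt_trans (ler_wpM2l _ (MP _)))// -ltr_pdivlMr//.
Qed.

Definition cone_simplex p k (s : simplex k V) : simplex k.+1 V :=
  mkcts (@cone_fun_continuous p k s).

Fact cone_key : unit. Proof. exact: tt. Qed.

Definition cone p k : chain k V -> chain k.+1 V :=
  locked_with cone_key (fglift (fun s => << cone_simplex p s >>)).

Lemma cone_is_linear p k : linear (@cone p k).
Proof. by rewrite /cone locked_withE; exact: linearP. Qed.

HB.instance Definition _ p k :=
  GRing.isLinear.Build int (chain k V) (chain k.+1 V) *:%R (@cone p k) (@cone_is_linear p k).

Lemma coneU p k (s : simplex k V) : cone p << s >> = << cone_simplex p s >>.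
Proof. by rewrite /cone locked_withE; exact: fgliftU. Qed.

Lemma sface0_cone p k (s : simplex k V) : sface ord0 (cone_simplex p s) = s.
Proof.
apply/continuousEP => x; rewrite /= /mkcts /cone_fun.
have e0 : set_val (face ord0 x) 0 0 = 0 by exact: face_map_eq.
rewrite e0 subr0 scale1r addrC subrK; congr (s _).
apply: val_inj.
have : set_val (cone_base (face ord0 x)) = set_val x; last by [].
rewrite val_cone_base; last by rewrite e0 eq_sym oner_eq0.
apply/rowP => j.
by rewrite mxE e0 subr0 divr1; exact: face_map_lift.
Qed.

Lemma lift_lift0 k (i : 'I_k.+2) (j : 'I_k.+1) :
  fintype.lift (fintype.lift ord0 i) (fintype.lift ord0 j) =
  fintype.lift ord0 (fintype.lift i j).
Proof. by apply: val_inj; rewrite /= /bump /=; lia. Qed.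

Lemma sfaceS_cone p k (i : 'I_k.+2) (s : simplex k.+1 V) :
  sface (fintype.lift ord0 i) (cone_simplex p s) = cone_simplex p (sface i s).
Proof.
apply/continuousEP => x; rewrite /= /mkcts /cone_fun.
have e0 : set_val (face (fintype.lift ord0 i) x) 0 0 = set_val x 0 0.
  have l0 : fintype.lift (fintype.lift ord0 i) ord0 = 0 by apply: val_inj.
  by rewrite -[X in _ X = _]l0; exact: face_map_lift.
rewrite e0; have [->|x1] := eqVneq (set_val x 0 0) 1; first by rewrite subrr !scale0r.
congr (_ + _ *: (s _ - _)); apply: val_inj.
have : set_val (cone_base (face (fintype.lift ord0 i) x)) = set_val (face i (cone_base x));
  last by [].
rewrite val_cone_base ?e0// [in RHS]val_face val_cone_base//; apply/rowP => j.
rewrite cone_base0E e0; case: (unliftP i j) => [j' ->|->].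
  rewrite face_map_lift cone_base0E; congr (_ / _); rewrite -lift_lift0; exact: face_map_lift.
by rewrite face_map_eq [X in X / _](_ : _ = 0) ?mul0r//; exact: face_map_eq.
Qed.

Lemma boundary_cone p k (c : chain k.+1 V) :
  boundary (cone p c) = c - cone p (boundary c).
Proof.
pose g1 : {linear chain k.+1 V -> chain k.+1 V} := @boundary R k.+2 V \o @cone p k.+1.
pose g2 : {linear chain k.+1 V -> chain k.+1 V} :=
  idfun \- (@cone p k \o @boundary R k.+1 V).
apply: (@eq_on_freeg _ _ g1 g2) => s; rewrite /g1/g2/= coneU !boundaryU big_ord_recl.
rewrite expr0 scale1r sface0_cone linear_sum -sumrN; congr (_ + _).
apply: eq_bigr => i _; rewrite linearZ/= coneU sfaceS_cone.
by rewrite -scaleNr -[RHS]/(_ *: _) /= /bump/= exprS mulN1r.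
Qed.

Lemma boundary_cone_cycle p k (c : chain k.+1 V) :
  boundary c = 0 -> boundary (cone p c) = c.
Proof. by move=> c0; rewrite boundary_cone c0 [cone p 0]linear0 subr0. Qed.

Definition const_simplex (p : V) : simplex 0 V := cst p.

Lemma boundary_cone0 p (c : chain 0 V) :
  boundary (cone p c) = c - deg c *: << const_simplex p >>.
Proof.
have := @csuppT _ c; move: c; apply: csupp_ind => [|c c'|m c|s _].
- by rewrite !raddf0 scale0r subr0.
- by rewrite !raddfD/= => -> ->; rewrite addrACA -opprD -scalerDl.
- by move=> IH; rewrite linearZ/= linearZ/= IH degZ scalerBr scalerA.
rewrite coneU boundaryU !big_ord_recl big_ord0 addr0 expr0 scale1r sface0_cone.
rewrite degU scale1r; congr (_ + _).
rewrite [_ ^+ _](_ : _ = -1) ?expr1// scaleN1r; congr (- << _ >>).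
apply/continuousEP => x; rewrite /= /mkcts /cone_fun /cst.
rewrite [X in 1 - X](_ : _ = 1) ?subrr ?scale0r ?addr0//.
have l0 : fintype.lift (fintype.lift ord0 ord0) ord0 = 0 :> 'I_2 by apply: val_inj.
rewrite -[X in _ X = _]l0 [LHS]face_map_lift -(Delta_sum x) big_ord_recl big_ord0 addr0.
by [].
Qed.

Definition star_shaped (p : V) (A : set V) :=
  forall x t, A x -> 0 <= t -> t <= 1 -> A (p + t *: (x - p)).

Lemma cone_simplex_in p k (s : simplex k V) (A : set V) :
  star_shaped p A -> range s `<=` A -> range (cone_simplex p s) `<=` A.
Proof.
move=> pA sA _ [x _ <-]; apply: pA; first exact: sA (imageP _ I).
- by rewrite subr_ge0 Delta_le1.
- by rewrite lerBlDr lerDl Delta_ge0.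
Qed.

Lemma csupp_cone p k (P : simplex k V -> Prop) (Q : simplex k.+1 V -> Prop) c :
  (forall s, P s -> Q (cone_simplex p s)) -> csupp P c -> csupp Q (cone p c).
Proof.
by move=> PQ; apply: csupp_linear => s Ps; rewrite /= coneU; apply: csuppU; exact: PQ.
Qed.

Lemma chain_in_cone p k (A : set V) (c : chain k V) :
  star_shaped p A -> chain_in A c -> chain_in A (cone p c).
Proof. by move=> pA; apply: csupp_cone => s; exact: cone_simplex_in. Qed.

Definition aff_fun k (v : 'M[R]_(k.+1, d)) (x : Delta k) : V := set_val x *m v.

Lemma aff_fun_continuous k (v : 'M[R]_(k.+1, d)) : continuous (aff_fun v).
Proof.
move=> x; apply: continuous_at_rV => j; rewrite /prop_for/continuous_at/aff_fun.
under eq_cvg do rewrite mxE; rewrite mxE.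
apply: cvg_bigsum => i; apply: cvgMr_tmp; exact: Delta_coord_continuous.
Qed.

Definition aff k (v : 'M[R]_(k.+1, d)) : simplex k V := mkcts (@aff_fun_continuous k v).

Lemma affE k (v : 'M[R]_(k.+1, d)) x : aff v x = \sum_i set_val x 0 i *: row i v.
Proof. by rewrite -mulmx_sum_row. Qed.

Lemma face_map_mul k (i : 'I_k.+2) (x : 'rV[R]_k.+1) (v : 'M[R]_(k.+2, d)) :
  face_map i x *m v = x *m row' i v.
Proof.
apply/rowP => j; rewrite !mxE (bigD1 i)//= face_map_eq mul0r add0r.
rewrite (reindex (fintype.lift i)) /=; last first.
  exists (fun b => odflt ord0 (unlift i b)) => b; rewrite inE => ab.
    by rewrite liftK.
  by case: unliftP ab => [b' -> //|->]; rewrite eqxx.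
apply: eq_big => [a|a _]; first by rewrite eq_sym neq_lift.
by rewrite face_map_lift mxE.
Qed.

Lemma sface_aff k (i : 'I_k.+2) (v : 'M[R]_(k.+2, d)) : sface i (aff v) = aff (row' i v).
Proof. by apply/continuousEP => x; exact: face_map_mul. Qed.

End Cone.

End Simplex.

(** The cancellation used for boundaries. The bit b excludes fixed points of u, where [F i = - F i]
    would not give 0 in a group with 2-torsion. *)
Lemma sum_signed_invol (V : zmodType) (I : finType) (u : I -> I) (b : pred I) (F : I -> V) :
  involutive u -> (forall i, b (u i) = ~~ b i) -> (forall i, F (u i) = - F i) ->
  \sum_i F i = 0.
Proof.
move=> uu bu Fu; rewrite (bigID b)/=; apply/eqP; rewrite addr_eq0; apply/eqP.
rewrite (reindex u)/=; last by exists u => i _; exact: uu.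
by rewrite -sumrN; apply: eq_big => [i|i _]; [rewrite bu|exact: Fu].
Qed.

Lemma lift_perm_bij n (i : 'I_n.+1) :
  bijective (fun p : 'I_n.+1 * 'S_n => lift_perm i p.1 p.2).
Proof.
apply: inj_card_bij => [[j s] [j' s'] /= e|]; last first.
  by rewrite card_prod card_ord !card_Sn factS.
have jj : j = j' by rewrite -(lift_perm_id i j s) e lift_perm_id.
congr pair => //; apply/permP => a; apply: (@lift_inj _ j).
by rewrite -(lift_perm_lift i j s) e jj lift_perm_lift.
Qed.

(** * Barycentric subdivision *)

Section Barycentric.
Variable R : realType.
Local Notation chain := (chain R).
Local Notation simplex := (singular_simplex R).
Local Notation Delta k := (@std_simplex R k).

(** Row l is the barycentre of the vertices [p 0], ..., [p l]; the last vertex of a small simplex is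
    thus the barycentre of the whole. *)
Definition bary_mx k (p : 'S_k.+1) : 'M[R]_k.+1 :=
  \matrix_(l, c) (if ((p^-1)%g c <= l)%N then l.+1%:R^-1 else 0).

Lemma bary_mx_row k (p : 'S_k.+1) (l c : 'I_k.+1) :
  bary_mx p l (p c) = if (c <= l)%N then l.+1%:R^-1 else 0.
Proof. by rewrite mxE permK. Qed.

Lemma sum_leq_ord k (l : 'I_k.+1) (a : R) :
  \sum_(c < k.+1) (if (c <= l)%N then a else 0) = a *+ l.+1.
Proof.
rewrite -big_mkcond/= sumr_const; congr (_ *+ _).
transitivity (\sum_(c < k.+1 | (c < l.+1)%N) 1)%N; first by rewrite sum1_card.
by rewrite -(big_ord_widen _ (fun=> 1%N))// sum1_card card_ord.
Qed.

Lemma bary_mx_sum k (p : 'S_k.+1) l : \sum_c bary_mx p l c = 1.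
Proof.
rewrite (reindex_inj (@perm_inj _ p))/=.
under eq_bigr do rewrite bary_mx_row.
by rewrite sum_leq_ord -[LHS]mulr_natr mulVf// pnatr_eq0.
Qed.

Lemma bary_mx_ge0 k (p : 'S_k.+1) l c : 0 <= bary_mx p l c.
Proof. by rewrite mxE; case: ifP => // _; rewrite invr_ge0. Qed.

Lemma bary_in k (p : 'S_k.+1) (x : Delta k) : set_val x *m bary_mx p \in Delta k.
Proof.
apply/mem_set; split=> [j|].
  by rewrite mxE; apply: sumr_ge0 => i _; rewrite mulr_ge0 ?Delta_ge0 ?bary_mx_ge0.
under eq_bigr do rewrite mxE.
rewrite exchange_big /= -[RHS](Delta_sum x); apply: eq_bigr => i _.
by rewrite -mulr_sumr bary_mx_sum mulr1.
Qed.

Definition bary_fun k (p : 'S_k.+1) (x : Delta k) : Delta k := SigSub (bary_in p x).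

Lemma bary_continuous k (p : 'S_k.+1) : continuous (bary_fun p).
Proof.
by move=> x; apply: continuous_at_set_type; exact: (@aff_fun_continuous _ _ _ (bary_mx p) x).
Qed.

Definition bary k (p : 'S_k.+1) : simplex k (Delta k) := mkcts (@bary_continuous k p).

Lemma val_baryE k (p : 'S_k.+1) x : set_val (bary p x) = set_val x *m bary_mx p.
Proof. by []. Qed.

(** The barycentre l is the only one that distinguishes [p l] from [p (l + 1)]; without it their
    order is lost. *)
Lemma bary_swap k (l : 'I_k.+1) (p : 'S_k.+2) (x : Delta k) :
  bary (tperm (widen_ord (leqnSn _) l) (fintype.lift ord0 l) * p)%g
    (face (widen_ord (leqnSn _) l) x) =
  bary p (face (widen_ord (leqnSn _) l) x).
Proof.
set l0 := widen_ord _ l; set l1 := fintype.lift ord0 l.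
have : set_val (bary (tperm l0 l1 * p)%g (face l0 x)) = set_val (bary p (face l0 x)).
  rewrite !val_baryE val_face !face_map_mul; congr (_ *m _).
  apply/matrixP => i c; rewrite !mxE -[c](permKV p) permK invgM permM tpermV permK.
  set a := (p^-1)%g c; have il : fintype.lift l0 i != l0 by rewrite eq_sym neq_lift.
  have l1E : l1 = l0.+1 :> nat by [].
  case: tpermP => [-> |-> |//]; rewrite l1E; move: il; rewrite -val_eqE/= => il.
    by rewrite ltn_neqAle eq_sym il.
  by rewrite [in RHS]ltn_neqAle eq_sym il.
by move=> e; apply: val_inj.
Qed.

(** Without the barycentre of the whole simplex there remains a piece of the subdivided face
    opposite to j, the vertex listed last. *)
Lemma bary_face_max k (j : 'I_k.+2) (p : 'S_k.+1) (x : Delta k) :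
  bary (lift_perm ord_max j p) (face ord_max x) = face j (bary p x).
Proof.
have : set_val (bary (lift_perm ord_max j p) (face ord_max x)) = set_val (face j (bary p x)).
  rewrite val_baryE !val_face val_baryE face_map_mul; apply/rowP => c.
  case: (unliftP j c) => [c'|] ->.
    rewrite face_map_lift !mxE; apply: eq_bigr => i _; congr (_ * _).
    rewrite mxE -[c'](permKV p) -(lift_perm_lift ord_max j p) bary_mx_row bary_mx_row.
    by rewrite !lift_max.
  rewrite face_map_eq mxE big1// => i _; rewrite mxE.
  rewrite -[in X in bary_mx _ _ X](lift_perm_id ord_max j p) bary_mx_row lift_max.
  by rewrite leqNgt ltn_ord mulr0.
by move=> e; apply: val_inj.
Qed.

Lemma bary0 (p : 'S_1) (x : Delta 0) : bary p x = x.
Proof.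
have : set_val (bary p x) = set_val x; last by move=> e; apply: val_inj.
have d0 (y : Delta 0) : set_val y 0 0 = 1 by rewrite -(Delta_sum y) big_ord1.
by apply/rowP => j; rewrite !ord1 !d0.
Qed.

Section Space.
Variable X : topologicalType.

Definition sd_simplex k (p : 'S_k.+1) (s : simplex k X) : simplex k X := s \o bary p.

Fact Sd_key : unit. Proof. exact: tt. Qed.

Definition Sd k : chain k X -> chain k X :=
  locked_with Sd_key
    (fglift (fun s => \sum_(p : 'S_k.+1) (-1) ^+ p *: << sd_simplex p s >>)).

Lemma Sd_is_linear k : linear (@Sd k).
Proof. by rewrite /Sd locked_withE; exact: linearP. Qed.

HB.instance Definition _ k :=
  GRing.isLinear.Build int (chain k X) (chain k X) *:%R (@Sd k) (@Sd_is_linear k).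

Lemma SdU k (s : simplex k X) :
  Sd << s >> = \sum_(p : 'S_k.+1) (-1) ^+ p *: << sd_simplex p s >>.
Proof. by rewrite /Sd locked_withE; exact: fgliftU. Qed.

Lemma csupp_Sd k (P : simplex k X -> Prop) c :
  (forall p s, P s -> P (sd_simplex p s)) -> csupp P c -> csupp P (Sd c).
Proof.
move=> Pp; apply: csupp_linear => s Ps; rewrite /= SdU.
by apply: csupp_sum => p _; apply: csuppZ; apply: csuppU; exact: Pp.
Qed.

Lemma range_sd k (p : 'S_k.+1) (s : simplex k X) : range (sd_simplex p s) `<=` range s.
Proof. by move=> _ [x _ <-]; exists (bary p x). Qed.

Lemma Sd0 (c : chain 0 X) : Sd c = c.
Proof.
apply: (@eq_on_freeg _ _ (@Sd 0) idfun) => s; rewrite /= SdU.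
have e (p : 'S_1) : p = 1%g by apply/permP => i; rewrite !ord1.
rewrite (big_pred1 (1%g : 'S_1)) => [|p]; last by rewrite [p]e/= eqxx.
rewrite odd_perm1 expr0 scale1r; congr (<< _ >>).
by apply/continuousEP => x /=; rewrite -[RHS](congr1 s (bary0 1%g x)).
Qed.

Lemma boundary_Sd k (c : chain k X) : boundary (Sd c) = Sd (boundary c).
Proof.
case: k c => [|k] c; first by rewrite /= raddf0.
pose g1 : {linear chain k.+1 X -> chain k X} := @boundary R k.+1 X \o @Sd k.+1.
pose g2 : {linear chain k.+1 X -> chain k X} := @Sd k \o @boundary R k.+1 X.
apply: (@eq_on_freeg _ _ g1 g2) => s; rewrite /g1/g2/= SdU boundaryU !linear_sum.
under eq_bigr => p _ do rewrite linearZ/= boundaryU scaler_sumr.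
(* Faces opposite to a barycentre below the top cancel by [bary_swap]; those opposite to the top
   one, sorted by the vertex j listed last, make up the subdivided boundary. *)
rewrite exchange_big big_ord_recr /= big1 ?add0r => [|l _]; last first.
  pose l0 : 'I_k.+2 := widen_ord (leqnSn _) l; pose l1 := fintype.lift ord0 l.
  have l01 : l0 != l1 by rewrite -val_eqE/l0/l1/=/bump/=; lia.
  apply: (@sum_signed_invol _ _ (fun p => (tperm l0 l1 * p)%g) (fun p => odd_perm p)) => [p|p|p].
  - by rewrite mulgA tperm2 mul1g.
  - by rewrite odd_permM odd_tperm l01.
  rewrite odd_permM odd_tperm l01 signr_addb mulN1r scaleNr; congr (- (_ *: (_ *: << _ >>))).
  by apply/continuousEP => x; apply: (congr1 s); exact: bary_swap.
rewrite (reindex (fun p : 'I_k.+2 * 'S_k.+1 => lift_perm ord_max p.1 p.2)); last first.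
  exact/onW_bij/lift_perm_bij.
rewrite -(pair_bigA _ (fun j p =>
  (-1) ^+ lift_perm ord_max j p *: ((-1) ^+ k.+1 *:
   << sface ord_max (sd_simplex (lift_perm ord_max j p) s) >>)))/=.
apply: eq_bigr => j _; rewrite linearZ/= SdU scaler_sumr; apply: eq_bigr => p _.
rewrite !scalerA odd_lift_perm; congr (_ *: << _ >>).
  rewrite !signr_addb !signr_odd mulrAC -!mulrA mulrCA; congr (_ * _).
  by rewrite mulrA -expr2 -exprM mulnC exprM sqrrN !expr1n mul1r.
by apply/continuousEP => x; apply: (congr1 s); exact: bary_face_max.
Qed.

End Space.

Lemma push_Sd (X Y : topologicalType) (f : X -> Y) (A : set X) k (c : chain k X) :
  {within A, continuous f} -> chain_in A c -> push f (Sd c) = Sd (push f c).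
Proof.
move=> fA.
pose g1 : {linear chain k X -> chain k Y} := @push R X Y f k \o @Sd X k.
pose g2 : {linear chain k X -> chain k Y} := @Sd Y k \o @push R X Y f k.
apply: (@eq_on_csupp _ _ _ g1 g2) => s sA; rewrite /g1/g2/=.
have [t st] := push_lift fA sA; rewrite (pushU st) !SdU linear_sum.
apply: eq_bigr => p _; rewrite linearZ/= (@pushU _ _ _ _ _ _ (sd_simplex p t))// => x.
exact: (st (bary p x)).
Qed.

Lemma chain_in_Sd (X : topologicalType) (A : set X) k (c : chain k X) :
  chain_in A c -> chain_in A (Sd c).
Proof. by apply: csupp_Sd => p s; apply: subset_trans; exact: range_sd. Qed.

(** Cones are formed in the ambient vector space; [push] along this map brings them back to the
    simplex as a space of its own. *)
Definition retr k (y : 'rV[R]_k.+1) : Delta k := insubd (vertex R ord0) y.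

Lemma retrK k (x : Delta k) : retr (set_val x) = x.
Proof. by apply: val_inj; rewrite /retr insubdK//; exact: valP. Qed.

Lemma val_retr k (y : 'rV[R]_k.+1) : Delta k y -> set_val (retr y) = y.
Proof. by move=> dy; rewrite set_valE /retr insubdK//; exact/mem_set. Qed.

Lemma retr_continuous k : {within Delta k, continuous (@retr k)}.
Proof.
apply/subspace_continuousP => y dy; apply: cvg_set_type; rewrite val_retr// => U yU.
by rewrite /within/= nbhs_simpl /=; apply: filterS yU => z Uz dz; rewrite /= val_retr.
Qed.

Lemma Delta_star k p : Delta k p -> star_shaped p (Delta k).
Proof.
move=> [p0 p1] x t [x0 x1] t0 t1; have e : p + t *: (x - p) = (1 - t) *: p + t *: x.
  by rewrite scalerBr scalerBl scale1r addrA addrAC.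
rewrite e; split=> [i|]; first by rewrite !mxE addr_ge0// mulr_ge0// subr_ge0.
under eq_bigr do rewrite !mxE.
by rewrite big_split/= -!mulr_sumr p1 x1 !mulr1 subrK.
Qed.

Definition id_simplex k : simplex k (Delta k) := idfun.

(** Acyclic models: on the identity simplex, the chain homotopy between the identity and [Sd] is the
    cone over what its boundary has to be. The inlined [fglift] is [sdT] one dimension below, the
    extension by naturality to all spaces. *)
Fixpoint T_model k : chain k.+1 (Delta k) :=
  if k is k'.+1 return chain k.+1 (Delta k) then
    push (@retr k'.+1) (cone (set_val (vertex R ord0)) (push set_val
      (<< id_simplex k'.+1 >> - Sd << id_simplex k'.+1 >> -
       fglift (fun s : simplex k' (Delta k'.+1) => push s (T_model k'))
         (boundary << id_simplex k'.+1 >>))))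
  else 0.

Section SubdivisionLinearity.
Variable X : topologicalType.

Definition sdT k : chain k X -> chain k.+1 X := fglift (fun s : simplex k X => push s (T_model k)).
HB.instance Definition _ k := GRing.Linear.copy (@sdT k) (@sdT k).

Lemma sdTU k (s : simplex k X) : sdT << s >> = push s (T_model k).
Proof. exact: fgliftU. Qed.

Lemma sdT0 (c : chain 0 X) : sdT c = 0.
Proof.
by apply: (@eq_on_freeg _ _ (@sdT 0) \0) => s; rewrite /= sdTU raddf0.
Qed.

Lemma chain_in_sdT (A : set X) k (c : chain k X) : chain_in A c -> chain_in A (sdT c).
Proof.
apply: csupp_linear => s sA; rewrite /= sdTU.
apply: (@chain_in_push _ _ _ _ _ setT) => // x _; exact: sA (imageP s I).
Qed.

End SubdivisionLinearity.

Definition sdT_defect k : chain k.+1 (Delta k.+1) :=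
  << id_simplex k.+1 >> - Sd << id_simplex k.+1 >> - sdT (boundary << id_simplex k.+1 >>).

Lemma T_modelS k : T_model k.+1 =
  push (@retr k.+1) (cone (set_val (vertex R ord0)) (push set_val (sdT_defect k))).
Proof. by []. Qed.

#[local] Arguments T_model : simpl never.

Lemma push_sdT (X Y : topologicalType) (f : X -> Y) (A : set X) k (c : chain k X) :
  {within A, continuous f} -> chain_in A c -> push f (sdT c) = sdT (push f c).
Proof.
move=> fA.
pose g1 : {linear chain k X -> chain k.+1 Y} := @push R X Y f k.+1 \o @sdT X k.
pose g2 : {linear chain k X -> chain k.+1 Y} := @sdT Y k \o @push R X Y f k.
apply: (@eq_on_csupp _ _ _ g1 g2) => s sA; rewrite /g1/g2/=.
have [t st] := push_lift fA sA; rewrite (pushU st) !sdTU.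
rewrite (@push_comp _ _ _ _ s f setT A)//.
- apply: (@eq_push _ _ _ (f \o s) t setT) => //.
  by rewrite (funext st); exact: (cont_within _ (@cts_fun _ _ t)).
- exact: (cont_within _ (@cts_fun _ _ s)).
- by move=> x _; exact: sA (imageP s I).
Qed.

Lemma boundary_T_model k (W : chain k.+1 (Delta k.+1)) :
  boundary W = 0 ->
  boundary (push (@retr k.+1) (cone (set_val (vertex R ord0)) (push set_val W))) = W.
Proof.
move=> W0; have vc : {within [set: Delta k.+1], continuous set_val}.
  exact: (cont_within _ (@set_val_continuous _ (Delta k.+1))).
have vW : chain_in (Delta k.+1) (push set_val W).
  by apply: (@chain_in_push _ _ _ _ _ setT) => // x _; exact: set_valP.
have v0 := Delta_star (set_valP (vertex R ord0 : Delta k.+1)).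
rewrite (boundary_push (@retr_continuous k.+1)); last exact: chain_in_cone.
rewrite boundary_cone (boundary_push vc)// W0 !raddf0 addr0.
rewrite (push_comp vc (@retr_continuous k.+1))//; last by move=> x _; exact: set_valP.
apply: (@push_eq_id _ _ _ setT) => // [|x _]; last exact: retrK.
have -> : @retr k.+1 \o set_val = id by apply/funext => x; exact: retrK.
by apply: cont_within => x; exact: cvg_id.
Qed.

Lemma boundary_sdT_model k (X : topologicalType) (c : chain k.+1 X) :
  boundary (sdT_defect k) = 0 ->
  boundary (sdT c) = c - Sd c - sdT (boundary c).
Proof.
move=> W0.
pose g1 : {linear chain k.+1 X -> chain k.+1 X} := @boundary R k.+2 X \o @sdT X k.+1.
pose g2 : {linear chain k.+1 X -> chain k.+1 X} :=
  (idfun \- @Sd X k.+1) \- (@sdT X k \o @boundary R k.+1 X).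
apply: (@eq_on_freeg _ _ g1 g2) => s; rewrite /g1/g2/= sdTU.
have sc : {within [set: Delta k.+1], continuous s} := cont_within _ (@cts_fun _ _ s).
rewrite (boundary_push sc)// T_modelS boundary_T_model// /sdT_defect !linearB/=.
rewrite (push_Sd sc)// (push_sdT sc)//.
rewrite -(@boundary_push _ _ _ _ setT k.+1 << id_simplex k.+1 >> sc)//.
by rewrite (@pushU _ _ _ _ _ (id_simplex _) s).
Qed.

(** The defect is a cycle by the formula one dimension lower, so its cone bounds it. X is
    generalised because the induction hypothesis is applied in the model simplex. *)
Lemma boundary_sdT (X : topologicalType) k (c : chain k.+1 X) :
  boundary (sdT c) = c - Sd c - sdT (boundary c).
Proof.
elim: k X c => [|k IH] X c; apply: boundary_sdT_model.
  by rewrite /sdT_defect sdT0 subr0 linearB/= boundary_Sd Sd0 subrr.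
by rewrite /sdT_defect !linearB/= IH boundary_Sd boundaryK raddf0 subr0 subrr.
Qed.

Section Iterate.
Variable X : topologicalType.

Definition sdIter m k (c : chain k X) := iter m (@Sd X k) c.
Definition sdIterT m k (c : chain k X) : chain k.+1 X := \sum_(i < m) sdT (sdIter i c).

Lemma boundary_sdIter m k (c : chain k X) : boundary (sdIter m c) = sdIter m (boundary c).
Proof. by elim: m => //= m IH; rewrite boundary_Sd IH. Qed.

Lemma chain_in_sdIter (A : set X) m k (c : chain k X) :
  chain_in A c -> chain_in A (sdIter m c).
Proof. by move=> Ac; elim: m => //= m IH; exact: chain_in_Sd. Qed.

Lemma chain_in_sdIterT (A : set X) m k (c : chain k X) :
  chain_in A c -> chain_in A (sdIterT m c).
Proof.
by move=> Ac; apply: csupp_sum => i _; apply: chain_in_sdT; exact: chain_in_sdIter.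
Qed.

Lemma boundary_sdIterT m k (c : chain k.+1 X) :
  boundary (sdIterT m c) = c - sdIter m c - sdIterT m (boundary c).
Proof.
rewrite /sdIterT linear_sum /=; elim: m => [|m IH].
  by rewrite !big_ord0 subrr subr0.
rewrite !big_ord_recr /= {}IH boundary_sdT boundary_sdIter.
set a := \sum_(_ < _) _; rewrite opprD addrACA; congr (_ + _).
by rewrite addrA subrK.
Qed.

Lemma sdIter0 m (c : chain 0 X) : sdIter m c = c.
Proof. by elim: m => //= m; rewrite Sd0. Qed.

End Iterate.

Lemma push_sdIter (X Y : topologicalType) (f : X -> Y) (A : set X) m k (c : chain k X) :
  {within A, continuous f} -> chain_in A c -> push f (sdIter m c) = sdIter m (push f c).
Proof.
move=> fA Ac; elim: m => //= m IH; rewrite (push_Sd fA) ?IH//.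
exact: chain_in_sdIter.
Qed.

End Barycentric.

(** * Subdivisions finer than an open cover *)

Section Small.
Variable R : realType.
Local Notation chain := (chain R).
Local Notation simplex := (singular_simplex R).
Local Notation Delta k := (@std_simplex R k).

Definition l1 k (x y : Delta k) : R := \sum_j `|set_val x 0 j - set_val y 0 j|.

Lemma l1_triangle k (x y z : Delta k) : l1 x z <= l1 x y + l1 y z.
Proof.
rewrite /l1 -big_split/=; apply: ler_sum => j _.
by rewrite -[X in `|X|](subrKA (set_val y 0 j)) ler_normD.
Qed.

Lemma l1_le2 k (x y : Delta k) : l1 x y <= 2.
Proof.
have -> : 2 = \sum_j set_val x 0 j + \sum_j set_val y 0 j by rewrite !Delta_sum.
rewrite -big_split/=; apply: ler_sum => j _.
by rewrite (le_trans (ler_normB _ _))// !ger0_norm ?Delta_ge0.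
Qed.

Lemma l1_continuous k (x : Delta k) : continuous (l1 x).
Proof.
move=> y; rewrite /continuous_at/l1; apply: cvg_bigsum => j.
apply: cvg_norm; apply: cvgB; first exact: cvg_cst.
exact: Delta_coord_continuous.
Qed.

Lemma nbhs_l1 k (x : Delta k) (U : set (Delta k)) : nbhs x U ->
  exists2 e : R, 0 < e & forall y, l1 x y < e -> U y.
Proof.
rewrite nbhsE => -[V [[W oW WV] Vx] VU].
have : nbhs (set_val x) W.
  by apply: open_nbhs_nbhs; split=> //; move: Vx; rewrite -WV.
move=> /nbhs_ballP[e /= e0 eW]; exists e => // y xye; apply: VU; rewrite -WV.
apply: eW; split=> // i j; rewrite ord1 /ball/=.
apply: le_lt_trans xye; rewrite /l1 (bigD1 j)//= lerDl.
exact: sumr_ge0.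
Qed.

Definition contr k : R := 1 - k.+1%:R^-1.

Lemma contr_ge0 k : 0 <= contr k.
Proof. by rewrite subr_ge0 invf_le1// ler1n. Qed.

Lemma contr_lt1 k : contr k < 1.
Proof. by rewrite ltrBlDr ltrDl invr_gt0. Qed.

(** Every row of the matrix has at least [k.+1%:R^-1] in column [p ord0]. This common part m does
    not see the difference of x and y, whose coordinates sum to 0, and the rest of each row sums to
    [contr k]. *)
Lemma bary_l1 k (p : 'S_k.+1) (x y : Delta k) :
  l1 (bary R p x) (bary R p y) <= contr k * l1 x y.
Proof.
pose m c : R := if c == p ord0 then k.+1%:R^-1 else 0.
have Bm l c : m c <= bary_mx R p l c.
  rewrite /m; case: eqP => [->|_]; last exact: bary_mx_ge0.
  by rewrite bary_mx_row /= lef_pV2 ?posrE ?ltr0n// ler_nat.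
have sm l : \sum_c (bary_mx R p l c - m c) = contr k.
  rewrite sumrB bary_mx_sum /m -big_mkcond/= big_pred1_eq//.
have E c : set_val (bary R p x) 0 c - set_val (bary R p y) 0 c =
    \sum_l (set_val x 0 l - set_val y 0 l) * (bary_mx R p l c - m c).
  rewrite !val_baryE !mxE -sumrB; under [RHS]eq_bigr do rewrite mulrBr.
    rewrite [RHS]sumrB -[X in _ = _ - X]mulr_suml [X in _ = _ - X * _]sumrB.
  rewrite !Delta_sum subrr mul0r subr0.
  by apply: eq_bigr => l _; rewrite mulrBl.
rewrite /l1; under eq_bigr do rewrite E.
rewrite (le_trans (ler_sum _ (fun c _ => ler_norm_sum _ _ _)))// exchange_big/=.
rewrite mulr_sumr; apply: ler_sum => l _; under eq_bigr do rewrite normrM.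
by rewrite -mulr_sumr mulrC -(sm l) ler_wpM2r//; apply: ler_sum => c _; rewrite ger0_norm// subr_ge0.
Qed.

Section Space.
Variable X : topologicalType.

Definition shrunk m k (s t : simplex k X) := exists g : Delta k -> Delta k,
  (forall x y, l1 (g x) (g y) <= contr k ^+ m * l1 x y) /\ t =1 s \o g.

Lemma csupp_shrunk m k (s : simplex k X) : csupp (shrunk m s) (sdIter m << s >>).
Proof.
elim: m => [|m IH] /=.
  by apply: csuppU; exists id; split=> // x y; rewrite expr0 mul1r.
move: IH; apply: csupp_linear => t [g [gl tg]]; rewrite /= SdU.
apply: csupp_sum => p _; apply: csuppZ; apply: csuppU.
exists (g \o bary R p); split=> [x y|x]; last by rewrite -[LHS]/(t _) tg.
rewrite (le_trans (gl _ _))// exprSr -mulrA ler_wpM2l ?exprn_ge0 ?contr_ge0//.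
exact: bary_l1.
Qed.

Definition small (I : Type) (V : I -> set X) k (s : simplex k X) :=
  exists i, range s `<=` V i.

Lemma small_simplex (I : Type) (V : I -> set X) k (s : simplex k X) :
  (forall i, open (V i)) -> range s `<=` \bigcup_i V i ->
  \forall m \near \oo, csupp (@small I V k) (sdIter m << s >>).
Proof.
move=> oV sV.
(* In place of a Lebesgue number: for m large, the ball of radius [contr k ^+ m * 2] around any
   point is sent into one of the [V i]. The factor 2 bounds the diameter of the simplex. *)
have /compact_near_coveringP := @Delta_compact R k.
move=> /(_ nat \oo (fun m x => exists i, forall y, l1 x y <= contr k ^+ m * 2 -> V i (s y))).
move=> /(_ eventually_filter); case=> [x _|m _ mH].
- have [i _ Vi] := sV _ (imageP s (Logic.I : setT x)).
  have : nbhs x (s @^-1` V i).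
    by apply: (@cts_fun _ _ s x); exact: open_nbhs_nbhs.
  move=> /nbhs_l1[e e0 eV]; have e20 : 0 < e / 2 by rewrite divr_gt0.
  exists ([set y | l1 x y < e / 2], [set m | contr k ^+ m * 2 < e / 2]).
    split=> /=.
      have : l1 x y @[y --> x] --> l1 x x by exact: l1_continuous.
      rewrite [X in _ --> X](_ : _ = 0); last by rewrite /l1 big1// => j _; rewrite subrr normr0.
      by move=> /(_ [set z | z < e / 2]); apply; exact: lt_nbhsl.
    have := @cvg_geometric R 2 (contr k).
    rewrite ger0_norm ?contr_ge0// => /(_ (contr_lt1 _)).
    move=> /(_ _ (lt_nbhsl e20)); apply: (@filterS _ \oo) => m /=.
    by rewrite /geometric/= mulrC.
  move=> [y m] [/= xy me]; exists i => z yz; apply: eV.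
  by rewrite (le_lt_trans (l1_triangle _ y _))// [e]splitr ltrD// (le_lt_trans yz).
exists m => // m' mm'; have := @csupp_shrunk m' k s.
apply: csupp_sub => t [g [gl tg]].
have [i iV] := mH m' mm' (g (vertex R ord0)) Logic.I; exists i => _ [x _ <-].
rewrite tg; apply: iV; rewrite (le_trans (gl _ _))// ler_wpM2l ?exprn_ge0 ?contr_ge0//.
exact: l1_le2.
Qed.

Lemma small_chain (I : Type) (V : I -> set X) k (c : chain k X) :
  (forall i, open (V i)) -> chain_in (\bigcup_i V i) c ->
  exists m, csupp (@small I V k) (sdIter m c).
Proof.
move=> oV; suff H : chain_in (\bigcup_i V i) c ->
    \forall m \near \oo, csupp (@small I V k) (sdIter m c).
  by move=> /H [m _ mc]; exists m; apply: mc => /=.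
move: c; apply: csupp_ind.
- apply: filterE => m; rewrite (_ : sdIter m 0 = 0); first exact: csupp0.
  by elim: m => //= m ->; rewrite raddf0.
- move=> c c'; apply: filterS2 => m mc mc'.
  rewrite (_ : sdIter m (c + c') = sdIter m c + sdIter m c'); first exact: csuppD.
  by elim: {mc mc'}m => //= m ->; rewrite raddfD.
- move=> a c; apply: filterS => m mc.
  rewrite (_ : sdIter m (a *: c) = a *: sdIter m c); first exact: csuppZ.
  by elim: {mc}m => //= m ->; rewrite linearZ.
- by move=> s; exact: small_simplex.
Qed.

End Space.

(** * Homotopies and relative boundaries *)

Section Line.
Variables (X : topologicalType) (d : nat) (f0 f1 : X -> 'rV[R]_d).
Local Notation V := 'rV[R]_d.

Definition base_pt k (s : simplex k X) : V := f0 (s (vertex R ord0)).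

(* Straight-line homotopy from [f0] to [f1], by cones with a moving apex. *)
Fixpoint lineP k : chain k X -> chain k.+1 V :=
  if k is k'.+1 return chain k X -> chain k.+1 V then
    fglift (fun s : simplex k'.+1 X => cone (base_pt s)
      (push f1 << s >> - push f0 << s >> - lineP (boundary << s >>)))
  else fglift (fun s : simplex 0 X => cone (base_pt s) (push f1 << s >> - push f0 << s >>)).

Lemma lineP_is_linear k : linear (@lineP k).
Proof. by case: k => [|k] m c c'; exact: linearP. Qed.

HB.instance Definition _ k :=
  GRing.isLinear.Build int (chain k X) (chain k.+1 V) *:%R (@lineP k) (@lineP_is_linear k).

Lemma lineP0U (s : simplex 0 X) :
  lineP << s >> = cone (base_pt s) (push f1 << s >> - push f0 << s >>).
Proof. exact: fgliftU. Qed.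

Lemma linePSU k (s : simplex k.+1 X) :
  lineP << s >> = cone (base_pt s)
    (push f1 << s >> - push f0 << s >> - lineP (boundary << s >>)).
Proof. exact: fgliftU. Qed.

#[local] Arguments lineP : simpl never.

Hypotheses (f0c : continuous f0) (f1c : continuous f1).

Lemma deg_push (Y Z : topologicalType) (f : Y -> Z) (c : chain 0 Y) :
  continuous f -> deg (push f c) = deg c.
Proof.
move=> fc; have := @csuppT _ c; move: c; apply: csupp_ind => [|c c'|m c|s _].
- by rewrite !raddf0.
- by rewrite !raddfD/= => -> ->.
- by rewrite linearZ/= !degZ => ->.
have [t st] := push_lift (cont_within setT fc) (@subsetT _ (range s)).
by rewrite (pushU st) !degU.
Qed.

Lemma boundary_lineP0 (c : chain 0 X) : boundary (lineP c) = push f1 c - push f0 c.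
Proof.
pose g1 : {linear chain 0 X -> chain 0 V} := @boundary R 1 V \o @lineP 0.
pose g2 : {linear chain 0 X -> chain 0 V} := @push R X V f1 0 \- @push R X V f0 0.
apply: (@eq_on_freeg _ _ g1 g2) => s; rewrite /g1/g2/= lineP0U boundary_cone0.
have -> : deg (push f1 << s >> - push f0 << s >>) = 0.
  by rewrite degB (deg_push _ f1c) (deg_push _ f0c) !degU.
by rewrite scale0r subr0.
Qed.

Lemma boundary_lineP k (c : chain k.+1 X) :
  boundary (lineP c) = push f1 c - push f0 c - lineP (boundary c).
Proof.

elim: k c => [|k IH] c.
  pose g1 : {linear chain 1 X -> chain 1 V} := @boundary R 2 V \o @lineP 1.
  pose g2 : {linear chain 1 X -> chain 1 V} :=
    (@push R X V f1 1 \- @push R X V f0 1) \- (@lineP 0 \o @boundary R 1 X).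
  apply: (@eq_on_freeg _ _ g1 g2) => s; rewrite /g1/g2/= linePSU boundary_cone_cycle//.
  rewrite !boundaryB boundary_lineP0 (boundary_pushT _ f0c) (boundary_pushT _ f1c).
  exact: subrr.
pose g1 : {linear chain k.+2 X -> chain k.+2 V} := @boundary R k.+3 V \o @lineP k.+2.
pose g2 : {linear chain k.+2 X -> chain k.+2 V} :=
  (@push R X V f1 k.+2 \- @push R X V f0 k.+2) \- (@lineP k.+1 \o @boundary R k.+2 X).
apply: (@eq_on_freeg _ _ g1 g2) => s; rewrite /g1/g2/= linePSU boundary_cone_cycle//.
rewrite !boundaryB IH boundaryK [lineP 0]linear0 subr0.
rewrite (boundary_pushT _ f0c) (boundary_pushT _ f1c).
exact: subrr.
Qed.

Definition convexe (A : set V) := forall x y t, A x -> A y -> 0 <= t -> t <= 1 ->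
  A (x + t *: (y - x)).

Lemma chain_in_lineP (A : set V) k (c : chain k X) : convexe A ->
  chain_in [set x | A (f0 x) /\ A (f1 x)] c -> chain_in A (lineP c).
Proof.
move=> cA; have star p : A p -> star_shaped p A by move=> Ap x t Ax; exact: cA.
have base k' (s : simplex k' X) : range s `<=` [set x | A (f0 x) /\ A (f1 x)] -> A (base_pt s).
  by move=> sA; have [] := sA _ (imageP s (I : setT (vertex R ord0))).
have push_in f k' (s : simplex k' X) : (forall x, A (f0 x) /\ A (f1 x) -> A (f x)) ->
    range s `<=` [set x | A (f0 x) /\ A (f1 x)] -> chain_in A (push f << s >>).
  by move=> fA sA; apply: (@chain_in_push _ _ _ _ _ _ _ _ fA); exact: csuppU.
elim: k c => [|k IH] c; apply: csupp_linear => s sA.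
  rewrite /= lineP0U; apply: chain_in_cone; first exact/star/base.
  by apply: csuppB; apply: push_in => // x [].
rewrite /= linePSU; apply: chain_in_cone; first exact/star/base.
apply: csuppB; first by apply: csuppB; apply: push_in => // x [].
apply: (IH (boundary << s >>)); apply: (@chain_in_boundary _ _ k.+1); exact: csuppU.
Qed.

End Line.

End Small.

Section Relb.
Variables (R : realType) (X : topologicalType).
Local Notation chain := (chain R).
Local Notation simplex := (singular_simplex R).

(** The class of c vanishes in the homology of U modulo the simplices with P. Often P is smallness
    for a cover, which is not of the form [chain_in A]. *)
Definition relb (U : set X) k (P : simplex k X -> Prop) (c : chain k X) :=
  exists2 e : chain k.+1 X, chain_in U e & csupp P (c - boundary e).

Lemma relbD U k (P : simplex k X -> Prop) c c' :
  relb U P c -> relb U P c' -> relb U P (c + c').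
Proof.
move=> [e Ue Pe] [e' Ue' Pe']; exists (e + e'); first exact: csuppD.
by rewrite boundaryD opprD addrACA; exact: csuppD.
Qed.

Lemma relbZ U k (P : simplex k X -> Prop) m c : relb U P c -> relb U P (m *: c).
Proof.
move=> [e Ue Pe]; exists (m *: e); first exact: csuppZ.
by rewrite boundaryZ -scalerBr; exact: csuppZ.
Qed.

Lemma relbN U k (P : simplex k X -> Prop) c : relb U P c -> relb U P (- c).
Proof. by rewrite -scaleN1r; exact: relbZ. Qed.

Lemma relbB U k (P : simplex k X -> Prop) c c' :
  relb U P c -> relb U P c' -> relb U P (c - c').
Proof. by move=> ? ?; apply: relbD => //; exact: relbN. Qed.

Lemma relb_csupp U k (P : simplex k X -> Prop) c : csupp P c -> relb U P c.
Proof.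
move=> Pc; exists 0; first exact: csupp0.
by rewrite [boundary 0]linear0 subr0.
Qed.

Lemma relb_sub (U U' : set X) k (P Q : simplex k X -> Prop) c :
  U `<=` U' -> (forall s, P s -> Q s) -> relb U P c -> relb U' Q c.
Proof.
by move=> UU PQ [e Ue Pe]; exists e; [exact: chain_in_sub Ue|exact: csupp_sub Pe].
Qed.

Lemma small_face (I : Type) (V : I -> set X) k i (s : simplex k.+1 X) :
  small V s -> small V (sface i s).
Proof. by move=> [j sj]; exists j; apply: subset_trans sj; exact: range_sface. Qed.

Lemma small_boundary (I : Type) (V : I -> set X) k (c : chain k X) :
  csupp (@small R X I V k) c -> csupp (@small R X I V k.-1) (boundary c).
Proof. by apply: csupp_boundary => *; exact: small_face. Qed.

Lemma csupp_false k (P : simplex k X -> Prop) (c : chain k X) :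
  csupp P c -> (forall s, ~ P s) -> c = 0.
Proof.
move=> Pc nP; apply/eqP; rewrite -dom_eq0; case E: (dom c) => [//|s r].
by case: (nP s); apply: Pc; rewrite E mem_head.
Qed.

End Relb.

Lemma zmod_peel (M : zmodType) (a b x y e : M) :
  a + b - (x + y) - e = (a - x - e) + (b - y).
Proof. by rewrite opprD [a + b + _]addrACA [LHS]addrAC. Qed.

(** * Homology of a convex set relative to convex pieces *)

Section Convex.
Variables (R : realType) (d : nat).
Local Notation V := 'rV[R]_d.
Local Notation chain := (chain R).
Local Notation simplex := (singular_simplex R).

Lemma convexe_star (A : set V) p : convexe A -> A p -> star_shaped p A.
Proof. by move=> cA Ap x t Ax; exact: cA. Qed.

Lemma convexeI (A B : set V) : convexe A -> convexe B -> convexe (A `&` B).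
Proof. by move=> cA cB x y t [? ?] [? ?] t0 t1; split; [exact: cA|exact: cB]. Qed.

Lemma aff_in (A : set V) k (v : 'M[R]_(k.+1, d)) :
  convexe A -> (forall l, A (row l v)) -> range (aff v) `<=` A.
Proof.
move=> cA; elim: k v => [|k IH] v Av _ [x _ <-]; rewrite affE.
  have := Delta_sum x; rewrite !big_ord1 => ->; rewrite scale1r; exact: Av.
rewrite big_ord_recl.
have [x1|x1] := eqVneq (set_val x 0 0) 1.
  rewrite x1 scale1r big1 ?addr0// => i _; suff -> : set_val x 0 (fintype.lift ord0 i) = 0.
    by rewrite scale0r.
  have := Delta_sum_lift x; rewrite x1 subrr => /eqP; rewrite psumr_eq0 => [/allP/(_ i)|j _].
    by move=> /(_ (mem_index_enum _))/eqP.
  exact: Delta_ge0.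
have {}IH := IH (row' ord0 v) _ _ (imageP _ (Logic.I : setT (cone_base x))).
have /IH : forall l, A (row l (row' ord0 v)) by move=> l; rewrite row_rowsub; exact: Av.
rewrite affE => Aw; have := cA _ _ (1 - set_val x 0 0) (Av ord0) Aw.
rewrite subr_ge0 Delta_le1 lerBlDr lerDl Delta_ge0 => /(_ isT isT).
congr A; rewrite scalerBr addrCA -{1}[row 0 v]scale1r -scalerBl opprB addrC subrKC.
congr (_ + _); rewrite scaler_sumr; apply: eq_bigr => i _.
rewrite val_cone_base// cone_base0E row_rowsub scalerA; congr (_ *: _).
by rewrite mulrCA mulfV ?mulr1// subr_eq0 eq_sym.
Qed.

(** [c - boundary (cone p c)] is the cone over [boundary c], each simplex of which stays in its
    [W i]; in dimension 0 it is a multiple of the point p, which lies in [W i0]. *)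
Lemma relb_star (U : set V) (I : Type) (W : I -> set V) p i0 k (c : chain k V) :
  star_shaped p U -> (forall i, star_shaped p (W i)) -> W i0 p ->
  chain_in U c -> csupp (@small R _ _ W k.-1) (boundary c) ->
  relb U (@small R _ _ W k) c.
Proof.
move=> pU pW Wp Uc Wc; exists (cone p c); first exact: chain_in_cone.
case: k c Uc Wc => [|k] c Uc Wc.
  rewrite boundary_cone0 opprB addrC subrK; apply: csuppZ; apply: csuppU.
  by exists i0 => _ [x _ <-].
rewrite boundary_cone opprB addrC subrK; apply: csupp_cone Wc => s [i si].
by exists i; exact: cone_simplex_in.
Qed.

(* Peeling off [W 0]: the part in [W 0] of a chain is a relative cycle there. *)
Lemma small_split k m (W : 'I_m.+1 -> set V) (U : set V) (c : chain k V) :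
  csupp (@small R _ _ W k) c -> chain_in U c ->
  exists a b, [/\ c = a + b, chain_in (U `&` W ord0) a &
    csupp (@small R _ _ (fun j => W (fintype.lift ord0 j)) k) b].
Proof.
move=> Wc Uc.
have [|a [b [-> Pa Pb]]] := @csupp_split _ (fun s : simplex k V => range s `<=` U `&` W ord0)
  (@small R _ _ (fun j => W (fintype.lift ord0 j)) k) c; last by exists a, b.
apply: csupp_sub (csupp_and Wc Uc) => s [[i sW] sU].
case: (unliftP ord0 i) sW => [j ->|->] sW; first by right; exists j.
by left=> x sx; split; [exact: sU|exact: sW].
Qed.

(** [W j] contains the facet of the simplex v opposite to the vertex j, so U and the [W j] imitate a
    simplex and its boundary. *)
Definition in_position k (U : set V) (W : 'I_k.+1 -> set V) (v : 'M[R]_(k.+1, d)) :=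
  [/\ convexe U, forall j, convexe (W j), forall l, U (row l v) &
      forall l j, l != j -> W j (row l v)].

Lemma in_position_peel k (U : set V) (W : 'I_k.+2 -> set V) (v : 'M[R]_(k.+2, d)) :
  in_position U W v ->
  in_position (U `&` W ord0) (fun j => W (fintype.lift ord0 j)) (row' ord0 v).
Proof.
move=> [cU cW Uv Wv]; split=> [|//|l|l j lj]; first exact: convexeI.
- by rewrite row_rowsub; split=> //; apply: Wv; rewrite eq_sym neq_lift.
- by rewrite row_rowsub; apply: Wv; rewrite (inj_eq lift_inj).
Qed.

Lemma boundary_aff k (v : 'M[R]_(k.+2, d)) :
  boundary << aff v >> = << aff (row' ord0 v) >> +
    \sum_(l < k.+1) (-1) ^+ l.+1 *: << aff (row' (fintype.lift ord0 l) v) >>.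
Proof.
rewrite boundaryU big_ord_recl expr0 scale1r sface_aff; congr (_ + _).
by apply: eq_bigr => l _; rewrite sface_aff.
Qed.

Lemma small_tail k (U : set V) (W : 'I_k.+2 -> set V) (v : 'M[R]_(k.+2, d)) :
  in_position U W v ->
  csupp (@small R _ _ (fun j => W (fintype.lift ord0 j)) k)
    (\sum_(l < k.+1) (-1) ^+ l.+1 *: << aff (row' (fintype.lift ord0 l) v) >>).
Proof.
move=> [cU cW Uv Wv]; apply: csupp_sum => l _; apply: csuppZ; apply: csuppU.
exists l; apply: aff_in => // a; rewrite row_rowsub; apply: Wv.
by rewrite eq_sym neq_lift.
Qed.

(** Induction through a connecting map: the part a of [boundary c] in [W ord0] is a relative cycle
    there, one dimension lower, hence equivalent to a multiple of the facet of v opposite to its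
    vertex 0. Once this is corrected, only pieces that are star-shaped about that vertex are
    left. *)
Lemma relb_generator k (U : set V) (W : 'I_k.+1 -> set V) v (c : chain k V) :
  in_position U W v -> chain_in U c -> csupp (@small R _ _ W k.-1) (boundary c) ->
  exists r : int, relb U (@small R _ _ W k) (c - r *: << aff v >>).
Proof.
elim: k U W v c => [|k IH] U W v c pos Uc Wc; have [cU cW Uv Wv] := pos.
  exists (deg c); exists (cone (row 0 v) c).
    by apply: chain_in_cone => //; exact: convexe_star.
  rewrite boundary_cone0 (_ : << aff v >> = << const_simplex (row 0 v) >>).
    by rewrite subrr; exact: csupp0.
  congr (<< _ >>); apply/continuousEP => x; rewrite affE big_ord1.
  by have := Delta_sum x; rewrite big_ord1 => ->; rewrite scale1r.
have [a [b [cab Pa Pb]]] := small_split Wc (chain_in_boundary Uc).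
have ab : boundary a = - boundary b.
  by apply/eqP; rewrite -addr_eq0 -boundaryD -cab; apply/eqP; exact: boundary_boundary.
have [|r [e Ue We]] := IH _ _ _ a (in_position_peel pos) Pa.
  by rewrite ab; apply: csuppN; exact: small_boundary.
have Uaff : chain_in U << aff v >> by apply: chain_inU; exact: aff_in.
have Ue' : chain_in U e by apply: chain_in_sub Ue => x [].
have [||||f Uf Wf] := @relb_star U _ (fun j => W (fintype.lift ord0 j)) (row 0 v) ord0 k.+1
    (c - r *: << aff v >> - e) (convexe_star cU (Uv _)).
- by move=> j; apply: convexe_star => //; apply: Wv; rewrite neq_lift.
- by apply: Wv; rewrite neq_lift.
- by apply: chain_inB => //; apply: chain_inB => //; exact: chain_inZ.
- rewrite !boundaryB boundaryZ boundary_aff cab scalerDr.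
  rewrite (_ : _ - _ = (a - r *: << aff (row' ord0 v) >> - boundary e) + (b -
    r *: (\sum_(l < k.+1) (-1) ^+ l.+1 *: << aff (row' (fintype.lift ord0 l) v) >>))).
    apply: csuppD => //; apply: csuppB => //; apply: csuppZ.
    exact: small_tail pos.
  exact: zmod_peel.
exists r; exists f; first exact: Uf.
have -> : c - r *: << aff v >> - boundary f = (c - r *: << aff v >> - e - boundary f) + e.
  by rewrite [RHS]addrAC subrK.
apply: csuppD.
  by apply: csupp_sub Wf => s [j sj]; exists (fintype.lift ord0 j).
by apply: csupp_sub Ue => s sU; exists ord0 => x /sU[].
Qed.

(** The same peeling. When [W ord0] is the only piece, a common point with U is the apex of a cone;
    if there is none, the boundary is 0. *)
Lemma relb_above k i (U : set V) (W : 'I_k.+1 -> set V) v (c : chain i.+1 V) :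
  (k <= i)%N ->
  in_position U W v -> chain_in U c -> csupp (@small R _ _ W i) (boundary c) ->
  relb U (@small R _ _ W i.+1) c.
Proof.
elim: k i U W v c => [|k IH] i U W v c ki pos Uc Wc; have [cU cW Uv Wv] := pos.
  have [[q [Uq Wq]]|nq] := pselect (exists q, U q /\ W ord0 q).
    apply: (@relb_star U _ W q ord0) => //; first exact: convexe_star.
    by move=> j; rewrite ord1; exact: convexe_star.
  have c0 : boundary c = 0.
    apply: (csupp_false (csupp_and Wc (@chain_in_boundary _ _ i.+1 _ _ Uc))).
    move=> s [[j sj] sU]; rewrite ord1 in sj; apply: nq.
    by exists (s (vertex R ord0)); split; [apply: sU|apply: sj]; exact: imageP.
  exists (cone (row 0 v) c).
    by apply: chain_in_cone => //; exact: convexe_star.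
  by rewrite boundary_cone_cycle// subrr; exact: csupp0.
case: i ki c Uc Wc => // i ki c Uc Wc.
have [a [b [cab Pa Pb]]] := small_split Wc (@chain_in_boundary _ _ i.+2 _ _ Uc).
have ab : boundary a = - boundary b.
  by apply/eqP; rewrite -addr_eq0 -boundaryD -cab; apply/eqP; exact: boundaryK.
have [|e Ue We] := IH i _ _ _ a ki (in_position_peel pos) Pa.
  by rewrite ab; apply: csuppN; exact: (@small_boundary _ _ _ _ i.+1).
have Ue' : chain_in U e by apply: chain_in_sub Ue => x [].
have [||||f Uf Wf] := @relb_star U _ (fun j => W (fintype.lift ord0 j)) (row 0 v) ord0 i.+2
    (c - e) (convexe_star cU (Uv _)).
- by move=> j; apply: convexe_star => //; apply: Wv; rewrite neq_lift.
- by apply: Wv; rewrite neq_lift.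
- exact: chain_inB.
- by rewrite boundaryB cab addrAC; exact: csuppD.
exists f; first exact: Uf.
have -> : c - boundary f = (c - e - boundary f) + e.
  by rewrite [RHS]addrAC subrK.
apply: csuppD.
  by apply: csupp_sub Wf => s [j sj]; exists (fintype.lift ord0 j).
by apply: csupp_sub Ue => s sU; exists ord0 => x /sU[].
Qed.

(** If a multiple of v is trivial, so is the same multiple of its facet opposite to the vertex 0, by
    the connecting map. At the bottom the single piece misses U, and [deg] detects r. *)
Lemma relb_torsion_free k (U : set V) (W : 'I_k.+1 -> set V) v (r : int) :
  in_position U W v -> (forall x, U x -> (forall j, W j x) -> False) ->
  relb U (@small R _ _ W k) (r *: << aff v >>) -> r = 0.
Proof.
elim: k U W v => [|k IH] U W v pos UW [e Ue We]; have [cU cW Uv Wv] := pos.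
  have Uw : chain_in U (r *: << aff v >> - boundary e).
    apply: chain_inB; last exact: (@chain_in_boundary _ _ 1).
    by apply: chain_inZ; apply: chain_inU; exact: aff_in.
  have rE : r *: << aff v >> - boundary e = 0.
    apply: (csupp_false (csupp_and We Uw)) => s [[j sj] sU].
    apply: (UW (s (vertex R ord0))); first by apply: sU; exact: imageP.
    by move=> j'; rewrite ord1 -(ord1 j); apply: sj; exact: imageP.
  have := deg_boundary e; rewrite -(subr0_eq rE) degZ degU mulr1; exact.
have Uaff : chain_in U << aff v >> by apply: chain_inU; exact: aff_in.
have Uw : chain_in U (r *: << aff v >> - boundary e).
  apply: chain_inB; first exact: chain_inZ.
  exact: (@chain_in_boundary _ _ k.+2).
have [a [b [wab Pa Pb]]] := small_split We Uw.
apply: (IH _ _ _ (in_position_peel pos)).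
  by move=> x [Ux Wx] Wx'; apply: (UW x Ux) => j; case: (unliftP ord0 j) => [j' ->|-> //].
exists a => //.
have -> : r *: << aff (row' ord0 v) >> - boundary a = boundary b -
    r *: (\sum_(l < k.+1) (-1) ^+ l.+1 *: << aff (row' (fintype.lift ord0 l) v) >>).
  have E : boundary a + boundary b = r *: boundary << aff v >>.
    transitivity (boundary (a + b)); first exact/esym/boundaryD.
    rewrite -wab boundaryB -boundaryZ -[RHS]subr0; congr (_ - _).
    exact: boundaryK.
  apply/eqP; rewrite subr_eq addrAC eq_sym subr_eq -scalerDr -boundary_aff -E.
  by rewrite addrC.
apply: csuppB; first exact: (@small_boundary _ _ _ _ k.+1).
by apply: csuppZ; exact: small_tail pos.
Qed.

End Convex.

Lemma zmod_swap (M : zmodType) (a b q x y : M) : a - b - q = x + y -> a - x = b + y + q.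
Proof.
move/eqP; rewrite !subr_eq => /eqP ->.
rewrite [X in X - _](_ : _ = b + y + q + x) ?addrK//.
by rewrite [RHS]addrC [b + y]addrC -!addrA [b + q]addrC.
Qed.

(** * Excision and Mayer-Vietoris *)

Section Excision.
Variables (R : realType) (X : topologicalType).
Local Notation chain := (chain R).
Local Notation simplex := (singular_simplex R).

(** [homologous_mod A c c'] is convertible to [hzero A (c - c')], a form in which classes are added
    and subtracted linearly. *)
Definition hzero (A : set X) k (c : chain k X) := exists e : chain k.+1 X, chain_in A (c - boundary e).

Lemma hzeroD A k (c c' : chain k X) : hzero A c -> hzero A c' -> hzero A (c + c').
Proof.
move=> [e Ae] [e' Ae']; exists (e + e').
by rewrite boundaryD opprD addrACA; exact: chain_inD.
Qed.

Lemma hzeroZ A k m (c : chain k X) : hzero A c -> hzero A (m *: c).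
Proof. by move=> [e Ae]; exists (m *: e); rewrite boundaryZ -scalerBr; exact: chain_inZ. Qed.

Lemma hzeroN A k (c : chain k X) : hzero A c -> hzero A (- c).
Proof. by rewrite -scaleN1r; exact: hzeroZ. Qed.

Lemma hzeroB A k (c c' : chain k X) : hzero A c -> hzero A c' -> hzero A (c - c').
Proof. by move=> ? ?; apply: hzeroD => //; exact: hzeroN. Qed.

Lemma hzero_trans A k (b c c' : chain k X) : hzero A (c - b) -> hzero A (b - c') -> hzero A (c - c').
Proof. by move=> cb bc; rewrite -(subrKA b); exact: hzeroD. Qed.

Lemma hzero_sym A k (c c' : chain k X) : hzero A (c - c') -> hzero A (c' - c).
Proof. by move=> h; rewrite -opprB; exact: hzeroN. Qed.

Lemma hzero_in A k (c : chain k X) : chain_in A c -> hzero A c.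
Proof. by move=> Ac; exists 0; rewrite [boundary 0]linear0 subr0. Qed.

Lemma hzero0 A k : hzero A (0 : chain k X).
Proof. by apply: hzero_in; exact: csupp0. Qed.

Lemma hzero_refl A k (c : chain k X) : hzero A (c - c).
Proof. by rewrite subrr; exact: hzero0. Qed.

Lemma hzero_sub (A B : set X) k (c : chain k X) : A `<=` B -> hzero A c -> hzero B c.
Proof. by move=> AB [e Ae]; exists e; exact: chain_in_sub Ae. Qed.

Lemma hzero_boundary A k (e : chain k.+1 X) : hzero A (boundary e).
Proof. by exists e; rewrite subrr; exact: csupp0. Qed.

Lemma hzero_cycle A k (c : chain k X) : hzero A c -> chain_in A (boundary c).
Proof.
move=> [e Ae]; have -> : boundary c = boundary (c - boundary e); last exact: chain_in_boundary.
rewrite boundaryB [X in _ - X]boundary_boundary subr0.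
by [].
Qed.

Lemma relb_sdIter (U A : set X) m k (c : chain k X) :
  chain_in U c -> chain_in A (boundary c) ->
  relb U (fun s => range s `<=` A) (c - sdIter m c).
Proof.
case: k c => [|k] c Uc Ac; first by rewrite sdIter0 subrr; apply: relb_csupp; exact: csupp0.
exists (sdIterT m c); first exact: chain_in_sdIterT.
by rewrite boundary_sdIterT opprB addrC subrK; exact: chain_in_sdIterT.
Qed.

Lemma hzero_sdIter (A : set X) m k (c : chain k X) :
  chain_in A (boundary c) -> hzero A (c - sdIter m c).
Proof. by move=> /(relb_sdIter m (@chain_inT _ _ _ c))[e _ Ae]; exists e. Qed.

Lemma sdIterB m k (c c' : chain k X) : sdIter m (c - c') = sdIter m c - sdIter m c'.
Proof. by elim: m => //= m ->; rewrite linearB. Qed.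

Lemma sdIter_split (U V A : set X) k (c : chain k X) : open U -> open V ->
  chain_in A c -> A `<=` U `|` V -> exists m u v,
  [/\ sdIter m c = u + v, chain_in (U `&` A) u & chain_in (V `&` A) v].
Proof.
move=> oU oV Ac AUV; pose F (b : bool) := if b then U else V.
have [||m mc] := @small_chain R X bool F k c.
- by case.
- by apply: chain_in_sub Ac => x /AUV[Ux|Vx]; [exists true|exists false].
have [|u [v [E Pu Pv]]] := @csupp_split _ (fun s : simplex k X => range s `<=` U `&` A)
    (fun s => range s `<=` V `&` A) (sdIter m c); last by exists m, u, v.
have := csupp_and mc (@chain_in_sdIter R X A m k c Ac).
apply: (@csupp_sub _ (fun s => small F s /\ range s `<=` A)) => s [[[] sb] sA].
  by left=> x sx; split; [exact: sb|exact: sA].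
by right=> x sx; split; [exact: sb|exact: sA].
Qed.

(** After subdivision every simplex lies in U or off K; u collects those in U. *)
Lemma excision (U K : set X) k (c : chain k X) : open U -> closed K -> K `<=` U ->
  chain_in (~` K) (boundary c) -> exists u,
  [/\ chain_in U u, chain_in (~` K) (boundary u) & hzero (~` K) (c - u)].
Proof.
move=> oU cK KU Kc.
have [|m [u [v [E Uu Kv]]]] := @sdIter_split U (~` K) setT k c oU (closed_openC cK) (@chain_inT _ _ _ _).
  by move=> x _; have [/KU Ux|nKx] := pselect (K x); [left|right].
have {}Kv : chain_in (~` K) v by apply: chain_in_sub Kv => x [].
have uE : u = sdIter m c - v by rewrite E addrK.
exists u; split; first by apply: chain_in_sub Uu => x [].
  rewrite uE boundaryB boundary_sdIter; apply: chain_inB; first exact: chain_in_sdIter.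
  exact: chain_in_boundary.
rewrite uE opprB addrA addrAC; apply: hzeroD; last exact: hzero_in.
exact: hzero_sdIter.
Qed.

(** Injectivity of excision: the chain that makes u vanish is subdivided, and its part off K is
    discarded. *)
Lemma excision_relb (U K : set X) k (u : chain k X) : open U -> closed K -> K `<=` U ->
  chain_in U u -> hzero (~` K) u -> relb U (fun s => range s `<=` U `&` ~` K) u.
Proof.
move=> oU cK KU Uu hu; have Ku := hzero_cycle hu; case: hu => e Kw.
have [|m [eU [eV [E UeU KeV]]]] := @sdIter_split U (~` K) setT _ e oU (closed_openC cK) (@chain_inT _ _ _ _).
  by move=> x _; have [/KU Ux|nKx] := pselect (K x); [left|right].
have {}UeU : chain_in U eU by apply: chain_in_sub UeU => x [].
have {}KeV : chain_in (~` K) eV by apply: chain_in_sub KeV => x [].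
have H1 : relb U (fun s => range s `<=` U `&` ~` K) (u - sdIter m u).
  apply: relb_sdIter => //; apply: csupp_sub (csupp_and (chain_in_boundary Uu) Ku) => s [s1 s2].
  by move=> x sx; split; [exact: s1|exact: s2].
rewrite -(subrK (sdIter m u) u); apply: relbD => //; exists eU => //.
have h1 : chain_in U (sdIter m u - boundary eU).
  by apply: chain_inB; [exact: chain_in_sdIter|exact: (@chain_in_boundary _ _ k.+1)].
have h2 : chain_in (~` K) (sdIter m u - boundary eU).
  have -> : sdIter m u - boundary eU = sdIter m (u - boundary e) + boundary eV.
    by rewrite sdIterB -(boundary_sdIter m e) E boundaryD opprD addrA subrK.
  by apply: chain_inD; [exact: chain_in_sdIter|exact: (@chain_in_boundary _ _ k.+1)].
by apply: csupp_sub (csupp_and h1 h2) => s [s1 s2] x sx; split; [exact: s1|exact: s2].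
Qed.

(* Mayer-Vietoris *)
Lemma hzero_union (A B : set X) k (c : chain k X) : closed A -> closed B ->
  (forall q : chain k.+1 X, chain_in (~` (A `&` B)) (boundary q) -> hzero (~` (A `&` B)) q) ->
  hzero (~` A) c -> hzero (~` B) c -> hzero (~` (A `|` B)) c.
Proof.
move=> cA cB H hA hB.
have cc : chain_in (~` (A `|` B)) (boundary c).
  apply: csupp_sub (csupp_and (hzero_cycle hA) (hzero_cycle hB)) => s [sA sB] x sx.
  by case; [exact: sA|exact: sB].
have {}cc m := hzero_sdIter m cc.
case: hA hB => e eA [e' eB].
have [|q qH] := H (e - e').
  have -> : boundary (e - e') = (c - boundary e') - (c - boundary e).
    by rewrite boundaryB opprB addrC -addrA [c + _]addrC !addrA subrK.
  apply: chain_inB; last by apply: chain_in_sub eA => x nA [/nA].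
  by apply: chain_in_sub eB => x nB [_ /nB].
have [x|m [wA [wB [E wAH wBH]]]] :=
    @sdIter_split _ _ _ _ _ (closed_openC cA) (closed_openC cB) qH.
  by rewrite setCI.
have {}wAH : chain_in (~` A) wA by apply: chain_in_sub wAH => x [].
have {}wBH : chain_in (~` B) wB by apply: chain_in_sub wBH => x [].
rewrite -(subrK (sdIter m c) c); apply: hzeroD; first exact: cc.
(* e kills c up to chains off A, and e' up to chains off B. As the subdivided [e - e'] is wA + wB up
   to a boundary, this chain is also [sdIter m e' + wB] up to a boundary, and serves for both. *)
exists (sdIter m e - wA).
have hA : chain_in (~` A) (sdIter m c - boundary (sdIter m e - wA)).
  rewrite boundaryB boundary_sdIter opprB addrA addrAC -sdIterB.
  by apply: chain_inD; [exact: chain_in_sdIter|exact: (@chain_in_boundary _ _ k.+1)].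
have hB : chain_in (~` B) (sdIter m c - boundary (sdIter m e - wA)).
  have -> : sdIter m e - wA = sdIter m e' + wB + sdIter m (boundary q).
    by apply: zmod_swap; rewrite -E !sdIterB.
  rewrite -boundary_sdIter boundaryD [X in _ - (_ + X)]boundaryK addr0 boundaryD opprD addrA.
  rewrite boundary_sdIter -sdIterB.
  by apply: chain_inB; [exact: chain_in_sdIter|exact: (@chain_in_boundary _ _ k.+1)].
by apply: csupp_sub (csupp_and hA hB) => s [sA sB] x sx []; [exact: sA|exact: sB].
Qed.

End Excision.

(** * Local homology of manifolds *)

Section Barycentre.
Variables (R : realType) (n : nat).
Local Notation V := 'rV[R]_n.
Local Notation chain := (chain R).
Local Notation simplex := (singular_simplex R).

(* The n + 1 linear forms [lam] sum up to 0. Simplices cut out by lower bounds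
   on them are stable under intersection, which makes them a better choice of
   compact neighbourhoods than balls. *)
Definition lam (y : V) (j : 'I_n.+1) : R :=
  if unlift ord0 j is Some i then y 0 i else - \sum_i y 0 i.

Lemma lam0 y : lam y ord0 = - \sum_i y 0 i.
Proof. by rewrite /lam unlift_none. Qed.

Lemma lamS y (i : 'I_n) : lam y (fintype.lift ord0 i) = y 0 i.
Proof. by rewrite /lam liftK. Qed.

Lemma lam_sum y : \sum_j lam y j = 0.
Proof.
by rewrite big_ord_recl; under eq_bigr do rewrite lamS; rewrite lam0 addrC subrr.
Qed.

Lemma lam_continuous j : continuous (lam^~ j).
Proof.
have cs : continuous (fun y : V => \sum_i y 0 i).
  move=> v; apply: (@cvg_bigsum R _ _ (nbhs v) _ _ _ (fun i v => v 0 i)) => i.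
  exact: coord_continuous.
move=> y; rewrite /continuous_at /lam; case: unliftP => [i _|_].
  exact: coord_continuous.
by have /cvgN := cs y; apply.
Qed.

Lemma lam_line x y t j : lam (x + t *: (y - x)) j = lam x j + t * (lam y j - lam x j).
Proof.
rewrite /lam; case: unliftP => [i _|_]; first by rewrite !mxE.
under eq_bigr do rewrite !mxE.
by rewrite big_split/= -mulr_sumr sumrB opprD opprK addrC mulrBr; ring.
Qed.

Lemma lam_inj x y : (forall j, lam x j <= lam y j) -> x = y.
Proof.
move=> xy; have : \sum_j (lam y j - lam x j) = 0 by rewrite sumrB !lam_sum subrr.
move=> /eqP; rewrite psumr_eq0 => [/allP xy0|j _]; last by rewrite subr_ge0.
apply/rowP => i; have := xy0 (fintype.lift ord0 i) (mem_index_enum _).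
by rewrite !lamS /= subr_eq0 => /eqP.
Qed.

(** [Om] is an open simplex around 0 and [Sa a] a compact one, contained in [Om] for [inner] a. The
    convex sets [Wa a j] cover the difference, one for each violated inequality. *)
Definition Om : set V := [set y | forall j, -1 < lam y j].
Definition Sa (a : 'I_n.+1 -> R) : set V := [set y | forall j, a j <= lam y j].
Definition Wa (a : 'I_n.+1 -> R) j : set V := [set y | Om y /\ lam y j < a j].

Lemma open_lam_gt a j : open [set y | a < lam y j].
Proof.
by apply: (@open_comp _ _ (lam^~ j) [set z | a < z]); [move=> y _; exact: lam_continuous|exact: open_gt].
Qed.

Lemma open_lam_lt a j : open [set y | lam y j < a].
Proof.
by apply: (@open_comp _ _ (lam^~ j) [set z | z < a]); [move=> y _; exact: lam_continuous|exact: open_lt].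
Qed.

Lemma open_lam_gts (a : 'I_n.+1 -> R) : open [set y | forall j, a j < lam y j].
Proof.
rewrite openE => y ay; rewrite /interior.
apply: (@filter_forall _ _ (fun j y => a j < lam y j) (nbhs y)) => j.
by apply: open_nbhs_nbhs; split; [exact: open_lam_gt|exact: ay].
Qed.

Lemma open_Om : open Om. Proof. exact: open_lam_gts. Qed.

Lemma open_Wa a j : open (Wa a j).
Proof. by apply: openI; [exact: open_Om|exact: open_lam_lt]. Qed.

Lemma Om_convex : convexe Om.
Proof.
move=> x y t Ox Oy t0 t1 j; rewrite lam_line.
have := Ox j; have := Oy j => y1 x1.
have [->|tn1] := eqVneq t 1; first by lra.
have : 0 < 1 - t by rewrite subr_gt0 lt_neqAle tn1.
by nra.
Qed.

Lemma Wa_convex a j : convexe (Wa a j).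
Proof.
move=> x y t [Ox xa] [Oy ya] t0 t1; split; first exact: Om_convex.
rewrite lam_line; have [->|tn1] := eqVneq t 1; first by lra.
have : 0 < 1 - t by rewrite subr_gt0 lt_neqAle tn1.
by nra.
Qed.

Lemma Sa_compact a : compact (Sa a).
Proof.
pose b (i : 'I_n) := - \sum_(j | j != fintype.lift ord0 i) a j.
have cA : compact [set v : V | forall i, `[a (fintype.lift ord0 i), b i]%classic (v ord0 i)].
  by apply: (@rV_compact _ _ (fun i => `[a (fintype.lift ord0 i), b i]%classic)) => i; exact: segment_compact.
apply: (subclosed_compact _ cA) => [|y ya i].
  have -> : Sa a = ~` \bigcup_j [set y | lam y j < a j].
    by apply/seteqP; split=> y; [move=> ya [j _ /=]; rewrite ltNge ya|
      move=> ny j; rewrite leNgt; apply/negP => ja; apply: ny; exists j].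
  by apply: open_closedC; apply: bigcup_open => j _; exact: open_lam_lt.
have := lam_sum y; rewrite (bigD1 (fintype.lift ord0 i))//= => /eqP.
rewrite addr_eq0 lamS => /eqP e; rewrite /= in_itv/= {2}e lerN2 -lamS ya/=.
by apply: ler_sum => j _; exact: ya.
Qed.

Definition inner (a : 'I_n.+1 -> R) := forall j, - (1 / 2) <= a j.

(** In row l all forms but the form l equal -3/4, which lies between the -1 of [Om] and the -1/2 of
    [inner]: the point is in [Om] and violates every inequality except perhaps its own. The value
    3n/4 makes the sum 0. *)
Definition pv : 'M[R]_(n.+1, n) :=
  \matrix_(j, i) (if j == fintype.lift ord0 i then 3 / 4 * n%:R else - (3 / 4)).

Lemma lam_pv (l j : 'I_n.+1) :
  lam (row l pv) j = if l == j then 3 / 4 * n%:R else - (3 / 4).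
Proof.
case: (unliftP ord0 j) => [i|] ->; first by rewrite lamS !mxE.
rewrite lam0; under eq_bigr do rewrite !mxE.
case: (unliftP ord0 l) => [i|] ->.
  rewrite (bigD1 i)//= eqxx (eq_bigr (fun=> - (3 / 4))) => [|k ki]; last first.
    by rewrite (inj_eq lift_inj) eq_sym (negbTE ki).
  rewrite sumr_const (_ : #|_| = n.-1); last by rewrite cardC1 card_ord.
  have n0 : (0 < n)%N by apply: leq_ltn_trans (ltn_ord i).
  rewrite -mulr_natr (_ : n%:R = n.-1%:R + 1 :> R); last by rewrite natr1 prednK.
  by ring.
rewrite eqxx (eq_bigr (fun=> - (3 / 4))) => [|k _]; last by [].
by rewrite sumr_const card_ord -mulr_natr; field.
Qed.

Lemma pv_position a : inner a -> in_position Om (Wa a) pv.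
Proof.
move=> ia; have Op l : Om (row l pv).
  move=> j; rewrite lam_pv; case: ifP => _; last by lra.
  by rewrite (lt_le_trans (_ : -1 < 0))// mulr_ge0.
split=> [|j|//|l j lj]; [exact: Om_convex|exact: Wa_convex|].
by split=> //; rewrite lam_pv (negbTE lj); have := ia j; lra.
Qed.

Definition offSa a k (s : simplex k V) := range s `<=` Om `&` ~` Sa a.

Lemma small_offSa a k (s : simplex k V) : small (Wa a) s -> offSa a s.
Proof.
move=> [j sj] x /sj[Ox xa]; split=> // Sx.
by have := Sx j; rewrite leNgt xa.
Qed.

Lemma offSa_small a k (c : chain k V) : csupp (@offSa a k) c ->
  exists m, csupp (@small R _ _ (Wa a) k) (sdIter m c).
Proof.
move=> ca; apply: small_chain => [j|]; first exact: open_Wa.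
apply: csupp_sub ca => s sa x /sa[Ox nSx].
apply: contrapT => nW; apply: nSx => j; rewrite leNgt; apply/negP => xa.
by apply: nW; exists j.
Qed.

Lemma Om_generator a (c : chain n V) : inner a -> chain_in Om c ->
  csupp (@offSa a n.-1) (boundary c) ->
  exists r : int, relb Om (@offSa a n) (c - r *: << aff pv >>).
Proof.
move=> ia Oc ac; have [m mc] := offSa_small ac.
rewrite -boundary_sdIter in mc.
have [r rc] := relb_generator (pv_position ia) (chain_in_sdIter Oc) mc.
exists r; rewrite -(subrKA (sdIter m c)); apply: relbD; last first.
  by apply: relb_sub rc => // s; exact: small_offSa.
exact: relb_sdIter.
Qed.

Lemma Om_above a i (c : chain i.+1 V) : (n <= i)%N -> inner a -> chain_in Om c ->
  csupp (@offSa a i) (boundary c) -> relb Om (@offSa a i.+1) c.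
Proof.
move=> ni ia Oc ac; have [m mc] := offSa_small ac.
rewrite -(@boundary_sdIter _ _ m i.+1) in mc.
have rc := relb_above ni (pv_position ia) (chain_in_sdIter Oc) mc.
rewrite -[c](subrK (sdIter m c)); apply: relbD; last first.
  by apply: relb_sub rc => // s; exact: small_offSa.
exact: relb_sdIter.
Qed.

Lemma csupp_small_sdT (X : topologicalType) (I : Type) (F : I -> set X) k (c : chain k X) :
  csupp (@small R _ _ F k) c -> csupp (@small R _ _ F k.+1) (sdT c).
Proof.
apply: csupp_linear => s [j sj]; apply: csupp_sub (chain_in_sdT (chain_inU sj)) => t tj.
by exists j.
Qed.

Lemma csupp_small_sdIter (X : topologicalType) (I : Type) (F : I -> set X) m k (c : chain k X) :
  csupp (@small R _ _ F k) c -> csupp (@small R _ _ F k) (sdIter m c).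
Proof.
move=> Fc; elim: m => //= m; apply: csupp_Sd => p s [j sj].
by exists j; apply: subset_trans sj; exact: range_sd.
Qed.

Lemma relb_small_sdIter (X : topologicalType) (I : Type) (F : I -> set X) (U : set X) m k
    (c : chain k X) :
  chain_in U c -> csupp (@small R _ _ F k.-1) (boundary c) ->
  relb U (@small R _ _ F k) (c - sdIter m c).
Proof.
case: k c => [|k] c Oc ab.
  by rewrite sdIter0 subrr; apply: relb_csupp; exact: csupp0.
exists (sdIterT m c); first exact: chain_in_sdIterT.
rewrite boundary_sdIterT opprB addrC subrK; apply: csupp_sum => i _.
by apply: csupp_small_sdT; exact: csupp_small_sdIter.
Qed.

Lemma boundary_aff_small k (U : set V) (F : 'I_k.+1 -> set V) (v : 'M[R]_(k.+1, n)) :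
  in_position U F v -> csupp (@small R _ _ F k.-1) (boundary << aff v >>).
Proof.
case: k F v => [|k] F v [cU cF Uv Fv]; first by rewrite boundary0; exact: csupp0.
rewrite boundaryU; apply: csupp_sum => i _; apply: csuppZ; rewrite sface_aff.
apply: csuppU; exists i; apply: aff_in => // l; rewrite row_rowsub; apply: Fv.
by rewrite eq_sym neq_lift.
Qed.

(** [\sum_j a j <= 0] says that [Sa a] is not empty: the forms sum to 0, so no point violates all
    the inequalities. *)
Lemma Om_torsion_free a (r : int) : inner a -> \sum_j a j <= 0 ->
  relb Om (@offSa a n) (r *: << aff pv >>) -> r = 0.
Proof.
move=> ia sa0 [e Oe we]; have [m mw] := offSa_small we.
apply: (relb_torsion_free (pv_position ia)) => [x Ox xW|].
  have : \sum_j lam x j < \sum_j a j.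
    apply: ltr_sum => [|j _]; last by have [] := xW j.
    by apply/hasP; exists ord0; rewrite ?mem_index_enum.
  by rewrite lam_sum ltNge sa0.
rewrite -[_ *: _](subrK (sdIter m (r *: << aff pv >>))); apply: relbD.
  have ab := csuppZ (m := r) (boundary_aff_small (pv_position ia)); rewrite -boundaryZ in ab.
  have Op : chain_in Om (r *: << aff pv >>).
    apply: chain_inZ; apply: chain_inU; apply: aff_in; first exact: Om_convex.
    by have [] := pv_position ia.
  exact: relb_small_sdIter.
exists (sdIter m e); first exact: chain_in_sdIter.
by rewrite boundary_sdIter -sdIterB.
Qed.

End Barycentre.

Lemma within_open_continuous (X Y : topologicalType) (U : set X) (f : X -> Y) x :
  open U -> {within U, continuous f} -> U x -> {for x, continuous f}.
Proof.
move=> oU /subspace_continuousP fU Ux A /(fU x Ux) /=.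
have /filterI : nbhs x U by exact: open_nbhs_nbhs.
by move=> h /h; apply: filterS => y [Uy]; exact.
Qed.

Lemma continuous_at_within (X Y : topologicalType) (U : set X) (f : X -> Y) :
  (forall x, U x -> {for x, continuous f}) -> {within U, continuous f}.
Proof. by move=> fU; apply: continuous_in_subspaceT => x /set_mem; exact: fU. Qed.

Lemma relb_push (R : realType) (X Y : topologicalType) (h : X -> Y) (A : set X) (B : set Y) k
    (P : singular_simplex R k X -> Prop) (Q : singular_simplex R k Y -> Prop) c :
  {within A, continuous h} -> (forall x, A x -> B (h x)) ->
  (forall (s : singular_simplex R k X) (t : singular_simplex R k Y),
    P s -> h \o s =1 t -> Q t) ->
  relb A P c -> relb B Q (push h c).
Proof.
move=> hA AB PQ [e Ae Pe]; exists (push h e); first exact: chain_in_push Ae.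
by rewrite (boundary_push hA)// -pushB; exact: csupp_push Pe.
Qed.

Lemma affine_continuous (R : realType) n (a : 'rV[R]_n) (d : R) :
  continuous (fun y : 'rV[R]_n => a + d *: y).
Proof.
move=> x; apply: continuous_at_rV => j; rewrite /prop_for/continuous_at.
under eq_cvg do rewrite !mxE; rewrite !mxE.
have h := @coord_continuous R 1 n 0 j x.
by apply: (cvgD (cvg_cst _) (cvgMl_tmp h)).
Qed.

Lemma compact_seq_cover (M : topologicalType) (A : set M) (I : choiceType) (D : set I)
    (f : I -> set M) : compact A -> (forall i, D i -> open (f i)) ->
  (forall x, A x -> exists2 i, D i & f i x) ->
  exists L : seq I, (forall i, i \in L -> D i) /\
    forall x, A x -> exists2 i, i \in L & f i x.
Proof.
move=> cA fo Af; have [A0|/set0P[x0 _]] := eqVneq A set0.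
  by exists [::]; split=> // x; rewrite A0.
pose M' := HB.pack_for ptopologicalType M (isPointed.Build M x0).
have : @compact M' A by [].
rewrite compact_cover => /(_ I D f fo)[x Ax|L LD AL].
  by have [i] := Af x Ax; exists i.
exists (finmap.enum_fset L); split=> [i iL|x Ax]; first by apply/set_mem; exact: LD.
by have [i] := AL x Ax; exists i.
Qed.

Section Manifold.
Variables (R : realType) (n : nat) (M : topologicalType).
Local Notation V := 'rV[R]_n.
Local Notation chain := (chain R).
Local Notation Om := (@Om R n).
Local Notation lam := (@lam R n).

Definition chart (U : set M) (f : M -> V) (g : V -> M) :=
  [/\ open U, forall x, U x -> {for x, continuous f}, forall y, Om y -> {for y, continuous g},
      forall x, U x -> Om (f x) /\ g (f x) = x & forall y, Om y -> U (g y) /\ f (g y) = y].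

Lemma Om0 : Om 0.
Proof.
by move=> j; rewrite /lam; case: unliftP => [i|] _; rewrite ?mxE ?big1 ?oppr0// => i _; rewrite mxE.
Qed.

Lemma Om_bounded (y : V) i : Om y -> `|y 0 i| <= n.+1%:R.
Proof.
move=> Oy; rewrite ler_norml -lamS; apply/andP; split.
  by apply: le_trans (ltW (Oy _)); rewrite lerN2 ler1n.
have := lam_sum y; rewrite (bigD1 (fintype.lift ord0 i))//= => /eqP.
rewrite addr_eq0 => /eqP ->; rewrite -sumrN.
apply: (@le_trans _ _ (\sum_(j < n.+1 | j != fintype.lift ord0 i) 1)).
  by apply: ler_sum => j _; rewrite lerNl; exact: ltW.
rewrite sumr_const ler_nat; apply: leq_trans (max_card _) _.
by rewrite card_ord.
Qed.

Lemma chart_at (x : M) (W : set M) : locally_euclidean R n M -> nbhs x W ->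
  exists U f g, [/\ chart U f g, U x, U `<=` W & f x = 0].
Proof.
move=> eM xW; have [U0 [V0 [f0 [g0 [[oU0 U0x] oV0]]]]] := eM x.
move=> [[f0c g0c f0V g0U] [fK gK]].
have {}f0c y : U0 y -> {for y, continuous f0} := within_open_continuous oU0 f0c.
have {}g0c y : V0 y -> {for y, continuous g0} := within_open_continuous oV0 g0c.
have V0x := f0V _ U0x.
have : nbhs (f0 x) (V0 `&` g0 @^-1` W).
  apply: filterI; first exact: open_nbhs_nbhs.
  by apply: (g0c _ V0x); rewrite fK.
move=> /nbhs_ballP[e /= e0 eVW].
(* Points of [Om] have coordinates of absolute value at most n + 1, so scaling by d brings [Om] into
   the ball of radius e. *)
pose d : R := e / n.+2%:R; have d0 : 0 < d by rewrite divr_gt0.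
have Ome y : Om y -> V0 (f0 x + d *: y) /\ W (g0 (f0 x + d *: y)).
  move=> Oy; apply: eVW; split=> // i j; rewrite ord1 /ball/= !mxE opprD addrA subrr add0r.
  rewrite normrN normrM gtr0_norm// /d -mulrA gtr_pMr// mulrC ltr_pdivrMr// mul1r.
  by rewrite (le_lt_trans (Om_bounded _ Oy))// ltr_nat.
pose f y := d^-1 *: (f0 y - f0 x); pose g y := g0 (f0 x + d *: y).
have fc y : U0 y -> {for y, continuous f}.
  move=> U0y; apply: cvgZl_tmp; apply: cvgB; last exact: cvg_cst.
  exact: f0c.
have f0E y : f0 x + d *: f y = f0 y.
  by rewrite /f scalerA mulfV ?gt_eqF// scale1r addrC subrK.
exists [set y | U0 y /\ Om (f y)], f, g; split.
- split=> [|y [U0y _]|y Oy|y [U0y Oy]|y Oy].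
  + rewrite openE => y [U0y Oy]; rewrite /interior; apply: filterI.
      exact: open_nbhs_nbhs.
    by apply: (fc _ U0y); apply: open_nbhs_nbhs; split=> //; exact: open_Om.
  + exact: fc.
  + apply: (@continuous_comp _ _ _ (fun y : V => f0 x + d *: y) g0 y).
      exact: affine_continuous.
    by apply: g0c; have [] := Ome _ Oy.
  + by split=> //; rewrite /g f0E fK.
  + have [Vy Wy] := Ome _ Oy; have fgy : f (g y) = y.
      by rewrite /f /g gK// addrC addrA addNr add0r scalerA mulVf ?gt_eqF// scale1r.
    by split=> //; split; [exact: g0U|rewrite fgy].
- by split=> //; rewrite /f subrr scaler0; exact: Om0.
- by move=> y [U0y Oy]; have [_] := Ome _ Oy; rewrite f0E fK.
- by rewrite /f subrr scaler0.
Qed.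

Definition Ka (U : set M) (f : M -> V) (a : 'I_n.+1 -> R) : set M :=
  [set x | U x /\ Sa a (f x)].

(** The local generator carried by the chart; its boundary stays off [Ka U f a] for every [inner]
    a. *)
Definition gam (g : V -> M) : chain n M := push g << aff (pv R n) >>.

Section Chart.
Hypothesis hM : hausdorff_space M.
Variables (U : set M) (f : M -> V) (g : V -> M).
Hypothesis Uf : chart U f g.
Local Notation K a := (Ka U f a).

Let oU : open U. Proof. by case: Uf. Qed.
Let fU : {within U, continuous f}.
Proof. by apply: continuous_at_within; case: Uf. Qed.
Let gO : {within Om, continuous g}.
Proof. by apply: continuous_at_within; case: Uf. Qed.
Let fO x : U x -> Om (f x). Proof. by case: Uf => _ _ _ + _ Ux => /(_ x Ux)[]. Qed.
Let fK x : U x -> g (f x) = x. Proof. by case: Uf => _ _ _ + _ Ux => /(_ x Ux)[]. Qed.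
Let gU y : Om y -> U (g y). Proof. by case: Uf => _ _ _ _ + Oy => /(_ y Oy)[]. Qed.
Let gK y : Om y -> f (g y) = y. Proof. by case: Uf => _ _ _ _ + Oy => /(_ y Oy)[]. Qed.

Lemma inner_Om a y : inner a -> Sa a y -> Om y.
Proof. by move=> ia Sy j; have := Sy j; have := ia j; lra. Qed.

Lemma Ka_compact a : inner a -> compact (K a).
Proof.
move=> ia.
have -> : K a = g @` Sa a.
  apply/seteqP; split=> [x [Ux Sx]|_ [y Sy <-]]; first by exists (f x) => //; exact: fK.
  by have Oy := inner_Om ia Sy; split; [exact: gU|rewrite gK].
apply: continuous_compact; last exact: Sa_compact.
by apply: continuous_subspaceW gO => y; exact: inner_Om.
Qed.

Lemma Ka_closed a : inner a -> closed (K a).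
Proof. by move=> ia; apply: compact_closed => //; exact: Ka_compact. Qed.

Lemma push_gf k (c : chain k M) : chain_in U c -> push g (push f c) = c.
Proof.
move=> Uc; rewrite (push_comp fU gO)//.
apply: (@push_eq_id _ _ _ U) => //.
by apply: continuous_at_within => x Ux; apply: continuous_comp;
  [case: Uf => _ + _ _ _; exact|case: Uf => _ _ + _ _; apply; exact: fO].
Qed.

Lemma push_fg k (c : chain k V) : chain_in Om c -> push f (push g c) = c.
Proof.
move=> Uc; rewrite (push_comp gO fU)//.
apply: (@push_eq_id _ _ _ Om) => //.
by apply: continuous_at_within => x Ux; apply: continuous_comp;
  [case: Uf => _ _ + _ _; exact|case: Uf => _ + _ _ _; apply; exact: gU].
Qed.

Lemma aff_pv_Om : chain_in Om << aff (pv R n) >>.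
Proof.
apply: chain_inU; apply: aff_in; first exact: Om_convex.
have i0 : inner (fun _ : 'I_n.+1 => 0 : R) by move=> j; lra.
by have [] := pv_position i0.
Qed.

Lemma gam_in : chain_in U (gam g).
Proof. exact: chain_in_push gU aff_pv_Om. Qed.

Lemma relb_push_g a k (c : chain k V) : relb Om (@offSa R n a k) c ->
  hzero (~` K a) (push g c).
Proof.
move=> /(@relb_push R V M g Om U k _ (fun s => range s `<=` ~` K a) c gO gU) [|e _ Ke]; last by exists e.
move=> s t st gst _ [x _ <-]; rewrite -gst => -[_].
by have [Ox nSx] := st _ (imageP s (Logic.I : setT x)); rewrite /= gK.
Qed.

Lemma push_f_off a k (c : chain k M) : chain_in U c -> chain_in (~` K a) c ->
  csupp (@offSa R n a k) (push f c).
Proof.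
move=> Uc Kc; apply: csupp_push (csupp_and Uc Kc) => s t [sU sK] fst _ [x _ <-].
rewrite -fst; have Ux := sU _ (imageP s (Logic.I : setT x)); split; first exact: fO.
by move=> Sx; apply: (sK _ (imageP s (Logic.I : setT x))); split.
Qed.

Lemma Ka_sub a : K a `<=` U. Proof. by move=> x []. Qed.

Lemma chart_generator a (c : chain n M) : inner a -> chain_in (~` K a) (boundary c) ->
  exists r : int, hzero (~` K a) (c - r *: gam g).
Proof.
move=> ia Kc; have [u [Uu Ku cu]] := excision oU (Ka_closed ia) (@Ka_sub a) Kc.
have [||r rc] := @Om_generator R n a (push f u) ia.
- exact: chain_in_push fO Uu.
- rewrite (boundary_push fU)//; apply: push_f_off => //; exact: chain_in_boundary.
exists r; apply: hzero_trans cu _.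
by rewrite -[u](push_gf Uu) /gam -pushZ -pushB; exact: relb_push_g.
Qed.

Lemma boundary_gam a : inner a -> chain_in (~` K a) (boundary (gam g)).
Proof.
move=> ia; rewrite /gam (boundary_push gO aff_pv_Om).
apply: (@csupp_push R V M g n.-1 (@offSa R n a n.-1)); last first.
  apply: csupp_sub (boundary_aff_small (pv_position ia)) => s; exact: small_offSa.
move=> s t sO gst _ [x _ <-]; rewrite -gst => -[_].
by have [Ox nSx] := sO _ (imageP s (Logic.I : setT x)); rewrite /= gK.
Qed.

Lemma chart_above a i (c : chain i.+1 M) : (n <= i)%N -> inner a ->
  chain_in (~` K a) (boundary c) -> hzero (~` K a) c.
Proof.
move=> ni ia Kc; have [u [Uu Ku cu]] := excision oU (Ka_closed ia) (@Ka_sub a) Kc.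
rewrite -[c](subrK u); apply: hzeroD => //; rewrite -(push_gf Uu); apply: relb_push_g.
apply: Om_above => //; first exact: chain_in_push fO Uu.
by rewrite (boundary_push fU)//; apply: push_f_off => //; exact: (@chain_in_boundary _ _ i.+1).
Qed.

Lemma chart_torsion_free a (r : int) : inner a -> \sum_j a j <= 0 ->
  hzero (~` K a) (r *: gam g) -> r = 0.
Proof.
move=> ia sa0 h; apply: (Om_torsion_free ia sa0).
have Ur : chain_in U (r *: gam g) by apply: chain_inZ; exact: gam_in.
have := excision_relb oU (Ka_closed ia) (@Ka_sub a) Ur h.
move=> /(@relb_push R M V f U Om n _ (@offSa R n a n) _ fU fO)[].
  move=> s t st fst _ [x _ <-]; rewrite -fst.
  have [Ux nKx] := st _ (imageP s (Logic.I : setT x)); split; first exact: fO.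
  by move=> Sx; apply: nKx; split.
by move=> e Oe; rewrite pushZ push_fg; [exists e|exact: aff_pv_Om].
Qed.

(** Since the forms sum to 0, lower bounds attained at x force equality. Points are thus sets [K a],
    and local homology at a point is a case of the results on these. *)
Lemma Ka_point x : U x -> K (lam (f x)) = [set x].
Proof.
move=> Ux; apply/seteqP; split=> [y [Uy /lam_inj e]|y ->]; last by split.
by rewrite -(fK Uy) -e fK.
Qed.

Lemma point_inner a x : inner a -> K a x -> inner (lam (f x)).
Proof. by move=> ia [_ Sx] j; apply: le_trans (ia j) (Sx j). Qed.

Lemma point_torsion_free a x (r : int) : inner a -> K a x ->
  hzero (~` [set x]) (r *: gam g) -> r = 0.
Proof.
move=> ia Kx; have [Ux _] := Kx; rewrite -(Ka_point Ux); apply: chart_torsion_free.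
  exact: point_inner Kx.
by rewrite lam_sum.
Qed.

(** Over [K a], c is a multiple of [gam g], which has infinite order already at x; so the multiple
    is 0. *)
Lemma hzero_point a x (c : chain n M) : inner a -> K a x ->
  chain_in (~` K a) (boundary c) -> hzero (~` [set x]) c -> hzero (~` K a) c.
Proof.
move=> ia Kx Kc hc; have [r rc] := chart_generator ia Kc.
suff r0 : r = 0 by move: rc; rewrite r0 scale0r subr0.
apply: (point_torsion_free ia Kx).
have -> : r *: gam g = c - (c - r *: gam g) by rewrite opprB addrC subrK.
by apply: hzeroB => //; apply: hzero_sub rc => y nKy e; apply: nKy; rewrite e.
Qed.

Definition KL (L : seq ('I_n.+1 -> R)) : set M := foldr (fun a A => K a `|` A) set0 L.

Fixpoint allL (P : ('I_n.+1 -> R) -> Prop) (L : seq ('I_n.+1 -> R)) : Prop :=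
  if L is a :: L' then P a /\ allL P L' else True.

Lemma KL_closed L : allL (@inner R n) L -> closed (KL L).
Proof.
elim: L => [|a L IH] /=; first by move=> _; exact: closed0.
by move=> [ia /IH cL]; apply: closedU => //; exact: Ka_closed.
Qed.

Lemma Ka_KL a L : K a `&` KL L = KL [seq (fun j => Num.max (a j) (b j)) | b <- L].
Proof.
elim: L => [|b L IH] /=; first by rewrite setI0.
rewrite setIUr IH; congr (_ `|` _); apply/seteqP; split=> x.
  by move=> [[Ux ax] [_ bx]]; split=> // j; rewrite ge_max ax bx.
by move=> [Ux m]; split; split=> // j; have := m j; rewrite ge_max => /andP[].
Qed.

(** The induction is on the length: Mayer-Vietoris calls for the intersection of [K a] with [KL L],
    which is [KL] of another list as long as L, in one dimension more. *)
Lemma KL_above i L (c : chain i.+1 M) : (n <= i)%N -> allL (@inner R n) L ->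
  chain_in (~` KL L) (boundary c) -> hzero (~` KL L) c.
Proof.
have [s] := ubnP (size L); elim: s i L c => // s IH i [|a L] c Ls ni.
  by move=> _ _; apply: hzero_in; rewrite /= setC0.
move=> [ia iL] Kc; apply: hzero_union.
- exact: Ka_closed.
- exact: KL_closed.
- move=> q; rewrite Ka_KL; apply: IH; first by rewrite size_map.
    exact: leqW.
  elim: {Ls Kc}L iL => //= b L IHL [ib iL]; split; last exact: IHL.
  by move=> j; rewrite le_max ia.
- by apply: chart_above => //; apply: chain_in_sub Kc => x nx Kx; apply: nx; left.
- by apply: IH => //; apply: chain_in_sub Kc => x nx Kx; apply: nx; right.
Qed.

Lemma KL_zero L (c : chain n M) : allL (@inner R n) L ->
  allL (fun a => hzero (~` K a) c) L -> hzero (~` KL L) c.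
Proof.
elim: L => [|a L IH] /=; first by move=> _ _; apply: hzero_in; rewrite setC0.
move=> [ia iL] [ha hL]; apply: hzero_union => //.
- exact: Ka_closed.
- exact: KL_closed.
- move=> q; rewrite Ka_KL; apply: KL_above => //.
  elim: {hL IH}L iL => //= b L IHL [ib iL]; split; last exact: IHL.
  by move=> j; rewrite le_max ia.
- exact: IH.
Qed.

Lemma Ka_nbhs a x : U x -> (forall j, a j < lam (f x) j) -> nbhs x (K a).
Proof.
move=> Ux ax; apply: (@filterS _ _ _ (U `&` f @^-1` [set y | forall j, a j < lam y j])).
  by move=> y [Uy ay]; split=> // j; exact: ltW.
apply: filterI; first exact: open_nbhs_nbhs.
have fx : {for x, continuous f} by case: Uf => _ + _ _ _; apply.
by apply: fx; apply: open_nbhs_nbhs; split=> //; exact: open_lam_gts.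
Qed.

(** The margin between 1/4 and the 1/2 of [inner] leaves room for the neighbourhoods of
    [small_Ka]. *)
Definition quarter : set M := [set x | U x /\ forall j, - (1 / 4) <= lam (f x) j].

Lemma small_Ka x W : quarter x -> nbhs x W -> exists a,
  [/\ inner a, K a x, nbhs x (K a) & K a `<=` W].
Proof.
move=> [Ux fx4] xW; have Ox := fO Ux.
have gx : {for f x, continuous g} by case: Uf => _ _ + _ _; apply.
have : nbhs (f x) (g @^-1` W) by apply: gx; rewrite fK.
(* The bound 1/4 keeps the lowered bounds [inner]. Lowering all of them by d lets a coordinate rise
   by at most d (n + 1), since the forms sum to 0; hence the denominator n + 2. *)
move=> /nbhs_ballP[e /= e0 eW]; pose d := Num.min (1 / 4) (e / n.+2%:R).
have d0 : 0 < d by rewrite lt_min divr_gt0//= divr_gt0.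
have d4 : d <= 1 / 4 by rewrite ge_min lexx.
have de : d * n.+1%:R < e.
  rewrite (@le_lt_trans _ _ (e / n.+2%:R * n.+1%:R))//.
    by rewrite ler_wpM2r// ge_min lexx orbT.
  by rewrite mulrAC ltr_pdivrMr// ltr_pM2l// ltr_nat.
exists (fun j => lam (f x) j - d); split.
- by move=> j; have := fx4 j; lra.
- by split=> // j; lra.
- by apply: Ka_nbhs => // j; lra.
move=> y [Uy ay]; rewrite -(fK Uy); apply: eW; split=> // i j; rewrite ord1 /ball/=.
have : \sum_j (lam (f y) j - lam (f x) j) = 0 by rewrite sumrB !lam_sum subrr.
rewrite (bigD1 (fintype.lift ord0 j))//= !lamS => /eqP; rewrite addr_eq0 => /eqP e1.
have up : f y 0 j - f x 0 j <= d * n.+1%:R.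
  rewrite e1 -sumrN (@le_trans _ _ (\sum_(i < n.+1 | i != fintype.lift ord0 j) d))//.
    by apply: ler_sum => l _; have := ay l; lra.
  rewrite sumr_const -[leLHS]mulr_natr; apply: ler_wpM2l; first exact: ltW.
  by rewrite ler_nat; apply: leq_trans (max_card _) _; rewrite card_ord.
have lo := ay (fintype.lift ord0 j); rewrite !lamS in lo.
have dn : d <= d * n.+1%:R by rewrite ler_pMr// ler1n.
by rewrite -normrN opprB ltr_norml; apply/andP; split; lra.
Qed.

(** Vanishing at x spreads to a small [K a] around x by [hzero_point]; finitely many of these cover
    A and are put together by [KL_zero]. *)
Lemma compact_hzero (A : set M) (c : chain n M) : compact A -> A `<=` quarter ->
  chain_in (~` A) (boundary c) -> (forall x, A x -> hzero (~` [set x]) c) ->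
  hzero (~` A) c.
Proof.
move=> cA Aq Ac hc.
(* Simplices have compact, hence closed, images: a chain that misses x misses a neighbourhood of
   x. *)
have off k (b : chain k M) x : chain_in (~` [set x]) b ->
    exists2 W, nbhs x W & chain_in (~` W) b.
  move: b; apply: csupp_ind => [|b b' [W xW Wb] [W' xW' Wb']|m b [W xW Wb]|s sx].
  - by exists setT; [exact: filterT|exact: csupp0].
  - exists (W `&` W'); first exact: filterI.
    apply: chain_inD; first by apply: chain_in_sub Wb => y nW [].
    by apply: chain_in_sub Wb' => y nW [].
  - by exists W => //; exact: chain_inZ.
  - exists (~` range s); last by apply: chain_inU; rewrite setCK.
    apply: open_nbhs_nbhs; split; last by move=> /sx; exact.
    by apply: closed_openC; apply: compact_closed => //; exact: range_simplex_compact.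
have /choice[a aP] : forall x : M, exists a, A x ->
    [/\ inner a, nbhs x (K a) & hzero (~` K a) c].
  move=> x; have [Ax|nAx] := pselect (A x); last by exists (fun=> 0).
  have [W xW Wc] : exists2 W, nbhs x W & chain_in (~` W) (boundary c).
    by apply: off; apply: chain_in_sub Ac => y nAy yx; apply: nAy; rewrite yx.
  have [a [ia Kx xK KW]] := small_Ka (Aq _ Ax) xW; exists a => _; split=> //.
  apply: (hzero_point ia Kx); last exact: hc.
  by apply: chain_in_sub Wc => y nWy /KW.
have [x Ax|x Ax|L [LA AL]] := @compact_seq_cover _ A _ A (fun x => interior (K (a x))) cA.
- exact: open_interior.
- by exists x => //; have [] := aP x Ax.
apply: (@hzero_sub _ _ (~` KL (map a L))).
  move=> y nKy Ay; apply: nKy; have [x /= xL xy] := AL _ Ay.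
  elim: L xL {LA AL} => //= z L IH; rewrite inE => /orP[/eqP <-|/IH]; last by right.
  by left; exact: interior_subset xy.
apply: KL_zero.
  elim: L LA {AL} => //= x L IH LA; split.
    by have [] := aP x (LA _ (mem_head _ _)).
  by apply: IH => y yL; apply: LA; rewrite inE yL orbT.
elim: L LA {AL} => //= x L IH LA; split.
  by have [] := aP x (LA _ (mem_head _ _)).
by apply: IH => y yL; apply: LA; rewrite inE yL orbT.
Qed.

End Chart.

Lemma Ka_nbhs0 U f g (hU : chart U f g) x : U x -> f x = 0 -> nbhs x (quarter U f).
Proof.
move=> Ux fx0; have := @Ka_nbhs U f g hU (fun=> - (1 / 4)) x Ux.
apply=> j; rewrite fx0 (_ : lam 0 j = 0); first by lra.
by rewrite /lam; case: unliftP => [i|] _; rewrite ?mxE ?big1 ?oppr0// => i _; rewrite mxE.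
Qed.

Lemma inner_quarter : @inner R n (fun=> - (1 / 4)).
Proof. by move=> j; lra. Qed.

Hypothesis hM : hausdorff_space M.
Hypothesis eM : locally_euclidean R n M.

(** A trivialisation of local homology near x: z restricts to a generator of infinite order over K
    and at each point of K. *)
Lemma local_frame (x : M) (W : set M) : nbhs x W -> exists (K : set M) (z : chain n M),
  [/\ nbhs x K, K `<=` W /\ chain_in (~` K) (boundary z),
      forall c : chain n M, chain_in (~` K) (boundary c) ->
        exists r : int, hzero (~` K) (c - r *: z),
      forall y (c : chain n M), K y -> chain_in (~` [set y]) (boundary c) ->
        exists r : int, hzero (~` [set y]) (c - r *: z) &
      forall y (r : int), K y -> hzero (~` [set y]) (r *: z) -> r = 0].
Proof.
move=> xW; have [U [f [g [hU Ux UW fx0]]]] := chart_at eM xW.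
exists (Ka U f (fun=> - (1 / 4))), (gam g); split.
- exact: (@Ka_nbhs0 U f g hU x Ux fx0).
- split; first by move=> y [Uy _]; exact: UW.
  exact: (@boundary_gam U f g hU _ inner_quarter).
- move=> c; apply: chart_generator => //; exact: inner_quarter.
- move=> y c Ky; have [Uy _] := Ky; rewrite -(Ka_point hU Uy).
  by apply: chart_generator => //; apply: point_inner Ky; exact: inner_quarter.
- by move=> y r Ky; apply: (point_torsion_free hM hU inner_quarter Ky).
Qed.

Lemma locally_generator (x : M) (c : chain n M) : boundary c = 0 ->
  exists2 K, nbhs x K & forall y, K y ->
    (local_generator x c <-> local_generator y c).
Proof.
move=> c0; have [K [z [xK [_ Kz] gen pgen tf]]] := local_frame (@filterT _ (nbhs x) _).
have [|r rc] := gen c; first by rewrite c0; exact: csupp0.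
(* Over K, c is r times z, and it is a generator at y when r is invertible, a condition that does
   not involve y. *)
have key y : K y -> (local_generator y c <-> exists m, m * r = 1).
  move=> Ky; have yc : hzero (~` [set y]) (c - r *: z).
    by apply: hzero_sub rc => w nKw e; apply: nKw; rewrite e.
  have yz : chain_in (~` [set y]) (boundary z).
    by apply: chain_in_sub Kz => w nKw e; apply: nKw; rewrite e.
  split=> [[_ /(_ z yz)[m zc]]|[m mr]].
    exists m; apply/eqP; rewrite eq_sym -subr_eq0; apply/eqP/(tf y) => //.
    have -> : (1 - m * r) *: z = (z - m *: c) + m *: (c - r *: z).
      by rewrite scalerBl scale1r scalerBr scalerA addrA subrK.
    by apply: hzeroD => //; exact: hzeroZ.
  split=> [|c' yc']; first by rewrite /relative_cycle c0; exact: csupp0.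
  have [r' c'z] := pgen y c' Ky yc'; exists (r' * m).
  change (hzero (~` [set y]) (c' - (r' * m) *: c)).
  have -> : c' - (r' * m) *: c = (c' - r' *: z) - (r' * m) *: (c - r *: z).
    by rewrite scalerBr scalerA -mulrA mr mulr1 opprB addrA subrK.
  by apply: hzeroB => //; exact: hzeroZ.
exists K => // y Ky; have Kx := nbhs_singleton xK.
by split=> [/(key _ Kx)/(key _ Ky)|/(key _ Ky)/(key _ Kx)].
Qed.

(** Exactness of Mayer-Vietoris: a - b vanishes at the points of the intersection, hence on all of
    it by [compact_hzero], and the remainder off the intersection splits into corrections of a and
    of b. *)
Lemma glue_classes (A B : set M) U f g (a b : chain n M) :
  chart U f g -> compact A -> compact B -> A `&` B `<=` quarter U f ->
  chain_in (~` A) (boundary a) -> chain_in (~` B) (boundary b) ->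
  (forall x, A x -> B x -> hzero (~` [set x]) (a - b)) ->
  exists c : chain n M, [/\ chain_in (~` (A `|` B)) (boundary c),
    hzero (~` A) (c - a) & hzero (~` B) (c - b)].
Proof.
move=> hU cA cB ABq Aa Bb ab.
have clA := compact_closed hM cA; have clB := compact_closed hM cB.
have [||x [Ax Bx]|e he] := @compact_hzero hM _ _ _ hU (A `&` B) (a - b) _ ABq.
- by rewrite setIC; exact: compact_closedI.
- rewrite boundaryB; apply: chain_inB.
    by apply: chain_in_sub Aa => x nA [/nA].
  by apply: chain_in_sub Bb => x nB [_ /nB].
- exact: ab.
have [x|m [wA [wB [E wAH wBH]]]] :=
    @sdIter_split _ _ _ _ _ _ _ (closed_openC clA) (closed_openC clB) he.
  by rewrite setCI.
have {}wAH : chain_in (~` A) wA by apply: chain_in_sub wAH => x [].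
have {}wBH : chain_in (~` B) wB by apply: chain_in_sub wBH => x [].
have cE : sdIter m a - wA = sdIter m b + wB + sdIter m (boundary e).
  by apply: zmod_swap; rewrite -E !sdIterB.
have hA : hzero (~` A) (sdIter m a - wA - a).
  rewrite addrAC; apply: hzeroB; last exact: hzero_in.
  by apply: hzero_sym; exact: hzero_sdIter.
have hB : hzero (~` B) (sdIter m a - wA - b).
  rewrite cE addrAC [_ + wB - b]addrAC; apply: hzeroD.
    apply: hzeroD; last exact: hzero_in.
    by apply: hzero_sym; exact: hzero_sdIter.
  by rewrite -boundary_sdIter; exact: hzero_boundary.
exists (sdIter m a - wA); split=> //.
have cA' : chain_in (~` A) (boundary (sdIter m a - wA)).
  rewrite -[_ - wA](subrK a) boundaryD; apply: chain_inD => //; exact: hzero_cycle.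
have cB' : chain_in (~` B) (boundary (sdIter m a - wA)).
  rewrite -[_ - wA](subrK b) boundaryD; apply: chain_inD => //; exact: hzero_cycle.
apply: csupp_sub (csupp_and cA' cB') => s [sA sB] x sx.
by case; [exact: sA|exact: sB].
Qed.

End Manifold.

(** * Fundamental cycles *)

Section FundamentalCycle.
Variables (R : realType) (n : nat) (M : topologicalType).
Local Notation chain := (chain R).
Hypothesis hM : hausdorff_space M.
Hypothesis eM : locally_euclidean R n M.
Variable o : M -> chain n M.
Hypothesis oM : is_orientation o.

Lemma quarter_class (x : M) : exists (B : set M) (b : chain n M),
  [/\ nbhs x B, compact B, exists U (f : M -> 'rV[R]_n) g, chart U f g /\ B = quarter U f,
      chain_in (~` B) (boundary b) & forall y, B y -> hzero (~` [set y]) (b - o y)].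
Proof.
have [_ /(_ x)[W [xW [c [cW cy]]]]] := oM.
have [U [f [g [hU Ux UW fx0]]]] := chart_at eM xW.
have qW : quarter U f `<=` W by move=> y [/UW].
exists (quarter U f), c; split.
- exact: (@Ka_nbhs0 _ _ _ U f g hU x Ux fx0).
- exact: (Ka_compact hU (@inner_quarter R n)).
- by exists U, f, g.
- by apply: chain_in_sub cW => y nWy /qW.
- by move=> y /qW; exact: cy.
Qed.

Lemma fundamental_cycle_exists : compact [set: M] -> exists c, fundamental_cycle o c.
Proof.
move=> cM; have /choice[B /choice[b Bb]] := quarter_class.
have [x _|x _|L [_ LM]] := @compact_seq_cover M setT _ setT (fun x => interior (B x)) cM.
- exact: open_interior.
- by exists x => //; have [] := Bb x.
pose A := foldr (fun x A => A `|` B x) set0.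
suff [c [Ac oc]] : exists c : chain n M, chain_in (~` A L) (boundary c) /\
    forall y, A L y -> hzero (~` [set y]) (c - o y).
  have AL y : A L y.
    have [x xL xy] := LM y Logic.I; elim: L xL {LM Ac oc} => //= z L IH.
    rewrite inE => /orP[/eqP <-|/IH]; last by left.
    by right; exact: interior_subset xy.
  exists c; split=> [|y]; last exact: oc.
  (* Here [A L] is the whole space, and a chain off the whole space has no simplices: the relative
     cycle is a cycle. *)
  apply: (csupp_false Ac) => s sA.
  by apply: (sA (s (vertex R ord0))); first exact: imageP.
elim: L {LM} => [|x L [a [Aa ao]]] /=.
  by exists 0; split=> //; rewrite linear0; exact: csupp0.
have cA : compact (A L).
  by elim: (L) => [|y L' IH] /=; [exact: compact0|apply: compactU => //; have [] := Bb y].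
have [_ cB [U [f [g [hU BU]]]] Bx ox] := Bb x.
have [|y Ay By|c [Ac ca cb]] := glue_classes hM hU cA cB _ Aa Bx.
- by rewrite -BU => y [].
- have -> : a - b x = (a - o y) - (b x - o y) by rewrite opprB addrA subrK.
  by apply: hzeroB; [exact: ao|exact: ox].
exists c; split=> // y [Ay|By].
- rewrite -[c](subrK a) -addrA; apply: hzeroD; last exact: ao.
  by apply: hzero_sub ca => z nA e; apply: nA; rewrite e.
- rewrite -[c](subrK (b x)) -addrA; apply: hzeroD; last exact: ox.
  by apply: hzero_sub cb => z nB e; apply: nB; rewrite e.
Qed.

End FundamentalCycle.

Section Multiple.
Variables (R : realType) (n : nat) (M : topologicalType).
Local Notation chain := (chain R).
Hypothesis hM : hausdorff_space M.
Hypothesis eM : locally_euclidean R n M.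

Lemma generator_unit (x : M) (z : chain n M) (r : int) :
  local_generator x z -> hzero (~` [set x]) (r *: z) -> r = 0.
Proof.
move=> [_ gen] rz; have [K [z0 [xK [_ Kz] _ _ tf]]] := local_frame hM eM (@filterT _ (nbhs x) _).
have Kx := nbhs_singleton xK; have [|k zk] := gen z0.
  by apply: chain_in_sub Kz => w nKw e; apply: nKw; rewrite e.
apply: (tf x) => //; have -> : r *: z0 = r *: (z0 - k *: z) + k *: (r *: z).
  by rewrite scalerBr !scalerA mulrC subrK.
by apply: hzeroD; exact: hzeroZ.
Qed.

(** In a [local_frame] both [o x] and [a *: z] are constant, so the points where they agree form an
    open and closed set. The equation [a * b = 1] makes a a sign. *)
Lemma orientation_multiple (o : M -> chain n M) (z : chain n M) (x0 : M) :
  connected [set: M] -> is_orientation o -> boundary z = 0 ->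
  (forall x, local_generator x z) ->
  exists a b : int, a * b = 1 /\ forall x, hzero (~` [set x]) (o x - a *: z).
Proof.
move=> conM [go lo] z0 gz.
have [a oa] := (gz x0).2 _ (go x0).1; have [b zb] := (go x0).2 _ (gz x0).1.
exists a, b; split.
  apply/eqP; rewrite eq_sym -subr_eq0; apply/eqP/(generator_unit (gz x0)).
  have -> : (1 - a * b) *: z = (z - b *: o x0) + b *: (o x0 - a *: z).
    by rewrite scalerBl scale1r scalerBr scalerA addrA subrK mulrC.
  by apply: hzeroD => //; exact: hzeroZ.
have key x : exists2 K, nbhs x K & forall y, K y ->
    (hzero (~` [set x]) (o x - a *: z) <-> hzero (~` [set y]) (o y - a *: z)).
  have [W [xW [c [Wc oc]]]] := lo x.
  have [K [w [xK [KW Kw] gen _ tf]]] := local_frame hM eM xW.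
  have [|r rc] := gen (c - a *: z).
    rewrite boundaryB boundaryZ z0 scaler0 subr0.
    by apply: chain_in_sub Wc => y nWy /KW.
  have eq y : K y -> (hzero (~` [set y]) (o y - a *: z) <-> r = 0).
    move=> Ky; have yc : hzero (~` [set y]) (o y - a *: z - r *: w).
      have -> : o y - a *: z - r *: w = (c - a *: z - r *: w) - (c - o y).
        by rewrite opprB [RHS]addrC !addrA subrK.
      apply: hzeroB; last exact/oc/KW.
      by apply: hzero_sub rc => v nKv e; apply: nKv; rewrite e.
    split=> [hc|r0]; last by move: yc; rewrite r0 scale0r subr0.
    apply: (tf y) => //; have -> : r *: w = (o y - a *: z) - (o y - a *: z - r *: w).
      by rewrite opprB addrC subrK.
    exact: hzeroB.
  exists K => // y Ky; have Kx := nbhs_singleton xK.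
  by split=> [/(eq _ Kx)/(eq _ Ky)|/(eq _ Ky)/(eq _ Kx)].
pose B := [set x | hzero (~` [set x]) (o x - a *: z)].
suff BT : B = setT by move=> x; have : B x by rewrite BT.
apply: conM; first by exists x0.
  exists B; last by rewrite setTI.
  rewrite openE => x hx; have [K xK Kc] := key x.
  by rewrite /interior; apply: filterS xK => y /Kc[+ _]; apply.
exists B; last by rewrite setTI.
rewrite -[X in closed X]setCK; apply: open_closedC.
rewrite openE => x hx; have [K xK Kc] := key x.
by rewrite /interior; apply: filterS xK => y /Kc[_ h] /h.
Qed.

End Multiple.

(** * Cycles as glued simplices *)

Section SignedSums.
Variable T : choiceType.

(** Multiplicities become repetitions, because the matching of faces works with coefficients 1 and
    -1. *)
Lemma signed_repr (c : {freeg T / int}) : exists L : seq (bool * T),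
  c = \sum_(x <- L) (-1) ^+ x.1 *: << x.2 >>.
Proof.
have := @csuppT _ c; move: c; apply: csupp_ind => [|c c' [L ->] [L' ->]|m c [L ->]|x _].
- by exists [::]; rewrite big_nil.
- by exists (L ++ L'); rewrite big_cat.
- have opp : exists L' : seq (bool * T), - (\sum_(x <- L) (-1) ^+ x.1 *: << x.2 >>) =
      \sum_(x <- L') (-1) ^+ x.1 *: << x.2 >> :> {freeg T / int}.
    exists [seq (~~ x.1, x.2) | x <- L]; rewrite big_map -sumrN.
    by apply: eq_bigr => x _ /=; rewrite signrN scaleNr.
  have rep (L' : seq (bool * T)) (k : nat) : exists L'' : seq (bool * T), k%:Z *: (\sum_(x <- L') (-1) ^+ x.1 *: << x.2 >>) =
      \sum_(x <- L'') (-1) ^+ x.1 *: << x.2 >> :> {freeg T / int}.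
    elim: k => [|k [L'' e]]; first by exists [::]; rewrite scale0r big_nil.
    by exists (L' ++ L''); rewrite big_cat/= -e intS scalerDl scale1r.
  case: m => k; first exact: rep.
  have [L' eL] := opp; have [L'' e] := rep L' k.+1.
  by exists L''; rewrite NegzE scaleNr -scalerN eL.
- by exists [:: (false, x)]; rewrite big_seq1 expr0 scale1r.
Qed.

(** Each label occurs equally often with either sign; occurrences at the same rank in the two lists
    are matched. *)
Lemma sign_matching (P : finType) (sg : pred P) (lab : P -> T) :
  \sum_p (-1) ^+ sg p *: << lab p >> = 0 :> {freeg T / int} ->
  exists f : P -> P, [/\ involutive f, forall p, lab (f p) = lab p &
    forall p, sg (f p) = ~~ sg p].
Proof.
move=> s0; pose E b t := [seq p <- enum P | (lab p == t) && (sg p == b)].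
have sE t : size (E true t) = size (E false t).
  have := congr1 (coeff t) s0; rewrite raddf_sum raddf0/=.
  under eq_bigr do rewrite coeffZ coeffU mul1r.
  rewrite (bigID sg)/= (eq_bigr (fun p => - (lab p == t)%:R)); last first.
    by move=> p ->; rewrite expr1 mulN1r.
  rewrite [X in _ + X](eq_bigr (fun p => (lab p == t)%:R)); last first.
    by move=> p /negPf ->; rewrite expr0 mul1r.
  rewrite sumrN addrC => /eqP; rewrite subr_eq0.
  have cnt b : \sum_(p | sg p == b) ((lab p == t)%:R : int) = (size (E b t))%:R.
    rewrite -natr_sum; congr (_%:R); rewrite size_filter -sum1_count [RHS]big_enum_cond/=.
    rewrite big_mkcond [RHS]big_mkcond/=; apply: eq_bigr => p _.
    by case: (sg p == b); case: (lab p == t).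
  have cT : \sum_(p | sg p) ((lab p == t)%:R : int) = (size (E true t))%:R.
    by rewrite -cnt; apply: eq_bigl => p; rewrite eqb_id.
  have cF : \sum_(p | ~~ sg p) ((lab p == t)%:R : int) = (size (E false t))%:R.
    by rewrite -cnt; apply: eq_bigl => p; rewrite eqbF_neg.
  by rewrite cT cF eqr_nat => /eqP ->.
pose f p := nth p (E (~~ sg p) (lab p)) (index p (E (sg p) (lab p))).
have inE p : p \in E (sg p) (lab p) by rewrite mem_filter !eqxx mem_enum.
have sEb b t : size (E (~~ b) t) = size (E b t) by case: b; rewrite sE.
have fE p : f p \in E (~~ sg p) (lab p).
  by apply: mem_nth; rewrite sEb index_mem.
have [fs fl] : (forall p, sg (f p) = ~~ sg p) /\ (forall p, lab (f p) = lab p).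
  by split=> p; have := fE p; rewrite mem_filter => /andP[/andP[/eqP + /eqP +] _].
exists f; split=> // p; rewrite {1}/f fs fl negbK.
have -> : index (f p) (E (~~ sg p) (lab p)) = index p (E (sg p) (lab p)).
  rewrite /f index_uniq//; first by rewrite sEb index_mem.
  by rewrite filter_uniq// enum_uniq.
by rewrite nth_index.
Qed.

End SignedSums.

Section Model.
Variable R : realType.
Local Notation chain := (chain R).
Local Notation simplex := (singular_simplex R).

(* The simplices of the barycentric subdivision of a cycle, with the involutions
   gluing them along their faces. *)
Lemma subdivided_cycle (X : topologicalType) n (c : chain n.+1 X) : boundary c = 0 ->
  exists (V : finType) (sg : pred V) (phi : V -> simplex n.+1 X) (tau : 'I_n.+2 -> V -> V),
  [/\ forall k, involutive (tau k), forall k v, sg (tau k v) = ~~ sg v,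
      forall k v, sface k (phi (tau k v)) = sface k (phi v) &
      \sum_v (-1) ^+ sg v *: << phi v >> = Sd c].
Proof.
have [L ->] := signed_repr c; rewrite big_tnth => bd0.
pose J := 'I_(size L); pose e (j : J) := (tnth (in_tuple L) j).1.
pose s (j : J) := (tnth (in_tuple L) j).2.
have [|f [ff fl fs]] := @sign_matching (simplex n X) (J * 'I_n.+2)%type
    (fun p => e p.1 (+) odd p.2) (fun p => sface p.2 (s p.1)).
  rewrite -(pair_bigA _ (fun (j : J) (i : 'I_n.+2) =>
    (-1) ^+ (e j (+) odd i) *: << sface i (s j) >> : chain n X))/=.
  rewrite -[RHS]bd0 linear_sum; apply: eq_bigr => j _.
  rewrite [RHS](@boundaryZ R X n.+1) boundaryU scaler_sumr; apply: eq_bigr => i _.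
  by rewrite scalerA signr_addb signr_odd.
have [g lg gl] := lift_perm_bij (@ord_max n.+1).
pose V := (J * 'S_n.+2)%type.
pose glue (v : V) : V :=
  let q := f (v.1, (g v.2).1) in (q.1, lift_perm ord_max q.2 (g v.2).2).
have glift i r : g (lift_perm ord_max i r) = (i, r) by exact: (lg (i, r)).
have gE v : v = (v.1, lift_perm ord_max (g v.2).1 (g v.2).2).
  by rewrite [lift_perm _ _ _](gl v.2); case: v.
pose sw (l : 'I_n.+1) := tperm (widen_ord (leqnSn _) l) (fintype.lift ord0 l).
(* Vertices of small simplices are numbered by the dimension of the face whose barycentre they are,
   and the gluing respects these numbers. Opposite to the last vertex one crosses a face of a
   simplex of c, by the matching f; elsewhere one stays in the same simplex of c. *)
pose tau (k : 'I_n.+2) (v : V) : V :=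
  if unlift ord_max k is Some l then (v.1, (sw l * v.2)%g) else glue v.
have liftmax l : fintype.lift ord_max l = widen_ord (leqnSn _) l :> 'I_n.+2.
  by apply: val_inj; rewrite /= /bump leqNgt ltn_ord.
exists V, (fun v : V => e v.1 (+) odd_perm v.2), (fun v : V => sd_simplex v.2 (s v.1)), tau.
clear bd0; split.
- move=> k v; rewrite /tau; case: (unlift ord_max k) => [l|] /=.
    by case: v => j p /=; rewrite mulgA tperm2 mul1g.
  rewrite {1}/glue /= glift/= -surjective_pairing ff /=.
  by rewrite [lift_perm _ _ _](gl v.2); case: v.
- move=> k v; rewrite /tau; case: (unlift ord_max k) => [l|] /=.
    rewrite odd_permM odd_tperm addbA [_ (+) (_ != _)]addbC -addbA.
    by rewrite -val_eqE/= neq_ltn ltnS leqnn.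
  have aux (a b m i i' r : bool) : a (+) i = ~~ (b (+) i') ->
      a (+) (m (+) i (+) r) = ~~ (b (+) (m (+) i' (+) r)).
    by case: a b m i i' r => [] [] [] [] [] [].
  by rewrite [v in RHS]gE /= !odd_lift_perm; exact: aux (fs (v.1, (g v.2).1)).
- move=> k v; rewrite /tau; case: unliftP => [l ->|-> ] /=.
    rewrite liftmax; apply/continuousEP => x; apply: (congr1 (s v.1)); exact: bary_swap.
  have := fl (v.1, (g v.2).1); case: (f _) => j i /= h.
  apply/continuousEP => x /=.
  rewrite -[LHS]/(s j (bary R (lift_perm ord_max i (g v.2).2) (face ord_max x))).
  rewrite -[RHS]/(s v.1 (bary R v.2 (face ord_max x))).
  rewrite [in RHS](_ : v.2 = lift_perm ord_max (g v.2).1 (g v.2).2); last by rewrite [lift_perm _ _ _](gl v.2).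
  by rewrite !bary_face_max; exact: (congr1 (fun t : simplex n X => t (bary R (g v.2).2 x)) h).
- rewrite linear_sum -(pair_bigA _ (fun (j : J) (p : 'S_n.+2) =>
    (-1) ^+ (e j (+) p) *: << sd_simplex p (s j) >> : chain n.+1 X))/=.
  apply: eq_bigr => j _; rewrite linearZ/= SdU scaler_sumr; apply: eq_bigr => p _.
  by rewrite scalerA signr_addb.
Qed.

End Model.

Lemma convex_set_convexe (R : realType) d (A : set 'rV[R]_d) :
  @convex_set R 'rV[R]_d A <-> convexe A.
Proof.
split=> [cA x y t Ax Ay t0 t1|cA x y l /set_mem Ax /set_mem Ay].
  have := cA y x (Itv01 t0 t1) (mem_set Ay) (mem_set Ax) => /set_mem.
  congr (A _); rewrite -[LHS]/(t *: y + (1 - t) *: x).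
  by rewrite scalerBl scalerBr scale1r addrCA.
apply/mem_set; have := cA y x l%:num Ay Ax => /(_ _ _)H.
have -> : conv l x y = y + l%:num *: (x - y).
  rewrite -[LHS]/(l%:num *: x + (1 - l%:num) *: y).
  by rewrite scalerBl scalerBr scale1r addrCA.
exact: H.
Qed.

Lemma exists_sorting_perm n (f : 'I_n -> nat) :
  exists s : 'S_n, forall i j, (f i < f j)%N -> (s j < s i)%N.
Proof.
pose r i j := (f j <= f i)%N.
have rtot : total r by move=> i j; exact: leq_total.
have rtr : transitive r by move=> j i k; rewrite /r => ij jk; exact: leq_trans jk ij.
pose L := sort r (enum 'I_n).
have sL : size L = n by rewrite size_sort size_enum_ord.
have inL i : i \in L by rewrite mem_sort mem_enum.
have iL i : (index i L < n)%N by rewrite -[X in (_ < X)%N]sL index_mem.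
pose g i := Ordinal (iL i).
have gi : injective g.
  by move=> i j /(congr1 val)/= e; rewrite -(nth_index i (inL i)) e nth_index.
exists (perm gi) => i j fij; rewrite !permE/= ltnNge; apply/negP => gij.
have := sorted_leq_nth rtr (fun i => leqnn _) i (sort_sorted rtot (enum 'I_n)).
move=> /(_ (index i L) (index j L)); rewrite !inE -/L sL !iL => /(_ isT isT gij).
by rewrite !nth_index// /r leqNgt fij.
Qed.

(** * Flags and the permutahedron *)

Section Permutahedron.
Variables (R : realType) (n : nat) (eps : nat -> R).
Hypothesis hp : permutahedron_parameters n eps.
Local Notation V := 'rV[R]_n.+1.
Local Notation I := 'I_n.+1.

(** With the end values 1 and 0 the coordinates of a vertex telescope, and the empty and the full
    set have slack 0 on the hyperplane. *)
Definition epse (k : nat) : R := if k == 0 then 1 else if k == n.+1 then 0 else eps k.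

Lemma epse_half k : (k <= n)%N -> 2 * epse k.+1 < epse k.
Proof.
case: hp => e0 e1 e2; rewrite /epse; case: k => [|k] kn /=.
  case: eqP => [_|]; first by lra.
  by lra.
rewrite eqSS; have -> : (k.+1 == n.+1) = false by apply/negbTE; rewrite eqSS neq_ltn kn.
case: (eqVneq k.+1 n) => [_|k1]; first by rewrite mulr0; apply: e0; rewrite kn.
by apply: (e2 k.+2); rewrite /= ltn_neqAle k1.
Qed.

Lemma epseE k : (1 <= k <= n)%N -> epse k = eps k.
Proof. by rewrite /epse; case: k => //= k kn; rewrite eqSS ltn_eqF. Qed.

Lemma epse_ge0 k : (k <= n.+1)%N -> 0 <= epse k.
Proof.
move=> kn; rewrite /epse; case: ifP => // k0; case: ifP => // k1; apply: ltW.
by have [+ _ _] := hp; apply; rewrite lt0n k0 -ltnS ltn_neqAle k1.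
Qed.

Lemma epse_le k m : (k <= m)%N -> (m <= n.+1)%N -> epse m <= epse k.
Proof.
elim: m => [|m IH]; first by rewrite leqn0 => /eqP ->.
rewrite leq_eqVlt => /predU1P[-> //|]; rewrite ltnS => km mn.
by have := epse_half mn; have := IH km (ltnW mn); have := epse_ge0 mn; lra.
Qed.

Definition lsum (w : {set I}) (x : V) : R := \sum_(i in w) x 0 i.

Definition slack (w : {set I}) (x : V) : R := 1 - epse #|w| - lsum w x.

Definition Hrep : set V := [set x | lsum finset.setT x = 1 /\ forall w, 0 <= slack w x].

Lemma lsum_line w x y t : lsum w (x + t *: (y - x)) = lsum w x + t * (lsum w y - lsum w x).
Proof.
rewrite /lsum -sumrB mulr_sumr -big_split; apply: eq_bigr => i _.
by rewrite !mxE.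
Qed.

Lemma slack_line w x y t : slack w (x + t *: (y - x)) = slack w x + t * (slack w y - slack w x).
Proof. by rewrite /slack lsum_line; ring. Qed.

Lemma lsum_continuous w : continuous (lsum w).
Proof.
move=> x; apply: (@cvg_bigsum R _ _ (nbhs x) (nbhs_filter x)) => i.
exact: (@coord_continuous R 1 n.+1 0 i x).
Qed.

Lemma slack_continuous w : continuous (slack w).
Proof.
by move=> x; apply: (@cvgB _ _ _ (nbhs x) (nbhs_filter x) _ _ _ _ (cvg_cst _) (@lsum_continuous w x)).
Qed.

Lemma Hrep_convex : convexe Hrep.
Proof.
move=> x y t [x1 x0] [y1 y0] t0 t1; split.
  by rewrite lsum_line x1 y1 subrr mulr0 addr0.
move=> w; rewrite slack_line; have := x0 w; have := y0 w; nra.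
Qed.

Lemma slack_set0 x : slack finset.set0 x = 0.
Proof. by rewrite /slack /lsum cards0 big_set0 /epse/= subrr subr0. Qed.

Lemma slack_setT x : lsum finset.setT x = 1 -> slack finset.setT x = 0.
Proof. by rewrite /slack => ->; rewrite cardsT card_ord /epse/= eqxx subr0 subrr. Qed.

Definition dset (s : 'S_n.+1) k : {set I} := [set i | (s i < k)%N].

Lemma card_down s k : (k <= n.+1)%N -> #|dset s k| = k.
Proof.
move=> kn.
have winj : injective (widen_ord kn) by move=> i j /(congr1 val) /= /val_inj.
rewrite -[RHS](card_ord k) -(card_imset predT winj).
have -> : dset s k = s @^-1: [set j : I | (j < k)%N]%SET by apply/setP => i; rewrite !inE.
rewrite card_preimset; last exact: perm_inj; apply: eq_card => i.
rewrite !inE; apply/idP/imsetP => [ik|[j _ ->]]; last by rewrite /= ltn_ord.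
by exists (Ordinal ik) => //; exact: val_inj.
Qed.

Local Notation vert := (@permutahedron_vertex R n eps).

Lemma vertE s i : vert s 0 i = epse (s i) - epse (s i).+1.
Proof.
rewrite mxE /epse eqSS /=; congr (_ - _); case: eqP => //= _.
by rewrite ltn_eqF.
Qed.

Lemma lsum_down s k : (k <= n.+1)%N -> lsum (dset s k) (vert s) = 1 - epse k.
Proof.
move=> kn; rewrite /lsum (eq_bigr (fun i => epse (s i) - epse (s i).+1)); last first.
  by move=> i _; exact: vertE.
rewrite (eq_bigl (fun i => (s i < k)%N)); last by move=> i; rewrite inE.
rewrite (reindex_inj (@perm_inj _ (s^-1)%g))/=.
under eq_bigl do rewrite permKV; under eq_bigr do rewrite permKV.
rewrite -(big_ord_widen_cond _ predT (fun j => epse j - epse j.+1) kn)/=.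
rewrite -(big_mkord predT (fun j => epse j - epse j.+1)).
have -> : \sum_(0 <= j < k) (epse j - epse j.+1) = - \sum_(0 <= j < k) (epse j.+1 - epse j).
  by rewrite -sumrN; apply: eq_bigr => j _; rewrite opprB.
by rewrite telescope_sumr// opprB /epse.
Qed.

Lemma dset_setT s : dset s n.+1 = finset.setT.
Proof. by apply/setP => i; rewrite !inE ltn_ord. Qed.

Lemma vert_Hrep s : Hrep (vert s).
Proof.
have s1 : lsum finset.setT (vert s) = 1.
  by rewrite -(dset_setT s) lsum_down// /epse eqxx/= subr0.
split=> // w; have [wn|] := leqP #|w| n; last first.
  move=> nw; have -> : w = finset.setT; last by rewrite slack_setT.
  by apply/eqP; rewrite eqEcard finset.subsetT cardsT card_ord.
have wn1 := leqW wn.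
(* Either w is the set of the largest coordinates, or it misses one of them, i, which alone exceeds
   [epse #|w|]. *)
have [/subset_leqif_cards[]|/subsetPn[i]] := boolP (dset s #|w| \subset w).
  by rewrite card_down// eqxx => _ /esym/eqP e; rewrite /slack -{2}e lsum_down// subrr.
rewrite inE => iw niw.
have g0 j : 0 <= vert s 0 j.
  have := epse_half (_ : s j <= n)%N; rewrite -ltnS vertE => /(_ (ltn_ord _)).
  by have := epse_ge0 (ltn_ord (s j)); lra.
have up : lsum w (vert s) <= 1 - vert s 0 i.
  have := s1; rewrite {1}/lsum (bigD1 i) ?inE//= addrC => /(canRL (addrK _)) <-.
  rewrite /lsum big_mkcond [leRHS]big_mkcond/=; apply: ler_sum => j _; rewrite inE/=.
  case: (boolP (j \in w)) => jw; last by case: ifP.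
  by rewrite ifT//; apply: contraNneq niw => <-.
rewrite /slack subr_ge0; apply: le_trans up _; rewrite lerD2l lerN2 vertE.
have := epse_half (_ : s i <= n)%N; rewrite -ltnS => /(_ (ltn_ord _)).
by have := epse_le iw wn1; lra.
Qed.

Lemma slack_submod w u x : slack (w :&: u) x + slack (w :|: u) x =
  slack w x + slack u x + (epse #|w| + epse #|u| - epse #|w :&: u| - epse #|w :|: u|).
Proof.
have e : lsum (w :&: u) x + lsum (w :|: u) x = lsum w x + lsum u x.
  rewrite /lsum !(big_mkcond (fun i => i \in _)) -!big_split/=.
  by apply: eq_bigr => i _; rewrite !inE; do 2!case: (_ \in _); rewrite /= ?add0r ?addr0.
by rewrite /slack; have -> : lsum (w :&: u) x = lsum w x + lsum u x - lsum (w :|: u) x;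
  [rewrite -e addrK|ring].
Qed.

(* Because eps decreases faster than 2 ^- k. *)
Lemma tight_chain x w u : Hrep x -> slack w x = 0 -> slack u x = 0 ->
  (w \subset u) || (u \subset w).
Proof.
move=> [_ x0] w0 u0; apply/norP => -[/negPf wu /negPf uw].
have := slack_submod w u x; rewrite w0 u0 addr0 add0r => e.
have wn (v : {set I}) : (#|v| <= n.+1)%N by rewrite -[X in (_ <= X)%N]card_ord max_card.
have lw : (#|w :&: u| < #|w|)%N.
  rewrite proper_card// properE finset.subsetIl; apply/negP => h.
  by rewrite (fintype.subset_trans h (finset.subsetIr _ _)) in wu.
have lu : (#|w :&: u| < #|u|)%N.
  rewrite proper_card// properE finset.subsetIr; apply/negP => h.
  by rewrite (fintype.subset_trans h (finset.subsetIl _ _)) in uw.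
have half : 2 * epse #|w :&: u|.+1 < epse #|w :&: u|.
  by apply: epse_half; rewrite -ltnS (leq_trans lw).
have := epse_le lw (wn _); have := epse_le lu (wn _); have := epse_ge0 (wn (w :|: u)).
have := x0 (w :&: u); have := x0 (w :|: u); lra.
Qed.

Lemma lsum_dset_rec s x i :
  lsum (dset s (s i).+1) x = x 0 i + lsum (dset s (s i)) x.
Proof.
rewrite /lsum (bigD1 i) ?inE//=; congr (_ + _); apply: eq_bigl => j.
rewrite !inE ltnS leq_eqVlt andb_orl; have [->|ji] := eqVneq j i.
  by rewrite andbF ltnn.
by rewrite !andbT val_eqE (inj_eq perm_inj) (negPf ji).
Qed.

Lemma downset (s : 'S_n.+1) (w : {set I}) : (forall i j, i \in w -> j \notin w -> (s i < s j)%N) ->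
  w = dset s #|w|.
Proof.
move=> ws; have wn : (#|w| <= n.+1)%N by rewrite -[X in (_ <= X)%N]card_ord max_card.
apply/esym/eqP; rewrite eqEcard card_down// leqnn andbT; apply/fintype.subsetP => k.
rewrite inE => kw; apply/negP => /negP nkw.
suff : (#|w| <= s k)%N by rewrite leqNgt kw.
rewrite -[X in (_ <= X)%N](card_down s (ltnW (ltn_ord (s k)))); apply: subset_leq_card.
by apply/fintype.subsetP => i iw; rewrite inE ws.
Qed.

(** The tight sets form a chain, so sorting the indices by the number of tight sets that contain
    them, largest first, makes every tight set an initial segment. *)
Lemma tight_flag x : Hrep x -> exists s, forall w, slack w x = 0 -> w = dset s #|w|.
Proof.
move=> Hx; pose f i := #|[set u : {set I} | (slack u x == 0) && (i \in u)]%SET|.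
have [s sP] := exists_sorting_perm f; exists s => w w0; apply: downset => i j iw jw.
apply: sP; apply: proper_card; rewrite properE; apply/andP; split.
  apply/fintype.subsetP => u; rewrite !inE => /andP[/eqP u0 ju]; rewrite u0 eqxx/=.
  have /orP[/fintype.subsetP|/fintype.subsetP/(_ j ju)] := tight_chain Hx w0 u0; first exact.
  by rewrite (negPf jw).
apply/fintype.subsetPn; exists w; first by rewrite inE w0 eqxx.
by rewrite inE negb_and jw orbT.
Qed.

Local Notation Pi := (@permutahedron R n eps).

Lemma Pi_sub_Hrep : Pi `<=` Hrep.
Proof.
apply: smallest_sub; first by apply/convex_set_convexe; exact: Hrep_convex.
by move=> _ [s _ <-]; exact: vert_Hrep.
Qed.

Lemma Pi_vert s : Pi (vert s).
Proof. by apply: sub_gen_smallest; exists s. Qed.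

Lemma Pi_convex : convexe Pi.
Proof.
move=> x y t Px Py t0 t1 A [/convex_set_convexe cA vA].
by apply: (cA x y t (Px A _) (Py A _) t0 t1); split=> //; exact/convex_set_convexe.
Qed.

Definition dir (i j : I) : V := delta_mx 0 i - delta_mx 0 j.

Lemma slack_dir w x i j b :
  slack w (x + b *: dir i j) = slack w x - b * ((i \in w)%:R - (j \in w)%:R).
Proof.
have ind (k : I) : \sum_(l in w) (delta_mx 0 k : V) 0 l = (k \in w)%:R.
  rewrite big_mkcond (bigD1 k)//= big1 ?addr0; last first.
    by move=> l /negPf lk; case: ifP => //; rewrite mxE lk andbF.
  by case: ifP => //; rewrite mxE !eqxx.
rewrite /slack; have -> : lsum w (x + b *: dir i j) = lsum w x + b * ((i \in w)%:R - (j \in w)%:R).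
  rewrite -!ind -sumrB mulr_sumr /lsum -big_split/=.
  by apply: eq_bigr => l _; rewrite !mxE.
by ring.
Qed.

Definition nontight (x : V) : {set {set I}} := [set w : {set I} | slack w x != 0%R]%SET.

Lemma slack_move x i j : i != j -> Hrep x ->
  (forall w, slack w x = 0 -> (i \in w) = (j \in w)) ->
  exists b, [/\ 0 < b, Hrep (x + b *: dir i j) &
    (#|nontight (x + b *: dir i j)| < #|nontight x|)%N].
Proof.
move=> ij Hx sep; pose P (w : {set I}) := (i \in w) && (j \notin w).
have P0 : P [set i]%SET by rewrite /P !inE eqxx/= eq_sym.
case: (@arg_minP _ R _ [set i]%SET P (fun w => slack w x) P0) => w Pw wmin.
have [iw jw] := andP Pw; set b := slack w x.
have [x1 x0] := Hx; have b0 : 0 < b.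
  rewrite lt_neqAle x0 andbT eq_sym; apply/eqP => bx.
  by have := sep w bx; rewrite iw (negPf jw).
have y0 u : 0 <= slack u (x + b *: dir i j).
  rewrite slack_dir; have := x0 u; have := wmin u; rewrite /P.
  by case: (i \in u); case: (j \in u) => //=; try move=> /(_ isT); rewrite -/b; lra.
exists b; split=> //.
  split=> //; have h : slack finset.setT (x + b *: dir i j) = slack finset.setT x.
    by rewrite slack_dir !inE subrr mulr0 subr0.
  by rewrite -x1; move: h; rewrite /slack => /(addrI _)/oppr_inj.
apply: proper_card; rewrite properE; apply/andP; split.
  apply/fintype.subsetP => u; rewrite !inE; apply: contraNneq => u0.
  by rewrite slack_dir u0 (sep _ u0) subrr mulr0 subr0.
apply/fintype.subsetPn; exists w; rewrite !inE; first by rewrite gt_eqF.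
by rewrite slack_dir iw (negPf jw) subr0 mulr1 subrr eqxx.
Qed.

(** Induction on the number of sets that are not tight. If the tight sets fail to separate two
    indices, x lies between two points with fewer such sets; otherwise they form a complete flag,
    and x is its vertex. *)
Lemma Hrep_sub_Pi : Hrep `<=` Pi.
Proof.
move=> x; have [k] := ubnP #|nontight x|.
elim: k x => // k IH x; rewrite ltnS => xk Hx.
have [[i [j [ij sep]]]|nsep] := pselect (exists i j, i != j /\
    forall w, slack w x = 0 -> (i \in w) = (j \in w)).
  have [b [b0 Hb xb]] := slack_move ij Hx sep.
  have [|c [c0 Hc xc]] := slack_move (_ : j != i) Hx (fun w w0 => esym (sep w w0)).
    by rewrite eq_sym.
  have Pb := IH _ (leq_trans xb xk) Hb; have Pc := IH _ (leq_trans xc xk) Hc.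
  have bc : 0 < b + c by rewrite addr_gt0.
  have t0 : 0 <= c / (b + c) by rewrite divr_ge0 ?ltW.
  have t1 : c / (b + c) <= 1 by rewrite ler_pdivrMr// mul1r lerDr ltW.
  have := Pi_convex Pc Pb t0 t1.
  congr (Pi _); apply/rowP => l; rewrite !mxE.
  by field; rewrite gt_eqF.
have {}nsep i j : i != j -> exists2 w, slack w x = 0 & (i \in w) != (j \in w).
  move=> ij; apply: contrapT => h; apply: nsep; exists i, j; split=> // w w0.
  by apply/eqP; apply: contrapT => /negP h'; apply: h; exists w.
have [s sP] := tight_flag Hx; have [x1 x0] := Hx.
have tight m : (m <= n.+1)%N -> slack (dset s m) x = 0.
  case: m => [_|m].
    by rewrite (_ : dset s 0 = finset.set0) ?slack_set0//; apply/setP => i; rewrite !inE.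
  rewrite leq_eqVlt => /predU1P[[->]|mn]; first by rewrite dset_setT slack_setT.
  pose a : I := (s^-1)%g (Ordinal (ltnW mn)); pose c : I := (s^-1)%g (Ordinal mn).
  have [|w w0] := nsep a c.
    by rewrite (inj_eq perm_inj) -val_eqE/= neq_ltn ltnSn.
  rewrite (sP _ w0) !inE !permKV/= => h; rewrite (_ : m.+1 = #|w|) -?sP//.
  by apply/eqP; move: h; move: #|w| => q; lia.
suff -> : x = vert s by exact: Pi_vert.
apply/rowP => i; rewrite vertE; have si := ltn_ord (s i).
have := lsum_dset_rec s x i; have := tight _ si; have := tight _ (ltnW si).
by rewrite /slack !card_down ?(ltnW si)//; lra.
Qed.

Lemma PiE : Pi = Hrep.
Proof. by apply/seteqP; split; [exact: Pi_sub_Hrep|exact: Hrep_sub_Pi]. Qed.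

End Permutahedron.

Lemma perm_le_id k (p : 'S_k) : (forall i, (p i <= i)%N) -> p = 1%g.
Proof.
move=> pi; suff H i : p i = i by apply/permP => i; rewrite perm1.
have [q] := ubnP (i : nat); elim: q i => // q IH i; rewrite ltnS => iq.
apply: val_inj; move: (pi i); rewrite leq_eqVlt => /predU1P[//|pii].
by move: (IH (p i) (leq_trans pii iq)) => /perm_inj e; rewrite e ltnn in pii.
Qed.

(** * The barycentric subdivision of the permutahedron and Sperner labels *)

Section FlagChain.
Variables (R : realType) (m : nat).
Local Notation n := m.+1.
Local Notation chain := (chain R).
Local Notation W := (omega n).

Lemma down_omega (s : 'S_n.+1) (k : 'I_n) :
  (dset s k.+1 != finset.set0) && (dset s k.+1 \proper finset.setT).
Proof.
have kn : (k.+1 <= n.+1)%N by rewrite ltnS ltnW.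
rewrite -card_gt0 properEcard finset.subsetT cardsT card_ord card_down//=.
by rewrite ltnS.
Qed.

Definition fl (s : 'S_n.+1) (k : 'I_n) : W := exist _ (dset s k.+1) (down_omega s k).

(** The polytope is simple: a vertex s and an order t of its facets make a complete flag of faces,
    and the first i facets are those through its face of codimension i. *)
Definition flags (s : 'S_n.+1) (t : 'S_n) (i : nat) : {set W} :=
  [set fl s (t k) | k : 'I_n & (k < i)%N]%SET.

Definition is_flag (G : {set W}) := exists s, forall w, w \in G -> exists k, w = fl s k.

Lemma flags_is_flag s t i : is_flag (flags s t i).
Proof. by exists s => w /imsetP[k _ ->]; exists (t k). Qed.

Lemma flags_fl (s : 'S_n.+1) (t : 'S_n) (i : nat) (k : 'I_n) : (k < i)%N -> fl s (t k) \in flags s t i.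
Proof. by move=> ki; apply/imsetP; exists k; rewrite ?inE. Qed.

Section Def.
Variable d : nat.
Local Notation V := 'rV[R]_d.
Implicit Type b : {set W} -> V.

Definition flag_mx b (x : 'S_n.+1 * 'S_n) : 'M[R]_(n.+1, d) :=
  \matrix_(i, j) b (flags x.1 x.2 i) 0 j.

Lemma row_flag_mx b x i : row i (flag_mx b x) = b (flags x.1 x.2 i).
Proof. by apply/rowP => j; rewrite !mxE. Qed.

Definition flag_sg (x : 'S_n.+1 * 'S_n) : bool := odd_perm x.1 (+) odd_perm x.2.

(** The barycentric subdivision of the permutahedron, with [b G] put for the barycentre of the face
    where the facets of G meet. Row 0, with G empty, is the centre. *)
Definition flagchain b : chain n V :=
  \sum_x (-1) ^+ flag_sg x *: << aff (flag_mx b x) >>.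

Lemma flags_swap (s : 'S_n.+1) (t : 'S_n) (l l' : 'I_n) (i : nat) : l' = l.+1 :> nat -> i != l' ->
  flags s (tperm l l' * t)%g i = flags s t i.
Proof.
move=> ll' il; have ne : l != l' by rewrite -val_eqE /= ll' neq_ltn ltnSn.
have kt k : (tperm l l' k < i)%N = (k < i)%N.
  by case: tpermP => [->|->|//]; move: il; rewrite ll' => il; lia.
apply/setP => w; apply/imsetP/imsetP => -[k]; rewrite inE => ki ->.
  by exists (tperm l l' k); rewrite ?inE ?kt// permM.
by exists (tperm l l' k); rewrite ?inE ?kt// permM tpermK.
Qed.

Lemma fl_swap (s : 'S_n.+1) (l l' : 'I_n.+1) (k : 'I_n) : l' = l.+1 :> nat -> k != l :> nat ->
  fl (s * tperm l l')%g k = fl s k.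
Proof.
move=> ll' kl; apply: val_inj; apply/setP => i; rewrite !inE permM.
by case: tpermP => [->|->|//]; rewrite ll'; lia.
Qed.

(** Without the face of codimension l + 1 a flag does not see the order of two consecutive facets;
    without the vertex it does not see which end of the edge is meant. In either case a
    transposition, in t or in s, reverses the sign. *)
Lemma flag_face_cancel b (l : 'I_n) :
  \sum_x (-1) ^+ flag_sg x *: << aff (row' (fintype.lift ord0 l) (flag_mx b x)) >> = 0 :> chain m V.
Proof.
have row_ext (v v' : 'M[R]_(n.+1, d)) : (forall i, i != fintype.lift ord0 l -> row i v = row i v') ->
    row' (fintype.lift ord0 l) v = row' (fintype.lift ord0 l) v'.
  move=> e; apply/row_matrixP => i; rewrite !rowEsub -!mxsub_comp.
  by have := e (fintype.lift (fintype.lift ord0 l) i); rewrite eq_sym neq_lift !rowEsub => /(_ isT).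
have [lm|ml] := ltnP l m.
  pose l' : 'I_n := Ordinal (lm : l.+1 < n)%N.
  pose u (x : 'S_n.+1 * 'S_n) := (x.1, (tperm l l' * x.2)%g).
  have usg x : flag_sg (u x) = ~~ flag_sg x.
    rewrite /flag_sg /= odd_permM odd_tperm -val_eqE/= neq_ltn ltnSn/=.
    by rewrite addbN.
  apply: (@sum_signed_invol _ _ u flag_sg) => [[s t]|//|x].
    by rewrite /u/= mulgA tperm2 mul1g.
  rewrite usg signrN scaleNr; congr (- (_ *: << aff _ >>)).
  apply: row_ext => i il; rewrite !row_flag_mx flags_swap//.
pose u (x : 'S_n.+1 * 'S_n) :=
  ((x.1 * tperm (widen_ord (leqnSn _) (x.2 l)) (fintype.lift ord0 (x.2 l)))%g, x.2).
have usg x : flag_sg (u x) = ~~ flag_sg x.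
  rewrite /flag_sg /= odd_permM odd_tperm -val_eqE/= neq_ltn ltnSn/=.
  by case: (odd_perm _); case: (odd_perm _).
apply: (@sum_signed_invol _ _ u flag_sg) => [[s t]|//|x].
  by rewrite /u/= -mulgA tperm2 mulg1.
rewrite usg signrN scaleNr; congr (- (_ *: << aff _ >>)).
apply: row_ext => i il; rewrite !row_flag_mx; congr b.
have lm : l = m :> nat by apply/eqP; rewrite eqn_leq ml -ltnS ltn_ord.
have im : (i <= m)%N.
  rewrite -ltnS ltn_neqAle -ltnS ltn_ord andbT; move: il; rewrite -val_eqE/= /bump/=.
  by rewrite lm.
apply: eq_in_imset => k; rewrite inE => ki; apply: fl_swap => //=.
by apply/eqP => /val_inj/perm_inj kl; move: ki; rewrite kl lm ltnNge im.
Qed.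

Lemma boundary_flagchain b : boundary (flagchain b) =
  \sum_x (-1) ^+ flag_sg x *: << aff (row' ord0 (flag_mx b x)) >>.
Proof.
rewrite /flagchain linear_sum/=.
under eq_bigr => x _ do rewrite (@boundaryZ R V n) (@boundary_aff R d m) scalerDr.
rewrite big_split/= [X in _ + X](_ : _ = 0) ?addr0//.
under eq_bigr => x _ do rewrite scaler_sumr.
rewrite exchange_big big1// => l _.
under eq_bigr => x _ do rewrite scalerA mulrC -scalerA.
by rewrite -scaler_sumr flag_face_cancel scaler0.
Qed.

Lemma flagchain_in b (A : set V) : convexe A -> (forall G, is_flag G -> A (b G)) ->
  chain_in A (flagchain b).
Proof.
move=> cA Ab; apply: csupp_sum => x _; apply: csuppZ; apply: csuppU.
by apply: aff_in => // i; rewrite row_flag_mx; apply: Ab; exact: flags_is_flag.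
Qed.

Lemma flag_face_in b (A : W -> set V) x : (forall w, convexe (A w)) ->
  (forall G w, is_flag G -> w \in G -> A w (b G)) ->
  range (aff (row' ord0 (flag_mx b x))) `<=` A (fl x.1 (x.2 ord0)).
Proof.
move=> cA Ab; apply: aff_in => // i; rewrite rowEsub -mxsub_comp.
have := row_flag_mx b x (fintype.lift ord0 i); rewrite rowEsub => ->.
by apply: Ab; [exact: flags_is_flag|exact: flags_fl].
Qed.

End Def.

Lemma push_aff d e (f : {linear 'rV[R]_d -> 'rV[R]_e}) k (v : 'M[R]_(k.+1, d)) (v' : 'M[R]_(k.+1, e)) :
  (forall i, row i v' = f (row i v)) -> push f << aff v >> = << aff v' >>.
Proof.
move=> fv; apply: pushU => x; rewrite /= !affE linear_sum; apply: eq_bigr => i _.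
by rewrite fv linearZ.
Qed.

(** Both chains are images of one flag chain in the product of the two vector spaces, by h after the
    first projection and by the second projection. The straight-line homotopy between these maps
    preserves the convex sets [Uw w]. *)
Lemma flag_homotopy d e (b : {set W} -> 'rV[R]_d) (b1 : {set W} -> 'rV[R]_e)
    (h : 'rV[R]_d -> 'rV[R]_e) (A : set 'rV[R]_d) (Aw : W -> set 'rV[R]_d)
    (U : set 'rV[R]_e) (Uw : W -> set 'rV[R]_e) :
  continuous h -> convexe A -> (forall w, convexe (Aw w)) ->
  convexe U -> (forall w, convexe (Uw w)) ->
  (forall G, is_flag G -> A (b G) /\ U (b1 G)) ->
  (forall G w, is_flag G -> w \in G -> Aw w (b G) /\ Uw w (b1 G)) ->
  (forall x, A x -> U (h x)) -> (forall w x, Aw w x -> Uw w (h x)) ->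
  relb U (@small R _ _ Uw n) (flagchain b1 - push h (flagchain b)).
Proof.
move=> hc cA cAw cU cUw bA bAw hA hAw.
pose B (G : {set W}) : 'rV[R]_(d + e) := row_mx (b G) (b1 G).
have lc : continuous (lsubmx : 'rV[R]_(d + e) -> 'rV[R]_d).
  move=> x; apply: continuous_at_rV => j; rewrite /prop_for/continuous_at.
  by under eq_cvg do rewrite mxE; rewrite mxE; exact: coord_continuous.
have rc : continuous (rsubmx : 'rV[R]_(d + e) -> 'rV[R]_e).
  move=> x; apply: continuous_at_rV => j; rewrite /prop_for/continuous_at.
  by under eq_cvg do rewrite mxE; rewrite mxE; exact: coord_continuous.
pose f0 := h \o (lsubmx : 'rV[R]_(d + e) -> 'rV[R]_d).
have f0c : continuous f0 by move=> x; apply: continuous_comp; [exact: lc|exact: hc].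
pose f1 := (rsubmx : 'rV[R]_(d + e) -> 'rV[R]_e).
pose cl (D : set 'rV[R]_d) (E : set 'rV[R]_e) : set 'rV[R]_(d + e) :=
  [set x | D (lsubmx x) /\ E (rsubmx x)].
have ccl D E : convexe D -> convexe E -> convexe (cl D E).
  move=> cD cE x y t [Dx Ex] [Dy Ey] t0 t1.
  by split; rewrite linearD linearZ linearB/=; [exact: cD|exact: cE].
have pl : push (lsubmx : 'rV[R]_(d + e) -> 'rV[R]_d) (flagchain B) = flagchain b.
  rewrite /flagchain linear_sum; apply: eq_bigr => x _; rewrite linearZ/=.
  by congr (_ *: _); apply: push_aff => i; rewrite !row_flag_mx -[RHS]/(lsubmx (row_mx _ _)) row_mxKl.
have pr : push f1 (flagchain B) = flagchain b1.
  rewrite /flagchain linear_sum; apply: eq_bigr => x _; rewrite linearZ/=.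
  by congr (_ *: _); apply: push_aff => i; rewrite !row_flag_mx -[RHS]/(rsubmx (row_mx _ _)) row_mxKr.
have p0 : push f0 (flagchain B) = push h (flagchain b).
  rewrite -pl; apply/esym; apply: (@push_comp _ _ _ _ _ _ setT setT) => //.
  - exact: cont_within.
  - exact: cont_within.
exists (lineP f0 f1 (flagchain B)).
  apply: chain_in_lineP => //; apply: (@chain_in_sub _ _ _ (cl A U)).
    by move=> x [Ax Ux]; split=> //; exact: hA.
  apply: flagchain_in; first exact: ccl.
  by move=> G /bA; rewrite /cl/= row_mxKl row_mxKr.
rewrite boundary_lineP// pr p0 opprB addrC subrK boundary_flagchain linear_sum.
apply: csupp_sum => x _; rewrite linearZ/=; apply: csuppZ.
suff : chain_in (Uw (fl x.1 (x.2 ord0))) (lineP f0 f1 << aff (row' ord0 (flag_mx B x)) >>).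
  by apply: csupp_sub => s sw; exists (fl x.1 (x.2 ord0)).
apply: chain_in_lineP => //; apply: (@chain_in_sub _ _ _ (cl (Aw (fl x.1 (x.2 ord0))) (Uw (fl x.1 (x.2 ord0))))).
  by move=> y [Ay Uy]; split=> //; exact: hAw.
apply: csuppU; apply: (@flag_face_in _ B (fun w => cl (Aw w) (Uw w))) => [w|G w fG wG].
  exact: ccl.
by have := bAw G w fG wG; rewrite /cl/= row_mxKl row_mxKr.
Qed.

Definition core (G : {set W}) : {set 'I_n.+1} := \bigcap_(w in G) val w.

(** A Sperner labelling: for a flag G, the label lies in every w of G. Taking the least element
    makes the fully labelled simplex unique. *)
Definition least (G : {set W}) : 'I_n.+1 :=
  odflt ord0 [pick i in core G | [forall (j | j \in core G), i <= j]%N].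

Lemma leastP (G : {set W}) i : i \in core G -> least G \in core G /\ (least G <= i)%N.
Proof.
move=> iG; rewrite /least; case: pickP => [j /andP[jG /forall_inP jmin]|h] /=.
  by split=> //; exact: jmin.
have := h [arg min_(j < i in core G) j]%N; case: arg_minnP => // j jG jmin.
by rewrite jG/= => /negP[]; apply/forall_inP => l; exact: jmin.
Qed.

Lemma core_flags (s : 'S_n.+1) (t : 'S_n) i (a : 'I_n.+1) :
  (a \in core (flags s t i)) <-> (forall k : 'I_n, (k < i)%N -> (s a <= t k)%N).
Proof.
split=> [/bigcapP h k ki|h]; first by have := h _ (flags_fl s t ki); rewrite inE.
by apply/bigcapP => w /imsetP[k]; rewrite inE => ki ->; rewrite inE ltnS h.
Qed.

Lemma core_flags0 (s : 'S_n.+1) (t : 'S_n) i : (s^-1)%g ord0 \in core (flags s t i).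
Proof. by apply/core_flags => k _; rewrite permKV. Qed.

Lemma incr_perm_id k (p : 'S_k) :
  (forall i j : 'I_k, (i < j)%N -> (p i < p j)%N) -> p = 1%g.
Proof.
move=> pm; suff le (i : 'I_k) : (i <= p i)%N.
  by apply: invg_inj; rewrite invg1; apply: perm_le_id => j; rewrite -{2}(permKV p j) le.
have [q] := ubnP (i : nat); elim: q i => // q IH [[|i] ik]; rewrite ltnS => iq //.
exact: leq_ltn_trans (IH (Ordinal (ltnW ik)) iq) (pm (Ordinal (ltnW ik)) (Ordinal ik) _).
Qed.

Definition rev_perm k : 'S_k := perm (@rev_ord_inj k).

Lemma flag_least_inj (s : 'S_n.+1) (t : 'S_n) :
  injective (fun i : 'I_n.+1 => least (flags s t i)) -> s = rev_perm n.+1 /\ t = rev_perm n.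
Proof.
move=> xi; pose x i := least (flags s t i).
have xP i : x i \in core (flags s t i) by case: (leastP (core_flags0 s t i)).
have decr i j a : (i <= j)%N -> a \in core (flags s t j) -> a \in core (flags s t i).
  by move=> ij /core_flags h; apply/core_flags => k ki; apply: h; exact: leq_trans ki ij.
(* Cores shrink along the flag, so labels increase weakly; being distinct they are 0, ..., n in this
   order, which determines s and t. *)
have x1 : perm xi = 1%g.
  apply: incr_perm_id => i j ij; rewrite !permE ltn_neqAle -/(x i) -/(x j).
  have -> : (x i <= x j)%N by case: (leastP (decr _ _ _ (ltnW ij) (xP j))).
  by rewrite andbT val_eqE (inj_eq xi) -val_eqE neq_ltn ij.
have xE (i : 'I_n.+1) : x i = i by rewrite -[RHS](perm1 i) -x1 permE.
have st (k : 'I_n) (l : 'I_n.+1) : (k < l)%N -> (s l <= t k)%N.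
  move=> kl; have := xP l; rewrite xE => /core_flags; exact.
have ts (k : 'I_n) : (t k < s (widen_ord (leqnSn _) k))%N.
  set k' := widen_ord _ k; rewrite ltnNge; apply/negP => sk.
  have : k' \in core (flags s t k.+1).
    apply/core_flags => l; rewrite ltnS leq_eqVlt => /predU1P[/val_inj ->//|lk].
    by have := xP k'; rewrite xE => /core_flags; apply.
  move=> /leastP[_]; rewrite -/(x k.+1).
  by have := xE (fintype.lift ord0 k); rewrite /= /bump/= add1n => -> /=; rewrite ltnn.
have sE : s = rev_perm n.+1.
  have : (s * rev_perm n.+1 = 1)%g.
    apply: incr_perm_id => i j ij; rewrite !permM !permE /=.
    have im : (i < n)%N by rewrite -ltnS (leq_trans _ (ltn_ord j)).
    have := ts (Ordinal im); have := st (Ordinal im) j ij.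
    rewrite (_ : widen_ord _ _ = i); last exact: val_inj.
    by have := ltn_ord (s i); lia.
  move=> e; apply: (mulIg (rev_perm n.+1)); rewrite e; apply/permP => i.
  by rewrite permM !permE rev_ordK.
split=> //; apply/permP => k; rewrite permE; apply: val_inj => /=.
have := ts k; have := st k (fintype.lift ord0 k) _; rewrite sE !permE /= /bump/= => h1 h2.
have := h1 (ltnSn _); move: h2; have := ltn_ord k; move: (t k : nat) (k : nat) => q r; lia.
Qed.

Lemma least_rev (i : 'I_n.+1) : least (flags (rev_perm n.+1) (rev_perm n) i) = i.
Proof.
have core_rev (a : 'I_n.+1) :
    a \in core (flags (rev_perm n.+1) (rev_perm n) i) <-> (i <= a)%N.
  split=> [/core_flags h|ia]; last first.
    by apply/core_flags => k ki; rewrite !permE /=; have := ltn_ord k; lia.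
  rewrite leqNgt; apply/negP => ai; have an : (a < n)%N by rewrite (leq_trans ai)// -ltnS.
  by have := h (Ordinal an) ai; rewrite !permE/=; lia.
have [|/core_rev h1 h2] := @leastP (flags (rev_perm n.+1) (rev_perm n) i) i.
  exact/core_rev.
by apply: val_inj; apply/eqP; rewrite eqn_leq h1 h2.
Qed.

(** Sperner's lemma with signs: a simplex that misses the label j has all its vertices in [A j], and
    only the one of [flag_least_inj] misses no label. *)
Lemma flagchain_least d (u : 'M[R]_(n.+1, d)) (A : 'I_n.+1 -> set 'rV[R]_d) :
  (forall j, convexe (A j)) -> (forall l j, l != j -> A j (row l u)) ->
  csupp (@small R _ _ A n) (flagchain (fun G => row (least G) u) -
    (-1) ^+ flag_sg (rev_perm n.+1, rev_perm n) *: << aff u >>).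
Proof.
move=> cA uA; rewrite /flagchain (bigD1 (rev_perm n.+1, rev_perm n))//=.
rewrite (_ : flag_mx _ _ = u); last first.
  by apply/row_matrixP => i; rewrite row_flag_mx /= least_rev.
rewrite [X in X - _]addrC addrK; apply: csupp_sum => -[s t] st; apply: csuppZ.
apply: csuppU.
have /existsP[j /forallP jx] : [exists j, [forall i : 'I_n.+1, least (flags s t i) != j]].
  apply: contraT => /existsPn h; move: st.
  suff /flag_least_inj[-> ->] : injective (fun i : 'I_n.+1 => least (flags s t i)).
    by rewrite eqxx.
  have /fin_all_exists[g gK] j : exists i : 'I_n.+1, least (flags s t i) = j.
    by have /forallPn[i] := h j; rewrite negbK => /eqP; exists i.
  have gi : injective g by move=> a b ab; rewrite -[a]gK ab gK.
  have [g' _ gg'] := injF_bij gi.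
  have E (i : 'I_n.+1) : least (flags s t i) = g' i by rewrite -{1}(gg' i) gK.
  by move=> i i'; rewrite !E => /(can_inj gg').
exists j; apply: aff_in => // i; rewrite row_flag_mx /=.
exact: uA.
Qed.

End FlagChain.

Lemma hausdorff_separated (R : realType) (Y : topologicalType) :
  (forall x y : Y, x <> y -> exists2 f : Y -> R, continuous f & f x <> f y) ->
  hausdorff_space Y.
Proof.
move=> sep x y xy; apply: contrapT => /sep[f fc fxy]; apply: fxy.
apply: (@Rhausdorff R) => A B Ax By.
have [z [Az Bz]] := xy (f @^-1` A) (f @^-1` B) (fc x _ Ax) (fc y _ By).
by exists (f z).
Qed.

Lemma cvg_prod (R : realType) (X I : Type) (F : set_system X) {FF : Filter F}
    (r : seq I) (P : pred I) (f : I -> X -> R) (l : I -> R) :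
  (forall i, f i x @[x --> F] --> l i) ->
  \prod_(i <- r | P i) f i x @[x --> F] --> \prod_(i <- r | P i) l i.
Proof.
move=> fl; elim: r => [|i r IH].
  by rewrite big_nil; under eq_cvg do rewrite big_nil; exact: cvg_cst.
rewrite big_cons; under eq_cvg do rewrite big_cons.
by case: (P i) => //; exact: cvgM (fl i) IH.
Qed.

(** * Spaces glued from permutahedra *)

Section Gluing.
Variables (R : realType) (m : nat) (eps : nat -> R).
Local Notation n := m.+1.
Hypothesis hp : permutahedron_parameters n eps.
Local Notation V := 'rV[R]_n.+1.
Local Notation W := (omega n).
Local Notation Pi := (@permutahedron R n eps).
Local Notation slack := (@slack R n eps).

Definition fac (x : V) : {set W} := [set w : W | slack (val w) x == 0%R]%SET.

Lemma slack_ge0 x (w : {set 'I_n.+1}) : Pi x -> 0 <= slack w x.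
Proof. by rewrite (PiE hp) => -[]. Qed.

Section Action.
Variables (C : finType) (act : W -> C -> C) (bit : C -> 'I_n -> bool).

Definition cell_action := [/\ forall w, involutive (act w),
  forall w w' c, omega_sub w w' -> act w (act w' c) = act w' (act w c) &
  forall w c (k : 'I_n), bit (act w c) k = (k.+1 == #|val w|) (+) bit c k].

Definition step (T : {set W}) : rel C := fun c c' => [exists w in T, c' == act w c].

Definition conn (T : {set W}) (c c' : C) : bool := connect (step T) c c'.

(** The quotient is given by its universal property and not by a construction, so that the Tomei
    manifold, a quotient in two steps, and the spaces with other cells fall under the same
    lemmas. *)
Definition gluing (Y : topologicalType) (q : C -> V -> Y) :=
  [/\ forall c, {within Pi, continuous (q c)},
      forall y, exists p : C * V, Pi p.2 /\ y = q p.1 p.2,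
      forall c c' x x', Pi x -> Pi x' ->
        (q c x = q c' x' <-> x = x' /\ conn (fac x) c c') &
      forall (Z : topologicalType) (f : Y -> Z),
        (forall c, {within Pi, continuous (f \o q c)}) -> continuous f].

Hypothesis hact : cell_action.
Let actK w : involutive (act w). Proof. by case: hact. Qed.

Lemma conn_sym T : symmetric (conn T).
Proof.
have sub c c' : step T c c' -> step T c' c.
  by move=> /exists_inP[w wT /eqP ->]; apply/exists_inP; exists w; rewrite ?actK.
by apply: sym_connect_sym => c c'; apply/idP/idP; exact: sub.
Qed.

Lemma conn_act (T : {set W}) w c c' : w \in T -> conn T c (act w c') = conn T c c'.
Proof.
move=> wT; have h : conn T c' (act w c').
  by apply: connect1; apply/exists_inP; exists w.
by apply/idP/idP => h'; [rewrite conn_sym in h|]; exact: connect_trans h' h.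
Qed.

Lemma conn_sub (T T' : {set W}) c c' : T \subset T' -> conn T c c' -> conn T' c c'.
Proof.
move=> TT'; apply: connect_sub => d d' /exists_inP[w wT e]; apply: connect1.
by apply/exists_inP; exists w => //; exact: (fintype.subsetP TT').
Qed.

Lemma conn_set0 c c' : conn finset.set0 c c' = (c == c').
Proof.
apply/idP/eqP => [/connectP[p]|->]; last exact: connect0.
by case: p => [_ -> //|d p /= /andP[/exists_inP[w]]]; rewrite inE.
Qed.

Lemma conn_invariant (S : Type) (T : {set W}) (h : C -> S) c c' :
  (forall w c, w \in T -> h (act w c) = h c) -> conn T c c' -> h c' = h c.
Proof.
move=> hT /connectP[p]; elim: p c => [c _ -> //|d p IH c /= /andP[/exists_inP[w wT /eqP dc] /IH e] /e ->].
by rewrite dc hT.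
Qed.

Section Flag.
Variable s : 'S_n.+1.

Definition flagset : {set W} := [set fl s k | k : 'I_n]%SET.

Lemma fl_flagset k : fl s k \in flagset. Proof. by apply/imsetP; exists k. Qed.

Lemma flag_comm k l c : act (fl s k) (act (fl s l) c) = act (fl s l) (act (fl s k) c).
Proof.
have [_ hc _] := hact.
have sub (a b : 'I_n) : (a <= b)%N -> omega_sub (fl s a) (fl s b).
  by move=> ab; apply/fintype.subsetP => i; rewrite !inE => /leq_trans; apply.
by case: (leqP k l) => [/sub/hc -> //|/ltnW/sub/hc ->].
Qed.

Lemma bit_fl k l c : bit (act (fl s k) c) l = (l == k) (+) bit c l.
Proof.
by have [_ _ ->] := hact; rewrite /= card_down ?eqSS// ltnS ltnW.
Qed.

Fixpoint mvi (e : 'I_n -> bool) j (c : C) : C :=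
  if j is i.+1 then
    if e (inord i) then act (fl s (inord i)) (mvi e i c) else mvi e i c
  else c.

Definition mv (e : 'I_n -> bool) := mvi e n.

Definition flip (k : 'I_n) (e : 'I_n -> bool) (l : 'I_n) : bool := (l == k) (+) e l.

Lemma mvi_flip k e j c : (j <= n)%N ->
  mvi (flip k e) j c = if (k < j)%N then act (fl s k) (mvi e j c) else mvi e j c.
Proof.
elim: j => //= j IH jn; rewrite IH ?(ltnW jn)// /flip ltnS [(k <= j)%N]leq_eqVlt.
have -> : (inord j == k) = (k == j :> nat) by rewrite -val_eqE/= inordK// eq_sym.
case: eqVneq => [kj|_] /=.
  rewrite kj ltnn; have -> : inord j = k by apply: val_inj; rewrite /= inordK.
  by case: (e k); rewrite //= actK.
by case: (k < j)%N; case: (e _); rewrite //= flag_comm.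
Qed.

Lemma mv_flip k e c : mv (flip k e) c = act (fl s k) (mv e c).
Proof. by rewrite /mv mvi_flip// ltn_ord. Qed.

Lemma eq_mv e e' c : e =1 e' -> mv e c = mv e' c.
Proof. by move=> ee'; rewrite /mv; elim: n => //= j ->; rewrite ee'. Qed.

Lemma mv0 c : mv (fun=> false) c = c.
Proof. by rewrite /mv; have H j : mvi (fun=> false) j c = c by elim: j. Qed.

Lemma bit_mv e c k : bit (mv e c) k = e k (+) bit c k.
Proof.
have H j : (j <= n)%N -> bit (mvi e j c) k = ((k < j)%N && e k) (+) bit c k.
  elim: j => //= j IH jn; rewrite ltnS leq_eqVlt.
  have kj : (k == inord j) = (k == j :> nat) by rewrite -val_eqE/= inordK.
  case: (boolP (e (inord j))) => ej; rewrite ?bit_fl IH ?(ltnW jn)// ?kj.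
    case: eqP => //= kjj; have kE : k = inord j by apply: val_inj; rewrite /= inordK.
    by rewrite {1}kjj ltnn /= kE ej.
  case: eqP => //= kjj; rewrite kjj ltnn /=.
  have -> : k = inord j by apply: val_inj; rewrite /= inordK.
  by rewrite (negPf ej).
by rewrite H// ltn_ord.
Qed.

Lemma conn_mv e c : conn flagset c (mv e c).
Proof.
rewrite /mv; elim: n => [|j IH] /=; first exact: connect0.
by case: (e _) => //; rewrite conn_act// fl_flagset.
Qed.

(** The moves across the facets of one flag commute and change different bits, so a cell reached by
    them is determined by its bits. *)
Lemma connP c c' : conn flagset c c' -> c' = mv (fun k => bit c' k (+) bit c k) c.
Proof.
move=> h; suff [e ->] : exists e, c' = mv e c.
  by apply: eq_mv => k; rewrite bit_mv -addbA addbb addbF.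
move: h => /connectP[p]; elim/last_ind: p c' => [c' _ ->|p d IH c' /=].
  by exists (fun=> false); rewrite mv0.
rewrite rcons_path last_rcons => /andP[pp /exists_inP[w /imsetP[k _ ->] /eqP ->]] ->.
by have [e ->] := IH _ pp erefl; exists (flip k e); rewrite mv_flip.
Qed.

Lemma conn_mv2 (K : {set W}) e e' c : K \subset flagset ->
  (forall k, e k != e' k -> fl s k \in K) -> conn K (mv e c) (mv e' c).
Proof.
move=> KT eK; rewrite /mv; elim: n => [|j IH] /=; first exact: connect0.
have [ee|/eK wK] := eqVneq (e (inord j)) (e' (inord j)).
  rewrite -ee; case: (e _) => //.
  move: IH => /connectP[p]; move: (mvi e j c); elim: p => [d _ ->|d' p IHp d /=].
    exact: connect0.
  move=> /andP[/exists_inP[w wK /eqP dd] pp] lp.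
  apply: connect_trans (IHp d' pp lp); apply: connect1; apply/exists_inP; exists w => //.
  have /imsetP[k _ wk] := fintype.subsetP KT w wK.
  by rewrite dd wk flag_comm.
case: (e _); case: (e' _); rewrite ?conn_act//.
all: by rewrite conn_sym conn_act// conn_sym ?conn_act.
Qed.

End Flag.

Section Space.
Variables (Y : topologicalType) (q : C -> V -> Y).
Hypothesis hq : gluing q.

Let qP y : exists p : C * V, Pi p.2 /\ y = q p.1 p.2. Proof. by case: hq. Qed.

Lemma q_within c : {within Pi, continuous (q c)}. Proof. by case: hq. Qed.

Lemma q_eq c c' x : Pi x -> conn (fac x) c c' -> q c x = q c' x.
Proof. by case: hq => _ _ H _ Px cc; apply/(H _ _ _ _ Px Px). Qed.

Lemma q_inj c c' x x' : Pi x -> Pi x' -> q c x = q c' x' -> x = x' /\ conn (fac x) c c'.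
Proof. by case: hq => _ _ H _ Px Px' /(H _ _ _ _ Px Px'). Qed.

Definition glift (Z : Type) (h : C -> V -> Z) (y : Y) : Z :=
  let p := projT1 (cid (qP y)) in h p.1 p.2.

Definition compat (Z : Type) (h : C -> V -> Z) :=
  forall c w x, Pi x -> w \in fac x -> h (act w c) x = h c x.

Lemma gliftE (Z : Type) (h : C -> V -> Z) c x : compat h -> Pi x -> glift h (q c x) = h c x.
Proof.
move=> hc Px; rewrite /glift; case: cid => -[c' x'] /= [Px' /(q_inj Px Px')[e cc]]; subst x'.
by apply: (conn_invariant (h := h^~ x) _ cc) => w d; exact: hc.
Qed.

Lemma glift_continuous (Z : topologicalType) (h : C -> V -> Z) :
  compat h -> (forall c, {within Pi, continuous (h c)}) -> continuous (glift h).
Proof.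
move=> hc hcont; have [_ _ _ H] := hq; apply: H => c.
apply: (@subspace_eq_continuous _ _ _ (h c)); last exact: hcont.
by move=> x /set_mem Px; rewrite -[RHS]/(glift h (q c x)) gliftE.
Qed.

Definition fold : Y -> V := glift (fun=> id).

Lemma foldE c x : Pi x -> fold (q c x) = x.
Proof. by move=> Px; rewrite /fold gliftE. Qed.

Lemma fold_continuous : continuous fold.
Proof. by apply: glift_continuous => // c; apply: cont_within => x; exact: cvg_id. Qed.

Definition wt (P : pred W) (x : V) : R := \prod_(w : W | P w) slack (val w) x.

Lemma wt_continuous P : continuous (wt P).
Proof.
by move=> x; apply: (@cvg_prod R _ _ (nbhs x) (nbhs_filter x)) => w; exact: slack_continuous.
Qed.

Lemma wt_ge0 P x : Pi x -> 0 <= wt P x.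
Proof. by move=> Px; apply: prodr_ge0 => w _; exact: slack_ge0. Qed.

Lemma wt_neq0 (P : pred W) x : (forall w, P w -> w \notin fac x) -> wt P x != 0.
Proof.
move=> h; apply/prodf_neq0 => w /h; rewrite inE; exact.
Qed.

Lemma wt_eq0 (P : pred W) w x : P w -> w \in fac x -> wt P x = 0.
Proof. by move=> Pw; rewrite inE => /eqP w0; rewrite /wt (bigD1 w)//= w0 mul0r. Qed.

Lemma wt_gt0P (P : pred W) x : Pi x -> (forall w, P w -> w \notin fac x) <-> 0 < wt P x.
Proof.
move=> Px; split=> [h|h w Pw]; first by rewrite lt_neqAle eq_sym wt_ge0// wt_neq0.
by apply/negP => wx; rewrite (wt_eq0 Pw wx) ltxx in h.
Qed.

(** The weight vanishes on the facets outside T, where the indicator of the component of c0 could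
    jump. So the function is continuous, and it is positive exactly on an open star. *)
Definition sheet (T : {set W}) c0 : Y -> R :=
  glift (fun c x => wt (fun w => w \notin T) x * (conn T c0 c)%:R).

Lemma sheet_compat (T : {set W}) c0 :
  compat (fun c x => wt (fun w => w \notin T) x * (conn T c0 c)%:R).
Proof.
move=> c w x Px wx; have [wT|wT] := boolP (w \in T); first by rewrite conn_act.
by rewrite (@wt_eq0 _ w)// !mul0r.
Qed.

Lemma sheetE T c0 c x : Pi x ->
  sheet T c0 (q c x) = wt (fun w => w \notin T) x * (conn T c0 c)%:R.
Proof. by move=> Px; rewrite /sheet gliftE//; exact: sheet_compat. Qed.

Lemma sheet_continuous T c0 : continuous (sheet T c0).
Proof.
apply: glift_continuous; first exact: sheet_compat.
by move=> c; apply: cont_within => x; exact: (cvgMr_tmp (@wt_continuous _ x)).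
Qed.

Lemma sheet_gt0 T c0 c x : Pi x ->
  (0 < sheet T c0 (q c x)) <-> (fac x \subset T /\ conn T c0 c).
Proof.
move=> Px; rewrite sheetE//; have := wt_gt0P (fun w => w \notin T) Px.
case: (conn _ _ _); rewrite ?mulr1 ?mulr0 ?ltxx => h; last by split=> // -[].
split=> [/h h'|[xT _]]; first by split=> //; apply/fintype.subsetP => w; apply: contraTT => /h'.
by apply/h => w; apply: contra => /(fintype.subsetP xT).
Qed.

(** Points over different points of the permutahedron are separated by a coordinate of [fold], two
    points over the same x by a [sheet] of the facets through x. *)
Lemma glued_hausdorff : hausdorff_space Y.
Proof.
apply: (@hausdorff_separated R) => y y' yy'.
have [[c x] /= [Px yE]] := qP y; have [[c' x'] /= [Px' yE']] := qP y'.
have [xx|xx] := eqVneq x x'; last first.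
  have [i xi] : exists i, x 0 i != x' 0 i.
    apply: contrapT => h; case/eqP: xx; apply/rowP => i; apply/eqP/negPn/negP => hi.
    by apply: h; exists i.
  exists (fun y => fold y 0 i).
    move=> z; apply: (@continuous_comp _ _ _ fold (fun v : V => v 0 i) z).
      exact: fold_continuous.
    exact: coord_continuous.
  by rewrite yE yE' !foldE//; exact/eqP.
exists (sheet (fac x) c); first exact: sheet_continuous.
rewrite yE yE' !sheetE// -xx /conn connect0 mulr1.
have -> : connect (step (fac x)) c c' = false.
  by apply/negP => h; apply: yy'; rewrite yE yE' -xx; exact: q_eq.
by rewrite mulr0; apply/eqP/wt_neq0 => w /=.
Qed.

Section Chart.
Variables (s : 'S_n.+1) (c0 : C).
Local Notation T := (flagset s).

(* The points of the open star of the flag [s], with its coordinates: the slacks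
   of the facets of the flag, with signs recording the cell. *)
Definition star : set Y := [set y | 0 < sheet T c0 y].

Lemma star_open : open star.
Proof.
apply: (@open_comp _ _ (sheet T c0) [set z | 0 < z]); last exact: open_gt.
by move=> y _; exact: sheet_continuous.
Qed.

Definition tt (t : 'rV[R]_n) (j : nat) : R :=
  if j is i.+1 then (if insub i is Some k then t 0 k else 0) else 0.

Definition yy (t : 'rV[R]_n) (j : nat) : R := 1 - epse n eps j - tt t j.

(** Inverse to the slacks along the flag: [yy t j] is the sum of the first j coordinates in the
    order s. Entry k of t belongs to j = k + 1; for j = 0 and j = n + 1 the slack [tt t j] is 0. *)
Definition pt (t : 'rV[R]_n) : V := \row_i (yy t (s i).+1 - yy t (s i)).

Lemma yy0 t : yy t 0 = 0. Proof. by rewrite /yy /epse/= subrr subr0. Qed.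

Lemma lsum_pt t j : (j <= n.+1)%N -> lsum (dset s j) (pt t) = yy t j.
Proof.
elim: j => [_|j IH jn].
  rewrite yy0 /lsum big_pred0// => i; by rewrite inE.
have := lsum_dset_rec s (pt t) ((s^-1)%g (Ordinal jn)); rewrite permKV/= => ->.
by rewrite IH ?(ltnW jn)// mxE permKV/= subrK.
Qed.

Lemma slack_pt t k : slack (val (fl s k)) (pt t) = t 0 k.
Proof.
rewrite /(slack _ _) card_down ?lsum_pt//; [|by rewrite ltnS ltnW..].
by rewrite /yy /tt /= insubT ?ltn_ord// => kn; rewrite opprB addrC subrK; congr (t 0 _); exact: val_inj.
Qed.

Lemma lsum_ptT t : lsum finset.setT (pt t) = 1.
Proof.
rewrite -(dset_setT s) lsum_pt// /yy /tt /epse/= insubF ?ltnn//.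
by rewrite eqxx !subr0.
Qed.

Definition slk (x : V) : 'rV[R]_n := \row_k slack (val (fl s k)) x.

Lemma pt_slk x : lsum finset.setT x = 1 -> pt (slk x) = x.
Proof.
move=> x1; have yE j : (j <= n.+1)%N -> yy (slk x) j = lsum (dset s j) x.
  case: j => [_|j]; first by rewrite yy0 /lsum big_pred0// => i; rewrite inE.
  rewrite ltnS leq_eqVlt => /predU1P[->|jn].
    by rewrite dset_setT x1 -(lsum_ptT (slk x)) -(dset_setT s) lsum_pt.
  have e : slack (dset s j.+1) x = 1 - epse n eps j.+1 - lsum (dset s j.+1) x.
    by rewrite /(slack _ _) card_down// ltnS ltnW.
  transitivity (1 - epse n eps j.+1 - slack (dset s j.+1) x); last by rewrite e; ring.
  by rewrite /yy /tt insubT mxE.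
apply/rowP => i; rewrite mxE !yE ?ltn_ord ?(ltnW (ltn_ord _))// lsum_dset_rec.
by rewrite addrK.
Qed.

Lemma pt_continuous : continuous pt.
Proof.
move=> t; apply: continuous_at_rV => i; rewrite /prop_for/continuous_at.
under eq_cvg do rewrite mxE; rewrite mxE.
have yc j : yy u j @[u --> t] --> yy t j.
  apply: (@cvgB _ _ _ (nbhs t) (nbhs_filter t) _ _ _ _ (cvg_cst _)).
  rewrite /tt; case: j => [|j]; first exact: cvg_cst.
  by case: insubP => [k _ _|_]; [exact: coord_continuous|exact: cvg_cst].
exact: (@cvgB _ _ _ (nbhs t) (nbhs_filter t) _ _ _ _ (yc _) (yc _)).
Qed.

Lemma star_Pi (t : 'rV[R]_n) : (forall k, 0 <= t 0 k) ->
  (forall w : W, w \notin T -> 0 < slack (val w) (pt t)) -> Pi (pt t).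
Proof.
move=> t0 tT; rewrite (PiE hp); split=> [|w]; first exact: lsum_ptT.
have [->|w0] := eqVneq w finset.set0; first by rewrite slack_set0.
have [->|w1] := eqVneq w finset.setT; first by rewrite slack_setT// lsum_ptT.
have pw : (w != finset.set0) && (w \proper finset.setT).
  by rewrite w0 properT.
pose w' : W := exist _ w pw; have [/imsetP[k _ wk]|/tT/ltW//] := boolP (w' \in T).
by have := t0 k; rewrite -slack_pt -wk.
Qed.

Lemma flagset_size w k : w \in T -> #|val w| = k.+1 -> exists2 l : 'I_n, w = fl s l & l = k :> nat.
Proof.
move=> /imsetP[l _ ->]; rewrite card_down; last by rewrite ltnS ltnW.
by move=> [lk]; exists l.
Qed.

(** One slack with the sign of bit k would jump at the other facets of the same size, where this bit
    changes too. The product over all of them is a function on Y, and [star_coord] divides it by the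
    slacks off the flag, which do not vanish on the star. *)
Definition level (k : 'I_n) : Y -> R :=
  glift (fun c x => (-1) ^+ bit c k * wt (fun w => #|val w| == k.+1) x).

Lemma level_compat (k : 'I_n) :
  compat (fun c x => (-1) ^+ bit c k * wt (fun w => #|val w| == k.+1) x).
Proof.
move=> c w x Px wx; have [_ _ ->] := hact; have [wk|wk] := eqVneq (k.+1) #|val w|.
  by rewrite (@wt_eq0 _ w) ?mulr0// -wk.
by rewrite addFb.
Qed.

Lemma levelE k c x : Pi x -> level k (q c x) = (-1) ^+ bit c k * wt (fun w => #|val w| == k.+1) x.
Proof. by move=> Px; rewrite /level gliftE//; exact: level_compat. Qed.

Lemma level_continuous k : continuous (level k).
Proof.
apply: glift_continuous; first exact: level_compat.
move=> c; apply: cont_within => x.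
exact: (cvgMl_tmp (@wt_continuous (fun w => #|val w| == k.+1) x)).
Qed.

Definition oth (k : 'I_n) : V -> R := wt (fun w => (#|val w| == k.+1) && (w != fl s k)).

Lemma oth_neq0 k x : fac x \subset T -> oth k x != 0.
Proof.
move=> xT; apply: wt_neq0 => w /andP[/eqP wk wl]; apply/negP => /(fintype.subsetP xT) wT.
have [l wE lk] := flagset_size wT wk; case/eqP: wl; rewrite wE.
by congr fl; exact: val_inj.
Qed.

Lemma wt_size (k : 'I_n) x : wt (fun w => #|val w| == k.+1) x = slack (val (fl s k)) x * oth k x.
Proof.
by rewrite /wt (bigD1 (fl s k))//= card_down// ltnS ltnW.
Qed.

Definition star_coord (y : Y) : 'rV[R]_n :=
  \row_k ((-1) ^+ bit c0 k * level k y / oth k (fold y)).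

Lemma star_coordE c x k : Pi x -> fac x \subset T ->
  star_coord (q c x) 0 k = (-1) ^+ (bit c0 k (+) bit c k) * slack (val (fl s k)) x.
Proof.
move=> Px xT; rewrite mxE levelE// foldE// wt_size signr_addb !mulrA mulfK//.
exact: oth_neq0.
Qed.

Lemma starP c x : Pi x -> star (q c x) <-> (fac x \subset T /\ conn T c0 c).
Proof. exact: sheet_gt0. Qed.

Definition absv (z : 'rV[R]_n) : 'rV[R]_n := \row_k `|z 0 k|.

Definition star_dom : set 'rV[R]_n :=
  [set z | forall w : W, w \notin T -> 0 < slack (val w) (pt (absv z))].

Definition star_inv (z : 'rV[R]_n) : Y := q (mv s (fun k => z 0 k < 0) c0) (pt (absv z)).

Lemma absv_continuous : continuous absv.
Proof.
move=> z; apply: continuous_at_rV => k; rewrite /prop_for/continuous_at.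
under eq_cvg do rewrite mxE; rewrite mxE.
apply: (@continuous_comp _ _ _ (fun z : 'rV[R]_n => z 0 k) (fun r : R => `|r|) z).
  exact: coord_continuous.
exact: norm_continuous.
Qed.

Lemma pt_absv_continuous : continuous (pt \o absv).
Proof.
by move=> z; apply: continuous_comp; [exact: absv_continuous|exact: pt_continuous].
Qed.

Lemma star_dom_open : open star_dom.
Proof.
rewrite openE => z zD; rewrite /interior.
apply: (@filterS _ (nbhs z) _ [set z' | forall w : W, w \notin T -> 0 < slack (val w) (pt (absv z'))]) => //.
apply: (@filter_forall _ _ (fun w z' => w \notin T -> 0 < slack (val w) (pt (absv z'))) (nbhs z) (nbhs_filter z)) => w.
have [wT|wT] := boolP (w \in T); first exact: filterE.
have sc : {for z, continuous (slack (val w) \o (pt \o absv))}.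
  by apply: continuous_comp; [exact: pt_absv_continuous|exact: slack_continuous].
have : nbhs z ((slack (val w) \o (pt \o absv)) @^-1` [set r | 0 < r]).
  by apply: sc; apply: open_nbhs_nbhs; split; [exact: open_gt|exact: zD].
by apply: filterS => z'.
Qed.

Lemma star_dom_Pi z : star_dom z -> Pi (pt (absv z)).
Proof. by move=> zD; apply: star_Pi => // k; rewrite mxE. Qed.

Lemma star_dom_fac z : star_dom z -> fac (pt (absv z)) \subset T.
Proof.
move=> zD; apply/fintype.subsetP => w; rewrite inE; apply: contraTT => /zD h.
by rewrite gt_eqF.
Qed.

Lemma star_inv_in z : star_dom z -> star (star_inv z).
Proof.
move=> zD; apply/starP; first exact: star_dom_Pi.
by split; [exact: star_dom_fac|exact: conn_mv].
Qed.

Lemma star_invK z : star_dom z -> star_coord (star_inv z) = z.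
Proof.
move=> zD; apply/rowP => k; rewrite star_coordE; [|exact: star_dom_Pi|exact: star_dom_fac].
rewrite slack_pt mxE bit_mv addbC -addbA addbb addbF.
exact: mulr_sign_norm.
Qed.

Lemma absv_star_coord c x : Pi x -> fac x \subset T -> absv (star_coord (q c x)) = slk x.
Proof.
move=> Px xT; apply/rowP => k; rewrite mxE star_coordE// normrM normr_sign mul1r mxE.
by rewrite ger0_norm// slack_ge0.
Qed.

Lemma pt_star_coord c x : Pi x -> fac x \subset T -> pt (absv (star_coord (q c x))) = x.
Proof.
move=> Px xT; rewrite absv_star_coord// pt_slk//.
by move: Px; rewrite (PiE hp) => -[].
Qed.

Lemma star_coord_in y : star y -> star_dom (star_coord y).
Proof.
have [[c x] /= [Px ->]] := qP y; move=> /(starP _ Px)[xT _] w wT.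
rewrite pt_star_coord// lt_neqAle eq_sym slack_ge0// andbT.
by apply: contra wT => w0; apply: (fintype.subsetP xT); rewrite inE.
Qed.

Lemma star_coordK y : star y -> star_inv (star_coord y) = y.
Proof.
have [[c x] /= [Px ->]] := qP y; move=> /(starP _ Px)[xT cc].
rewrite /star_inv pt_star_coord//; apply: q_eq => //; rewrite {2}(connP cc).
have aux (b : bool) (r : R) : 0 < r -> ((-1) ^+ b * r < 0) = b.
  by move=> r0; case: b; rewrite ?expr1 ?expr0 ?mul1r ?mulN1r ?oppr_lt0// ltNge (ltW r0).
apply: conn_mv2 => [|k /=]; first exact: xT.
apply: contraNT; rewrite inE => k0; apply/eqP.
rewrite star_coordE// aux; first exact: addbC.
by rewrite lt_neqAle eq_sym k0 slack_ge0.
Qed.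

Lemma star_coord_continuous y : star y -> {for y, continuous star_coord}.
Proof.
have [[c x] /= [Px yE]] := qP y; rewrite yE => /(starP _ Px)[xT _].
apply: continuous_at_rV => k; rewrite /prop_for/continuous_at.
under eq_cvg do rewrite mxE; rewrite mxE.
have h1 := cvgMl_tmp (a := (-1) ^+ bit c0 k) (@level_continuous k (q c x)).
apply: (@cvgM _ _ _ (nbhs_filter (q c x)) _ _ _ _ (h1 (nbhs_filter _))).
apply: (@cvgV _ _ _ (nbhs_filter (q c x))); first by rewrite foldE// oth_neq0.
apply: (@continuous_comp _ _ _ fold (oth k) (q c x)); first exact: fold_continuous.
exact: wt_continuous.
Qed.

Lemma star_inv_continuous z : star_dom z -> {for z, continuous star_inv}.
Proof.
move=> zD N; rewrite /= => Nz.
(* Where [z 0 k] is 0 its sign is ambiguous, but then the point lies on the facet k of the flag: all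
   patterns e compatible with z give the same point of Y, and near z only such patterns occur. *)
pose ok (e : {ffun 'I_n -> bool}) (z' : 'rV[R]_n) := forall k, z' 0 k != 0 -> e k = (z' 0 k < 0).
have D1 : nbhs z star_dom by apply: open_nbhs_nbhs; split=> //; exact: star_dom_open.
have D2 : \forall z' \near z, forall e : {ffun 'I_n -> bool}, ok e z ->
    N (q (mv s e c0) (pt (absv z'))).
  apply: (@filter_forall _ _ (fun (e : {ffun 'I_n -> bool}) z' => ok e z ->
    N (q (mv s e c0) (pt (absv z')))) (nbhs z) (nbhs_filter z)) => e.
  have [ze|nz] := pselect (ok e z); last by apply: filterE => z' /nz.
  have := @q_within (mv s e c0) => /subspace_continuousP/(_ _ (star_dom_Pi zD)) qc.
  have e0 : q (mv s e c0) (pt (absv z)) = star_inv z.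
    apply: q_eq; first exact: star_dom_Pi.
    apply: conn_mv2; first exact: star_dom_fac.
    move=> k; rewrite inE slack_pt mxE normr_eq0; apply: contraNT => zk.
    by rewrite ze// eqxx.
  rewrite -e0 in Nz; have h : nbhs z [set z' | Pi (pt (absv z')) -> N (q (mv s e c0) (pt (absv z')))] :=
    pt_absv_continuous (qc N Nz).
  apply: (@filterS _ (nbhs z) (nbhs_filter z) _ _ _ (filterI D1 h)) => z' [z'D h'] _; apply: h'.
  exact: star_dom_Pi.
have D3 : nbhs z [set z' : 'rV[R]_n | forall k : 'I_n, z 0 k != 0 -> (z 0 k < 0) = (z' 0 k < 0)].
  apply: (@filter_forall _ _ (fun k (z' : 'rV[R]_n) => z 0 k != 0 -> (z 0 k < 0) = (z' 0 k < 0)) (nbhs z) (nbhs_filter z)) => k.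
  have [z0|z0|z0] := ltrgtP (z 0 k) 0; last by apply: filterE => z'; rewrite ?z0 ?eqxx.
    have : nbhs z ((fun z' : 'rV[R]_n => z' 0 k) @^-1` [set r | r < 0]).
      by apply: coord_continuous; apply: open_nbhs_nbhs; split; [exact: open_lt|].
    by apply: filterS => z' /= -> _.
  have : nbhs z ((fun z' : 'rV[R]_n => z' 0 k) @^-1` [set r | 0 < r]).
    by apply: coord_continuous; apply: open_nbhs_nbhs; split; [exact: open_gt|].
  by apply: filterS => z' /= z'0 _; rewrite ltNge ltW.
change (nbhs z [set z' | N (star_inv z')]).
apply: (@filterS _ (nbhs z) (nbhs_filter z) _ _ _ (filterI D2 D3)) => z' [h2 h3] /=.
have -> : star_inv z' = q (mv s [ffun k => z' 0 k < 0] c0) (pt (absv z')).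
  by rewrite /star_inv; congr q; apply: eq_mv => k; rewrite ffunE.
by apply: h2 => k zk; rewrite ffunE h3.
Qed.

Lemma star_homeo : homeomorphism_between star star_dom star_coord star_inv.
Proof.
split; last by split; [exact: star_coordK|exact: star_invK].
split.
- by apply: continuous_at_within; exact: star_coord_continuous.
- by apply: continuous_at_within; exact: star_inv_continuous.
- exact: star_coord_in.
- exact: star_inv_in.
Qed.

End Chart.

Lemma star_cover c x : Pi x -> exists s, star s c (q c x).
Proof.
move=> Px; have Hx : @Hrep R n eps x by rewrite -(PiE hp).
have [s sP] := tight_flag hp Hx; exists s; apply/starP => //; split; last exact: connect0.
apply/fintype.subsetP => w; rewrite inE => /eqP/sP wE; apply/imsetP.
have : (#|val w| < n.+1)%N.
  by have /andP[_ /proper_card] := valP w; rewrite cardsT card_ord.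
have : (0 < #|val w|)%N by rewrite card_gt0; have /andP[] := valP w.
case: #|val w| wE => // k wE _ kn; exists (Ordinal (kn : k < n)%N) => //.
exact: val_inj.
Qed.

Lemma glued_locally_euclidean : locally_euclidean R n Y.
Proof.
move=> y; have [[c x] /= [Px ->]] := qP y; have [s ys] := star_cover c Px.
exists (star s c), (star_dom s), (star_coord s c), (star_inv s c); split.
- by split=> //; exact: star_open.
- exact: star_dom_open.
- exact: star_homeo.
Qed.

End Space.

End Action.

End Gluing.

Lemma lt_line (R : realFieldType) (a x y t : R) :
  a < x -> a < y -> 0 <= t -> t <= 1 -> a < x + t * (y - x).
Proof.
move=> ax ay t0 t1; have -> : x + t * (y - x) = (1 - t) * x + t * y by ring.
have [->|t1'] := eqVneq t 1; first by rewrite subrr mul0r add0r mul1r.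
have h1 : 0 < (1 - t) * (x - a) by rewrite mulr_gt0 ?subr_gt0// lt_neqAle t1'.
have h2 : 0 <= t * (y - a) by rewrite mulr_ge0// subr_ge0 ltW.
by rewrite -subr_gt0 (_ : _ - a = (1 - t) * (x - a) + t * (y - a)); [exact: ltr_wpDr|ring].
Qed.

Lemma gt_line (R : realFieldType) (a x y t : R) :
  x < a -> y < a -> 0 <= t -> t <= 1 -> x + t * (y - x) < a.
Proof.
move=> xa ya t0 t1; rewrite -ltrN2 (_ : - (x + _) = - x + t * (- y - - x)); last by ring.
by apply: lt_line; rewrite ?ltrN2.
Qed.

(** * The cycle formed by the cells *)

Section Cycle.
Variables (R : realType) (m : nat) (eps : nat -> R).
Local Notation n := m.+1.
Hypothesis hp : permutahedron_parameters n eps.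
Local Notation V := 'rV[R]_n.+1.
Local Notation W := (omega n).
Local Notation chain := (chain R).
Local Notation simplex := (singular_simplex R).
Local Notation Pi := (@permutahedron R n eps).
Local Notation slack := (@slack R n eps).
Local Notation fac := (@fac R m eps).

(** Stands for the barycentre of the face of G; the default 0 is taken only when the facets of G do
    not meet. *)
Definition bpt (G : {set W}) : V := xget 0 [set x | Pi x /\ G \subset fac x].

Lemma bptP G : is_flag G -> Pi (bpt G) /\ G \subset fac (bpt G).
Proof.
move=> [s Gs]; rewrite /bpt; case: xgetP => [x -> //|/(_ (permutahedron_vertex eps s))[]].
split; first exact: Pi_vert.
apply/fintype.subsetP => w /Gs[k ->]; rewrite inE /(slack _ _)/= lsum_down//; last first.
  by rewrite ltnS ltnW.
by rewrite card_down ?subrr// ltnS ltnW.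
Qed.

(** A relative fundamental cycle of the permutahedron modulo its boundary, with sign [flag_sign] at
    the centre. *)
Definition zeta : chain n V := flagchain bpt.

Lemma zeta_Pi : chain_in Pi zeta.
Proof. by apply: flagchain_in => [|G /bptP[]//]; exact: Pi_convex. Qed.

Definition Fw (w : W) : set V := [set x | Pi x /\ slack (val w) x = 0].

Lemma Fw_convex w : convexe (Fw w).
Proof.
move=> x y t [Px x0] [Py y0] t0 t1; split; first exact: Pi_convex.
by rewrite slack_line x0 y0 subrr mulr0 addr0.
Qed.

Lemma bpt_Fw G w : is_flag G -> w \in G -> Fw w (bpt G).
Proof.
move=> /bptP[PG /fintype.subsetP Gf] /Gf; rewrite inE => /eqP w0; by split.
Qed.

(* The slack of the barycentre of the permutahedron. *)
Definition gap (w : {set 'I_n.+1}) : R := 1 - epse n eps #|w| - #|w|%:R / n.+1%:R.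

Lemma epse_pow k : (k <= n)%N -> 2 ^+ k.+1 * epse n eps k.+1 < 1.
Proof.
elim: k => [|k IH] kn; rewrite exprSr -mulrA.
  by rewrite expr0 mul1r; have := epse_half hp kn.
apply: lt_trans (IH (ltnW kn)); rewrite ltr_pM2l ?exprn_gt0//; exact: epse_half.
Qed.

(** For 1 <= k <= n, [epse_pow] bounds [epse k] by 2^-k, and 2^-k <= 1 - k/(n+1). *)
Lemma gap_gt0 (w : W) : 0 < gap (val w).
Proof.
have wn : (#|val w| < n.+1)%N.
  by have /andP[_ /proper_card] := valP w; rewrite cardsT card_ord.
have : (0 < #|val w|)%N by rewrite card_gt0; have /andP[] := valP w.
rewrite /gap; case: #|val w| wn => // k kn _.
have pow j : (j <= n)%N -> (n.+1 <= 2 ^ j * (n.+1 - j))%N.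
  elim: j => [|j IH] jn; first by rewrite mul1n subn0.
  apply: leq_trans (IH (ltnW jn)) _; rewrite expnSr -mulnA leq_mul2l; apply/orP; right.
  lia.
have e1 := epse_pow (ltnW kn : k <= n)%N.
have p0 : 0 < (2 : R) ^+ k.+1 by rewrite exprn_gt0.
have e2 : epse n eps k.+1 < (2 ^+ k.+1)^-1 by rewrite -[ltRHS]mul1r ltr_pdivlMr// mulrC.
have e3 : (2 ^+ k.+1)^-1 <= (n.+1 - k.+1)%:R / n.+1%:R :> R.
  rewrite ler_pdivlMr// mulrC ler_pdivrMr// -natrX -natrM ler_nat mulnC.
  exact: pow.
rewrite natrB in e3; last exact: ltnW.
rewrite mulrBl divff in e3; last by rewrite pnatr_eq0.
by move: e2 e3; move: (epse _ _ _) (2 ^- _) (k.+1%:R / _) => a b c; lra.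
Qed.

Lemma exists_kap : exists k : R, 0 < k /\ forall w : W, k * n.+1%:R < gap (val w).
Proof.
pose w0 : W := fl (1%g : 'S_n.+1) ord0.
case: (@arg_minP _ R W w0 xpredT (fun w => gap (val w)) isT) => w _ wmin.
exists (gap (val w) / n.+2%:R); split=> [|w']; first by rewrite divr_gt0// gap_gt0.
apply: lt_le_trans (wmin w' isT); rewrite mulrAC ltr_pdivrMr// ltr_pM2l ?gap_gt0//.
by rewrite ltr_nat.
Qed.

Lemma lam_zero j : lam (0 : 'rV[R]_n) j = 0.
Proof.
by rewrite /lam; case: unliftP => [i|] _; rewrite ?mxE ?big1 ?oppr0// => i _; rewrite mxE.
Qed.

Lemma lam_aff k (v : 'M[R]_(k.+1, n)) x j :
  lam (aff v x) j = \sum_i set_val x 0 i * lam (row i v) j.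
Proof.
have cE l : aff v x 0 l = \sum_i set_val x 0 i * v i l by rewrite mxE.
rewrite /lam; case: unliftP => [l|] _.
  by rewrite cE; apply: eq_bigr => i _; rewrite mxE.
under [in RHS]eq_bigr do rewrite mulrN; rewrite sumrN; congr (- _).
under eq_bigr do rewrite cE; rewrite exchange_big; apply: eq_bigr => i _.
by rewrite mulr_sumr; apply: eq_bigr => l _; rewrite mxE.
Qed.

Section Center.
Variable kap : R.
Hypotheses (kap0 : 0 < kap) (kapP : forall w : W, kap * n.+1%:R < gap (val w)).

(** Affine coordinates on the hyperplane around the barycentre, with kap so small that [Om] goes to
    the interior of the permutahedron. *)
Definition psi (y : 'rV[R]_n) : V := \row_j (n.+1%:R^-1 + kap * lam y j).

Definition theta (x : V) : 'rV[R]_n :=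
  \row_i (kap^-1 * (x 0 (fintype.lift ord0 i) - n.+1%:R^-1)).

Lemma lsum_psi w y : lsum w (psi y) = #|w|%:R / n.+1%:R + kap * \sum_(j in w) lam y j.
Proof.
rewrite /lsum (eq_bigr (fun j => n.+1%:R^-1 + kap * lam y j)) => [|j _]; last by rewrite mxE.
by rewrite big_split/= sumr_const -[X in X + _]mulr_natl mulr_sumr.
Qed.

Lemma lsum_psiT y : lsum finset.setT (psi y) = 1.
Proof.
rewrite lsum_psi cardsT card_ord divff ?pnatr_eq0//.
rewrite (eq_bigl xpredT) ?lam_sum ?mulr0 ?addr0// => j.
by rewrite inE.
Qed.

Lemma psi_slack (w : W) y : Om y -> 0 < slack (val w) (psi y).
Proof.
move=> Oy; rewrite /(slack _ _) lsum_psi.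
have h : \sum_(j in val w) lam y j <= n.+1%:R.
  have := lam_sum y; rewrite (bigID (fun j => j \in val w))/= => /eqP.
  rewrite addr_eq0 => /eqP ->; rewrite -sumrN.
  apply: (@le_trans _ _ (\sum_(j < n.+1 | j \notin val w) 1)).
    by apply: ler_sum => j _; rewrite lerNl ltW.
  rewrite sumr_const ler_nat; apply: leq_trans (max_card _) _.
  by rewrite card_ord.
have := kapP w; have : kap * \sum_(j in val w) lam y j <= kap * n.+1%:R by rewrite ler_pM2l.
by move=> h1 h2; rewrite opprD addrA subr_gt0; exact: le_lt_trans h1 h2.
Qed.

Lemma psi_Pi y : Om y -> Pi (psi y).
Proof.
move=> Oy; rewrite (PiE hp); split=> [|w]; first exact: lsum_psiT.
have [->|w0] := eqVneq w finset.set0; first by rewrite slack_set0.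
have [->|w1] := eqVneq w finset.setT; first by rewrite slack_setT// lsum_psiT.
have pw : (w != finset.set0) && (w \proper finset.setT) by rewrite w0 properT.
exact: ltW (psi_slack (exist _ w pw : W) Oy).
Qed.

Lemma psi_fac y : Om y -> fac (psi y) = finset.set0.
Proof.
move=> Oy; apply/setP => w; rewrite !inE; apply/negbTE.
by rewrite gt_eqF// psi_slack.
Qed.

Lemma psiK y : theta (psi y) = y.
Proof.
apply/rowP => i; rewrite !mxE addrC addKr lamS mulrA mulVf ?mul1r//.
by rewrite gt_eqF.
Qed.

Lemma lam_theta x j : lsum finset.setT x = 1 -> lam (theta x) j = kap^-1 * (x 0 j - n.+1%:R^-1).
Proof.
move=> x1; rewrite /lam; case: unliftP => [i ->|->]; first by rewrite mxE.
have : \sum_(j < n.+1) (x 0 j - n.+1%:R^-1) = 0.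
  rewrite sumrB sumr_const card_ord -[X in _ - X]mulr_natr mulVf ?pnatr_eq0//.
  move: x1; rewrite /lsum (eq_bigl xpredT) => [->|i]; first by rewrite subrr.
  by rewrite inE.
rewrite big_ord_recl => /eqP; rewrite addr_eq0 => /eqP ->.
rewrite mulrN mulr_sumr; congr (- _); apply: eq_bigr => i _.
by rewrite mxE.
Qed.

Lemma thetaK x : lsum finset.setT x = 1 -> psi (theta x) = x.
Proof.
move=> x1; apply/rowP => j; rewrite mxE lam_theta// mulrA mulfV ?gt_eqF// mul1r.
by rewrite addrC subrK.
Qed.

Lemma psi_continuous : continuous psi.
Proof.
move=> y; apply: continuous_at_rV => j; rewrite /prop_for/continuous_at.
under eq_cvg do rewrite mxE; rewrite mxE.
have h := @lam_continuous R n j y.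
by apply: (cvgD (cvg_cst _) (cvgMl_tmp h)).
Qed.

Lemma theta_continuous : continuous theta.
Proof.
move=> x; apply: continuous_at_rV => i; rewrite /prop_for/continuous_at.
under eq_cvg do rewrite mxE; rewrite mxE.
have h := @coord_continuous R 1 n.+1 0 (fintype.lift ord0 i) x.
exact: (cvgMl_tmp (@cvgB _ _ _ (nbhs x) (nbhs_filter x) _ _ _ _ h (cvg_cst _))).
Qed.

Definition psi_pv : 'M[R]_(n.+1, n.+1) := \matrix_(l, j) psi (row l (pv R n)) 0 j.

Lemma row_psi_pv l : row l psi_pv = psi (row l (pv R n)).
Proof. by apply/rowP => j; rewrite !mxE. Qed.

Lemma psi_aff x : psi (aff (pv R n) x) = aff psi_pv x.
Proof.
apply/rowP => j; rewrite mxE lam_aff [RHS]mxE mulr_sumr.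
have -> : n.+1%:R^-1 = \sum_i set_val x 0 i * n.+1%:R^-1 :> R.
  by rewrite -mulr_suml Delta_sum mul1r.
rewrite -big_split/=; apply: eq_bigr => i _.
by rewrite [psi_pv _ _]mxE [psi _ _ _]mxE mulrDr [in RHS]mulrCA.
Qed.

Lemma psi_pv_E l j : row l psi_pv 0 j =
  n.+1%:R^-1 + kap * (if l == j then 3 / 4 * n%:R else - (3 / 4)).
Proof. by rewrite row_psi_pv mxE lam_pv. Qed.

Lemma pv_Om l : Om (row l (pv R n)).
Proof.
have i0 : inner (fun _ : 'I_n.+1 => 0 : R) by move=> j; lra.
by have [_ _ + _] := pv_position i0; exact.
Qed.

Definition flag_sign : int := (-1) ^+ flag_sg (rev_perm n.+1, rev_perm n).

Lemma flag_sign2 : flag_sign * flag_sign = 1.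
Proof. exact: sqrr_sign. Qed.

(* The flag chain generates the local homology of the permutahedron at the centre. *)
Lemma zeta_center : relb Pi (fun s => range s `<=` ~` [set psi 0])
  (zeta - flag_sign *: << aff psi_pv >>).
Proof.
have Pc : convexe Pi := @Pi_convex R n eps.
(* The part of the permutahedron beyond the barycentre on the side of F_w. It contains F_w because
   [gap] is positive, and the rows of [psi_pv] with index in w because w has at most n elements, but
   not the barycentre. *)
pose Uw (w : W) : set V := [set x | Pi x /\ #|val w|%:R / n.+1%:R < lsum (val w) x].
have cUw w : convexe (Uw w).
  move=> x y t [Px x0] [Py y0] t0 t1; split; first exact: Pc.
  by rewrite lsum_line; exact: lt_line.
pose A (j : 'I_n.+1) : set V := [set x | Pi x /\ x 0 j < n.+1%:R^-1].
have cA j : convexe (A j).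
  move=> x y t [Px x0] [Py y0] t0 t1; split; first exact: Pc.
  by rewrite !mxE; exact: gt_line.
have h1 := @flagchain_least R m _ psi_pv A cA.
have {}h1 : csupp (fun s : simplex n V => range s `<=` ~` [set psi 0])
    (flagchain (fun G => row (least G) psi_pv) - flag_sign *: << aff psi_pv >>).
  apply: csupp_sub (h1 _) => [s [j sj] x /sj[_ +] e|l j lj].
    by rewrite e mxE lam_zero mulr0 addr0 ltxx.
  split; first by rewrite row_psi_pv; apply: psi_Pi; exact: pv_Om.
  by rewrite psi_pv_E (negPf lj) mulrN gtrDl oppr_lt0 mulr_gt0// divr_gt0.
have h2 : relb Pi (fun s : simplex n V => range s `<=` ~` [set psi 0])
    (flagchain (fun G => row (least G) psi_pv) - push id zeta).
  have := @flag_homotopy R m _ _ bpt (fun G => row (least G) psi_pv) id Pi Fw Pi Uw.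
  move=> /(_ _ Pc Fw_convex Pc cUw) H.
  apply: relb_sub (H _ _ _ _ _) => //.
  - move=> s [w sw] x /sw[_ +] e; rewrite e lsum_psi big1 ?mulr0 ?addr0 ?ltxx// => j _.
    exact: lam_zero.
  - by move=> x; exact: cvg_id.
  - move=> G /bptP[PG _]; split=> //; rewrite row_psi_pv; apply: psi_Pi; exact: pv_Om.
  - move=> G w fG wG; split; first exact: bpt_Fw.
    rewrite row_psi_pv; split; first by apply: psi_Pi; exact: pv_Om.
    rewrite lsum_psi ltrDl mulr_gt0//.
    have [s Gs] := fG; have lw : least G \in val w.
      have [|+ _] := @leastP m G ((s^-1)%g ord0).
        by apply/bigcapP => w' /Gs[k ->]; rewrite inE permKV.
      by move=> /bigcapP; exact.
    rewrite (bigD1 (least G))//= lam_pv eqxx.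
    rewrite (eq_bigr (fun=> - (3 / 4))) => [|j /andP[_ /negPf jl]]; last first.
      by rewrite lam_pv eq_sym jl.
    rewrite sumrN (eq_bigl (fun j => j \in (val w :\ least G))); last first.
      by move=> j; rewrite !inE andbC.
    rewrite sumr_const -[X in _ - X]mulr_natr subr_gt0 ltr_pM2l ?divr_gt0// ltr_nat.
    have wn : (#|val w| < n.+1)%N.
      by have /andP[_ /proper_card] := valP w; rewrite cardsT card_ord.
    by move: wn; rewrite (cardsD1 (least G)) lw add1n ltnS.
  - move=> w x [Px /eqP]; rewrite subr_eq0 => /eqP x0; split=> //.
    by rewrite -x0 -subr_gt0; exact: gap_gt0.
have -> : zeta - flag_sign *: << aff psi_pv >> =
    (flagchain (fun G => row (least G) psi_pv) - flag_sign *: << aff psi_pv >>) -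
    (flagchain (fun G => row (least G) psi_pv) - push id zeta).
  by rewrite push_id opprB [RHS]addrC addrA subrK.
by apply: relbB => //; exact: relb_csupp.
Qed.

End Center.

Section Glued.
Variables (C : finType) (act : W -> C -> C) (bit : C -> 'I_n -> bool).
Hypothesis hact : cell_action act bit.
Variables (Y : topologicalType) (q : C -> V -> Y).
Hypothesis hq : gluing eps act q.

Let hY : hausdorff_space Y := glued_hausdorff hact hq.
Let eY : locally_euclidean R n Y := glued_locally_euclidean hp hact hq.

Let qw c : {within Pi, continuous (q c)}. Proof. by case: hq. Qed.

Definition parity (c : C) : bool := \big[addb/false]_k bit c k.

Lemma parity_act w c : parity (act w c) = ~~ parity c.
Proof.
have [_ _ ba] := hact; rewrite /parity (eq_bigr (fun k : 'I_n => (k.+1 == #|val w|) (+) bit c k)) => [|k _]; last exact: ba.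
rewrite big_split/=; suff -> : \big[addb/false]_(k < n) (k.+1 == #|val w|) = true by [].
have wn : (#|val w| < n.+1)%N.
  by have /andP[_ /proper_card] := valP w; rewrite cardsT card_ord.
have w0 : (0 < #|val w|)%N by rewrite card_gt0; have /andP[] := valP w.
have kn : (#|val w|.-1 < n)%N by rewrite -ltnS prednK.
rewrite (bigD1 (Ordinal kn))//= prednK// eqxx big1 // => k kk.
apply/negbTE; apply: contra kk => /eqP kw; apply/eqP/val_inj; by rewrite /= -kw.
Qed.

(* A cycle, since crossing a facet changes the parity. *)
Definition cells : chain n Y := \sum_c (-1) ^+ parity c *: push (q c) zeta.

Lemma push_facet w k (a : chain k V) c : chain_in (Fw w) a ->
  push (q (act w c)) a = push (q c) a.
Proof.
move=> aw; apply: (@eq_push _ _ _ _ _ (Fw w)) => //.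
  by apply: (@continuous_subspaceW _ _ _ Pi) (@qw _) => x [].
move=> x [Px x0]; apply: (q_eq hq) => //; rewrite (conn_sym hact).
by rewrite (conn_act hact) /conn ?connect0// inE x0.
Qed.

Lemma boundary_cells : boundary cells = 0.
Proof.
rewrite /cells linear_sum/=.
under eq_bigr => c _ do rewrite (@boundaryZ R Y n) (boundary_push (@qw c) zeta_Pi)
  boundary_flagchain linear_sum scaler_sumr.
rewrite exchange_big big1// => x _.
under eq_bigr => c _ do rewrite linearZ/=.
apply: (@sum_signed_invol _ _ (act (fl x.1 (x.2 ord0))) parity) => [|c|c].
- by have [] := hact.
- exact: parity_act.
rewrite parity_act signrN scaleNr push_facet//; apply: csuppU.
exact: (@flag_face_in R m _ bpt Fw x Fw_convex bpt_Fw).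
Qed.

Lemma clopen_cell (B : set Y) c x x' : open B -> closed B -> Pi x -> Pi x' ->
  B (q c x) -> B (q c x').
Proof.
move=> oB cB Px Px' Bx; pose g (t : R) := x + t *: (x' - x).
have gc : continuous g by move=> t; apply: cvgD; [exact: cvg_cst|apply: cvgZr_tmp; exact: cvg_id].
have gP t : `[0 : R, 1]%classic t -> Pi (g t).
  by rewrite /= in_itv/= => /andP[t0 t1]; exact: Pi_convex.
have hc : {within `[0 : R, 1]%classic, continuous (q c \o g)}.
  apply/subspace_continuousP => t t01 N Nt.
  have := @qw c => /subspace_continuousP/(_ _ (gP t t01)) /(_ N Nt) h.
  have h2 : nbhs t [set t' | Pi (g t') -> N (q c (g t'))] := gc t _ h.
  by apply: (@filterS _ (nbhs t) (nbhs_filter t) _ _ _ h2) => t' h' /gP/h'.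
have con : connected ((q c \o g) @` `[0 : R, 1]%classic).
  by apply: connected_continuous_connected hc; exact: segment_connected.
have i0 : `[0 : R, 1]%classic 0 by rewrite /= in_itv/= lexx ler01.
have i1 : `[0 : R, 1]%classic 1 by rewrite /= in_itv/= lexx ler01.
have e : (q c \o g) @` `[0 : R, 1]%classic `&` B = (q c \o g) @` `[0 : R, 1]%classic.
  apply: con; [|by exists B|by exists B].
  by exists (q c x); split=> //; exists 0 => //; rewrite /= /g scale0r addr0.
have : ((q c \o g) @` `[0 : R, 1]%classic `&` B) (q c x').
  by rewrite e; exists 1 => //; rewrite /= /g scale1r addrC subrK.
by case.
Qed.

Lemma push_cell_off c (T : set V) (A : set Y) k (a : chain k V) :
  (forall x, Pi x -> T x -> A (q c x)) -> chain_in Pi a -> chain_in T a -> chain_in A (push (q c) a).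
Proof.
move=> TA Pa Ta; apply: (@chain_in_push _ _ _ _ _ (Pi `&` T)) => [x [Px Tx]|]; first exact: TA.
by apply: csupp_sub (csupp_and Pa Ta) => s [sP sT] x sx; split; [exact: sP|exact: sT].
Qed.

(** Only the cell c contains its centre, and there [zeta_center] compares [zeta] with the generator
    of a chart. *)
Lemma cells_center c : exists2 x, Pi x & local_generator (q c x) cells.
Proof.
have [kap [kap0 kapP]] := exists_kap; have O0 := @Om0 R n.
have P0 := psi_Pi kap0 kapP O0; exists (psi kap 0) => //.
pose f : Y -> 'rV[R]_n := theta kap \o fold hq.
pose g : 'rV[R]_n -> Y := q c \o psi kap.
pose U : set Y := [set y | 0 < sheet hq finset.set0 c y /\ Om (f y)].
have UP c' x : Pi x -> U (q c' x) -> [/\ fac x = finset.set0, c' = c & Om (theta kap x)].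
  move=> Px [/(sheet_gt0 hp hact hq _ _ _ Px)[x0 cc]]; rewrite /f /= foldE// => Ox; split=> //.
    by apply/eqP; rewrite -finset.subset0.
  by apply/eqP; rewrite eq_sym -(conn_set0 act).
have PU y : Om y -> U (q c (psi kap y)).
  move=> Oy; have Py := psi_Pi kap0 kapP Oy; split; last by rewrite /f/= foldE// psiK.
  by apply/(sheet_gt0 hp hact hq _ _ _ Py); rewrite psi_fac// finset.sub0set /conn connect0.
have fc : continuous f.
  by move=> y; apply: continuous_comp; [exact: fold_continuous|exact: theta_continuous].
have sum1 x : Pi x -> lsum finset.setT x = 1 by rewrite (PiE hp) => -[].
have hU : chart U f g.
  split.
  - rewrite (_ : U = (sheet hq finset.set0 c @^-1` [set z | 0 < z]) `&` (f @^-1` (@Om R n)))//.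
    apply: openI; [apply: open_comp; last exact: open_gt|apply: open_comp; last exact: open_Om].
      by move=> y _; exact: (sheet_continuous hact).
    by move=> y _; exact: fc.
  - by move=> y _; exact: fc.
  - move=> y Oy; apply: (@within_open_continuous _ _ (@Om R n)); [exact: open_Om| |exact: Oy].
    apply/subspace_continuousP => t Ot N Nt.
    have Pt := psi_Pi kap0 kapP Ot.
    have := @qw c => /subspace_continuousP/(_ _ Pt) /(_ N Nt) h.
    have h2 : nbhs t [set t' | Pi (psi kap t') -> N (q c (psi kap t'))] := psi_continuous h.
    apply: (@filterS _ (nbhs t) (nbhs_filter t) _ _ _ h2) => t' h' Ot'.
    by apply: h'; exact: psi_Pi.
  - move=> y; have [_ qP _ _] := hq; have [[c' x] /= [Px ->]] := qP y.
    move=> Ux; have [x0 cc Ox] := UP _ _ Px Ux; subst c'.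
    by rewrite /f /g /= foldE// thetaK// sum1.
  - move=> y Oy; have Py := psi_Pi kap0 kapP Oy; split; first exact: PU.
    by rewrite /f /g /= foldE// psiK.
set x0 := q c (psi kap 0).
have Ux0 : U x0 := PU 0 O0.
have fx0 : f x0 = 0 by rewrite /f /x0/= foldE// psiK.
have miss c' x : Pi x -> x <> psi kap 0 \/ c' <> c -> q c' x <> x0.
  move=> Px h e; have [ex cc] := q_inj hq Px P0 e; move: cc h.
  rewrite ex psi_fac// conn_set0 => /eqP ->; by case.
have zg : hzero (~` [set x0]) (cells - ((-1) ^+ parity c * flag_sign) *: gam g).
  have -> : cells - ((-1) ^+ parity c * flag_sign) *: gam g =
      (\sum_(c' | c' != c) (-1) ^+ parity c' *: push (q c') zeta) +
      (-1) ^+ parity c *: push (q c) (zeta - flag_sign *: << aff (psi_pv kap) >>).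
    have gE : gam g = push (q c) << aff (psi_pv kap) >>.
      rewrite /gam /g -(@push_comp _ _ _ _ _ (q c) (@Om R n) Pi).
      - by congr (push _ _); apply: pushU => x; exact: psi_aff.
      - by apply: cont_within; exact: psi_continuous.
      - exact: qw.
      - by move=> y; exact: psi_Pi.
      - exact: aff_pv_Om.
    by rewrite /cells (bigD1 c)//= gE pushB pushZ scalerBr scalerA [X in X - _]addrC addrA.
  apply: hzeroD.
    apply: hzero_in; apply: csupp_sum => c' cc; apply: csuppZ.
    apply: (@push_cell_off c' setT) => [x Px _|//|]; last exact: chain_inT.
      by apply: miss => //; right; exact/eqP.
    exact: zeta_Pi.
  apply: hzeroZ.
  have [e Pe he] := zeta_center kap0 kapP.
  have PP : chain_in Pi (zeta - flag_sign *: << aff (psi_pv kap) >> - boundary e).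
    apply: chain_inB; last exact: (@chain_in_boundary _ _ n.+1).
    apply: chain_inB; first exact: zeta_Pi.
    apply: chain_inZ; apply: chain_inU; apply: aff_in => [|l]; first exact: Pi_convex.
    by rewrite row_psi_pv; apply: psi_Pi => //; exact: pv_Om.
  have := @relb_push R V Y (q c) Pi setT n
    (fun s => range s `<=` Pi /\ range s `<=` ~` [set psi kap 0]) (fun s => range s `<=` ~` [set x0])
    (zeta - flag_sign *: << aff (psi_pv kap) >>) (@qw c) (fun _ _ => Logic.I).
  case=> [s t [sP s0] st _ [x _ <-]||e' _ he']; last by exists e'.
    rewrite -st /=; apply: miss; first by apply: sP; exact: imageP.
    by left; apply: s0; exact: imageP.
  by exists e => //; exact: csupp_and PP he.
have i0 : inner (lam (0 : 'rV[R]_n)) by move=> j; rewrite lam_zero; lra.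
have KE : Ka U f (lam (0 : 'rV[R]_n)) = [set x0] by rewrite -fx0 (Ka_point hU).
split=> [|c' rc']; first by rewrite /relative_cycle boundary_cells; exact: csupp0.
have [|r] := @chart_generator R n Y hY U f g hU _ c' i0; first by rewrite KE.
rewrite KE => c'g; pose e : int := (-1) ^+ parity c * flag_sign.
exists (r * e).
change (hzero (~` [set x0]) (c' - (r * e) *: cells)).
have e2 : e * e = 1 by rewrite /e mulrACA flag_sign2 mulr1 -expr2 sqrr_sign.
have -> : c' - (r * e) *: cells = (c' - r *: gam g) - (r * e) *: (cells - e *: gam g).
  by rewrite scalerBr scalerA -mulrA e2 mulr1 opprB addrA subrK.
by apply: hzeroB => //; exact: hzeroZ.
Qed.

(** By [locally_generator] the points with this property form an open and closed set; it contains
    the centre of each cell, and cells are connected. *)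
Lemma cells_generator y : local_generator y cells.
Proof.
have [_ qP _ _] := hq; have [[c x] /= [Px ->]] := qP y.
have [x0 P0 g0] := cells_center c.
apply: (@clopen_cell [set y | local_generator y cells] c x0 x _ _ P0 Px g0).
  rewrite openE => z gz; rewrite /interior.
  have [K zK Kc] := locally_generator hY eY z boundary_cells.
  by apply: filterS zK => z' /Kc[+ _]; apply.
rewrite -[X in closed X]setCK; apply: open_closedC.
rewrite openE => z gz; rewrite /interior.
have [K zK Kc] := locally_generator hY eY z boundary_cells.
by apply: filterS zK => z' /Kc[_ h] /h.
Qed.

Lemma cells_orientation : is_orientation (fun=> cells).
Proof.
split=> [y|y]; first exact: cells_generator.
exists setT; split; first exact: filterT.
exists cells; split=> [|y' _]; first by rewrite /relative_cycle boundary_cells; exact: csupp0.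
exact: hzero_refl.
Qed.

End Glued.

End Cycle.

(** * The Tomei manifold and its coverings *)

Section Quotients.
Local Open Scope quotient_scope.
Variables (R : realType) (m : nat) (eps : nat -> R).
Local Notation n := m.+1.
Hypothesis hp : permutahedron_parameters n eps.
Local Notation V := 'rV[R]_n.+1.
Local Notation W := (omega n).
Local Notation Pi := (@permutahedron R n eps).
Local Notation fac := (@fac R m eps).

Definition pt0 : Pi := SigSub (mem_set (@Pi_vert R n eps 1%g)).

Definition inPi (x : V) : Pi := insubd pt0 x.

Lemma val_inPi x : Pi x -> set_val (inPi x) = x.
Proof. by move=> Px; rewrite set_valE /inPi insubdK//; exact/mem_set. Qed.

Lemma inPiK p : inPi (set_val p) = p.
Proof. by apply: val_inj; rewrite /inPi insubdK//; exact: valP. Qed.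

Lemma inPi_continuous : {within Pi, continuous inPi}.
Proof.
apply/subspace_continuousP => y dy; apply: cvg_set_type; rewrite val_inPi// => U yU.
by rewrite /within/= nbhs_simpl /=; apply: filterS yU => z Uz dz; rewrite /= val_inPi.
Qed.

(** D labels the copies of the permutahedron before the quotient and C the cells after it; [dc]
    picks a label for a cell, [cd] gives the cell of a label. For the Tomei manifold D is the
    Coxeter group and C is Z_2^n. *)
Lemma gluing_quotient (D : choiceType) (Y : topologicalType)
    (pr : (Pi * discrete_topology D)%type -> Y) (C : finType) (act : W -> C -> C)
    (dc : C -> D) (cd : D -> C) :
  continuous pr ->
  (forall (Z : topologicalType) (f : Y -> Z), continuous (f \o pr) -> continuous f) ->
  (forall y, exists z, pr z = y) ->
  (forall p d, pr (p, d) = pr (p, dc (cd d))) ->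
  (forall p p' c c', pr (p, dc c) = pr (p', dc c') <->
    p = p' /\ conn act (fac (set_val p)) c c') ->
  gluing eps act (fun c x => pr (inPi x, dc c)).
Proof.
move=> prc pru prs prd pri; split.
- move=> c; apply/subspace_continuousP => x Px N Nx.
  have [[A B] /= [Ax Bx] AB] := prc (inPi x, dc c) N Nx.
  have := inPi_continuous => /subspace_continuousP/(_ _ Px)/(_ A Ax) h.
  have h2 : nbhs x [set z | Pi z -> A (inPi z)] := h.
  apply: (@filterS _ (nbhs x) (nbhs_filter x) _ _ _ h2) => z Az Pz.
  by apply: (AB (inPi z, dc c)); split; [exact: Az|exact: nbhs_singleton Bx].
- move=> y; have [[p d] <-] := prs y; exists (cd d, set_val p) => /=; split.
    exact: set_valP.
  by rewrite inPiK.
- move=> c c' x x' Px Px'; split=> [/pri[e cc]|[-> cc]].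
    by split; [rewrite -(val_inPi Px) e val_inPi|rewrite -(val_inPi Px)].
  by apply/pri; rewrite val_inPi.
- move=> Z f fc; apply: pru => -[p d] N Nf.
  have := fc (cd d) => /subspace_continuousP/(_ _ (set_valP p)).
  have hN : nbhs (f (pr (inPi (set_val p), dc (cd d)))) N by rewrite inPiK -prd.
  move=> /(_ N hN) h.
  have h2 : nbhs p [set p' : Pi | N (f (pr (p', d)))].
    have h3 : nbhs (set_val p) [set x | Pi x -> N (f (pr (inPi x, dc (cd d))))] := h.
    have h4 : nbhs p [set p' : Pi | Pi (set_val p') -> N (f (pr (inPi (set_val p'), dc (cd d))))].
      exact: (@set_val_continuous _ Pi p _ h3).
    apply: (@filterS _ (nbhs p) (nbhs_filter p) _ _ _ h4) => p' /= h'.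
    by have := h' (set_valP p'); rewrite inPiK -prd.
  exists ([set p' : Pi | N (f (pr (p', d)))], [set d]) => /=; first by split.
  by move=> [p' d'] /= [Np ->].
Qed.

Section TomeiGluing.
Local Notation CM := {ffun 'I_n -> bool}.
Local Notation G := (coxeter_W n).

Definition actM (w : W) (e : CM) : CM := [ffun k : 'I_n => (k.+1 == #|val w|) (+) e k].
Definition bitM (e : CM) (k : 'I_n) : bool := e k.

Lemma actM_cell : cell_action actM bitM.
Proof.
split=> [w e|w w' e _|w e k].
- by apply/ffunP => k; rewrite !ffunE addbA addbb.
- by apply/ffunP => k; rewrite !ffunE addbCA.
- by rewrite /bitM ffunE.
Qed.

Definition ebit (x : G) : CM := [ffun k => Defs.eta x 0 k != 0].

Lemma F2_neq0D (a b : 'F_2) : (a + b != 0) = (a != 0) (+) (b != 0).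
Proof. by case: a b => [[|[|a]] ia] [[|[|b]] ib]. Qed.

Lemma ebitM x y k : ebit (x * y)%g k = ebit x k (+) ebit y k.
Proof. by rewrite !ffunE etaM mxE F2_neq0D. Qed.

Lemma ebit_s w k : ebit (coxeter_s w) k = (k.+1 == #|val w|).
Proof. by rewrite ffunE eta_s mxE; case: (k.+1 == _). Qed.

Lemma ebit1 k : ebit 1%g k = false.
Proof. by rewrite ffunE eta1 mxE eqxx. Qed.

Lemma ebitV x k : ebit x^-1%g k = ebit x k.
Proof. by have := ebitM x x^-1%g k; rewrite mulgV ebit1; case: (ebit x k); case: (ebit _ k). Qed.

Lemma ebit_inj x y : ebit x = ebit y -> Defs.eta x = Defs.eta y.
Proof.
move=> e; apply/rowP => k; have := congr1 (fun f : CM => f k) e; rewrite !ffunE.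
by case: (Defs.eta x 0 k) (Defs.eta y 0 k) => [[|[|a]] ia] [[|[|b]] ib] //= _; exact: val_inj.
Qed.

(** A section of [eta], made of the generators of one flag, which has one subset of each size. *)
Definition wlift (e : CM) : G :=
  \pi_(coxeter_W n) [seq fl (1%g : 'S_n.+1) k | k <- enum 'I_n & e k].

Lemma wliftK e : ebit (wlift e) = e.
Proof.
apply/ffunP => k; rewrite ffunE eta_pi big_map big_filter big_enum_cond/=.
rewrite summxE (eq_bigr (fun j => (j == k)%:R)); last first.
  by move=> j _; rewrite mxE card_down ?ltnS 1?ltnW// eqSS eq_sym.
case: (boolP (e k)) => ek; last first.
  rewrite big1 ?eqxx// => j ej; case: eqP => // jk; by rewrite -jk ej in ek.
by rewrite (bigD1 k)//= eqxx big1 ?addr0// => j /andP[_ /negPf ->].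
Qed.

(** Translates gluing by subgroups into [conn]: the generators of the stabilizer of p act on the
    bits as the moves across the facets through p. *)
Lemma stabilizer_ebit (p : Pi) (c c' : CM) :
  conn actM (fac (set_val p)) c c' <->
  exists2 x : G, stabilizer p x & forall k, c' k = ebit x k (+) c k.
Proof.
have facE w : w \in fac (set_val p) <-> facet eps w (set_val p).
  rewrite inE /facet /(slack _ _); split=> [/eqP/subr0_eq e|[_ e]].
    split; first exact: set_valP.
    rewrite /= -/(lsum (val w) (set_val p)) -e epseE//.
    have := valP w; rewrite -card_gt0 => /andP[-> /proper_card].
    by rewrite cardsT card_ord ltnS.
  rewrite /lsum e epseE ?subrr//.
  have := valP w; rewrite -card_gt0 => /andP[-> /proper_card].
  by rewrite cardsT card_ord ltnS.
split=> [/connectP[l]|[x xS cc]].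
  elim: l c => [c _ ->|d l IH c /= /andP[/exists_inP[w wp /eqP dc] /IH h] /h [x xS cc]].
    by exists 1%g; [exact: generated_subgroup1|move=> k; rewrite ebit1].
  exists (x * coxeter_s w)%g.
    rewrite -[coxeter_s w]invgK; apply: generated_subgroupF => //.
    rewrite -[X in _ X]mul1g; apply: generated_subgroupF; first exact: generated_subgroup1.
    by move=> H [_]; apply; exists w => //; exact/facE.
  move=> k; have e : actM w c k = (k.+1 == #|val w|) (+) c k by rewrite ffunE.
  by rewrite cc dc e ebitM ebit_s addbA.
pose H : set G := [set x | forall c c' : CM, (forall k, c' k = ebit x k (+) c k) ->
  conn actM (fac (set_val p)) c c'].
have : H x; last by apply.
apply: xS; split.
  split=> [|y z /set_mem Hy /set_mem Hz]; apply/mem_set => d d' dd.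
    have -> : d' = d by apply/ffunP => k; rewrite dd ebit1.
    exact: connect0.
  pose d1 : CM := [ffun k => ebit z k (+) d k].
  apply: (@connect_trans _ _ d1); first by apply: Hz => k; rewrite ffunE.
  have d1E k : d1 k = ebit z k (+) d k by rewrite ffunE.
  by apply: Hy => k; rewrite d1E dd ebitM ebitV addbA.
move=> _ [w wp ->] d d' dd; have -> : d' = actM w d.
  by apply/ffunP => k; rewrite dd ebit_s /actM [RHS]ffunE.
rewrite (conn_act actM_cell); [exact: connect0|exact/facE].
Qed.

Local Notation T := (tomei_manifold n eps).

Definition tomei_pr (z : (Pi * discrete_topology G)%type) : T :=
  \pi_T (tomei_class z.1 z.2).

Lemma tomei_prP p p' (w w' : G) : tomei_pr (p, w) = tomei_pr (p', w') <->
  p = p' /\ conn actM (fac (set_val p)) (ebit w) (ebit w').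
Proof.
have cls u u' : tomei_class p u = tomei_class p' u' <-> p = p' /\ stabilizer p (u' * u^-1)%g.
  by split=> [/eqmodP/asboolP//|[e st]]; apply/eqmodP/asboolP.
split=> [/eqmodP/asboolP[k kk]|[pp /stabilizer_ebit[x xS wx]]].
  rewrite tomei_actE => /cls[pp st]; split=> //; apply/stabilizer_ebit.
  exists (w' * (w * k)^-1)%g => // j; rewrite ebitM ebitV ebitM.
  have -> : ebit k j = false by rewrite ffunE kk mxE eqxx.
  by rewrite addbF -addbA addbb addbF.
(* The element k of the kernel is chosen with w k = x^-1 w', which the stabilizer identifies with
   w'. *)
apply/eqmodP/asboolP; exists (w^-1 * (x^-1 * w'))%g.
  rewrite /eta_ker/= -(@eta1 n); apply: ebit_inj; apply/ffunP => j.
  by rewrite !ebitM !ebitV ebit1 wx; case: (ebit x j); case: (ebit w j).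
rewrite tomei_actE mulgA mulgV mul1g; apply/cls; split=> //.
by rewrite invgM invgK mulgA mulgV mul1g.
Qed.

Definition qM (e : CM) (x : V) : T := tomei_pr (inPi x, wlift e).

Lemma qM_gluing : gluing eps actM qM.
Proof.
apply: (@gluing_quotient G T tomei_pr CM actM wlift ebit).
- move=> z; apply: (@continuous_comp _ _ _ (fun z : (Pi * discrete_topology G)%type => tomei_class z.1 z.2) \pi_T z).
    rewrite (_ : (fun z => _) = \pi_(tomei_cover n eps)); first exact: pi_continuous.
    by apply/funext => -[].
  exact: pi_continuous.
- move=> Z f fc; apply/quotient_continuous/quotient_continuous.
  by move: fc; rewrite (_ : f \o tomei_pr = (f \o \pi_T) \o \pi_(tomei_cover n eps))//; apply/funext => -[].
- move=> y; rewrite -[y]reprK; elim/tomei_cover_ind: (repr y) => p w.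
  by exists (p, w).
- move=> p w; apply/tomei_prP; split=> //; rewrite wliftK; exact: connect0.
- move=> p p' c c'; have := tomei_prP p p' (wlift c) (wlift c').
  by rewrite !wliftK.
Qed.

(** All cells share a vertex, as the facets of one flag flip all bits independently, and each cell
    is connected. *)
Lemma qM_connected : connected [set: T].
Proof.
move=> B [y By] [A1 oA1 BA1] [A2 cA2 BA2]; rewrite setTI in BA1; rewrite setTI in BA2.
have oB : open B by rewrite BA1.
have cB : closed B by rewrite BA2.
pose v := @permutahedron_vertex R n eps 1%g.
have Pv : Pi v by exact: Pi_vert.
have [_ qP _ _] := qM_gluing; apply/seteqP; split=> // z _.
have [[c x] /= [Px zE]] := qP z; have [[c' x'] /= [Px' yE]] := qP y.
rewrite zE; apply: (clopen_cell qM_gluing oB cB Pv Px).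
have -> : qM c v = qM c' v.
  apply: (q_eq qM_gluing) => //.
  have fv : flagset (1%g : 'S_n.+1) \subset fac v.
    apply/fintype.subsetP => w /imsetP[k _ ->].
    rewrite inE /(slack _ _)/= lsum_down//; last by rewrite ltnS ltnW.
    by rewrite card_down ?subrr// ltnS ltnW.
  apply: conn_sub fv _; rewrite (_ : c' = mv actM 1%g (fun k => c' k (+) c k) c).
    exact: (conn_mv actM_cell).
  apply/ffunP => k; rewrite -[RHS]/(bitM _ k) (bit_mv actM_cell).
  by rewrite /bitM -addbA addbb addbF.
by rewrite yE in By; exact: (clopen_cell qM_gluing oB cB Px' Pv By).
Qed.

End TomeiGluing.

End Quotients.

Lemma zmod_shift (M : zmodType) (a b c d : M) : a - b - d = a - c - b - (d - c).
Proof. by rewrite opprB addrA [a - c - b]addrAC subrK. Qed.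

Section Bits.
Variables (m : nat).
Local Notation n := m.+1.
Local Notation W := (omega n).
Variables (C : finType) (act : W -> C -> C) (bit : C -> 'I_n -> bool).
Hypothesis hact : cell_action act bit.

Lemma conn_bits s c d : conn act (flagset s) c d -> (forall k, bit c k = bit d k) -> c = d.
Proof.
move=> cd e; rewrite (connP hact cd) -[LHS](mv0 act s c).
by apply: eq_mv => k; rewrite e addbb.
Qed.

Lemma conn_bit (T : {set W}) s c d k : conn act T c d -> T \subset flagset s ->
  bit d k != bit c k -> fl s k \in T.
Proof.
move=> cd Ts; apply: contraNT => nT; apply/eqP.
apply: (conn_invariant (h := bit^~ k) _ cd) => w c1 wT.
have /imsetP[l _ wE] := fintype.subsetP Ts w wT; rewrite wE (bit_fl hact).
by case: eqP => // kl; rewrite kl -wE wT in nT.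
Qed.

End Bits.

(** * Coverings between glued spaces *)

Section Covering.
Variables (R : realType) (m : nat) (eps : nat -> R).
Local Notation n := m.+1.
Hypothesis hp : permutahedron_parameters n eps.
Local Notation V := 'rV[R]_n.+1.
Local Notation W := (omega n).
Local Notation chain := (chain R).
Local Notation Pi := (@permutahedron R n eps).
Local Notation fac := (@fac R m eps).

Variables (C : finType) (act : W -> C -> C) (bit : C -> 'I_n -> bool).
Hypothesis hact : cell_action act bit.
Variables (E : topologicalType) (q : C -> V -> E).
Hypothesis hq : gluing eps act q.

Variables (C' : finType) (act' : W -> C' -> C') (bit' : C' -> 'I_n -> bool).
Hypothesis hact' : cell_action act' bit'.
Variables (B : topologicalType) (q' : C' -> V -> B).
Hypothesis hq' : gluing eps act' q'.

Variable h : C -> C'.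
Hypothesis h_act : forall w c, h (act w c) = act' w (h c).
Hypothesis h_bit : forall c k, bit' (h c) k = bit c k.

Lemma h_conn T c d : conn act T c d -> conn act' T (h c) (h d).
Proof.
move=> /connectP[p]; elim: p c => [c _ ->|d' p IH c /= /andP[/exists_inP[w wT /eqP e] /IH hp'] /hp' hc].
  exact: connect0.
apply: connect_trans hc; apply: connect1; apply/exists_inP; exists w => //.
by rewrite e h_act.
Qed.

Lemma h_mv s e c : h (mv act s e c) = mv act' s e (h c).
Proof.
have H j : h (mvi act s e j c) = mvi act' s e j (h c).
  by elim: j => //= j <-; case: (e _) => //; rewrite h_act.
exact: H.
Qed.

Lemma h_parity c : parity bit' (h c) = parity bit c.
Proof. by apply: eq_bigr => k _; exact: h_bit. Qed.

Lemma h_compat : compat eps act (fun c x => q' (h c) x).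
Proof.
move=> c w x Px wx; apply: (q_eq hq') => //; rewrite h_act (conn_sym hact').
by rewrite (conn_act hact')//; exact: connect0.
Qed.

Definition cov : E -> B := glift hq (fun c x => q' (h c) x).

Lemma covE c x : Pi x -> cov (q c x) = q' (h c) x.
Proof. by move=> Px; rewrite /cov gliftE//; exact: h_compat. Qed.

Lemma cov_continuous : continuous cov.
Proof.
by apply: glift_continuous => [|c]; [exact: h_compat|case: hq'].
Qed.

(** Star coordinates depend only on slacks and bits, and h preserves bits: in these charts [cov] is
    the identity. *)
Lemma cov_star s c c0 x : Pi x -> fac x \subset flagset s ->
  star_coord bit' hq' s (h c0) (cov (q c x)) = star_coord bit hq s c0 (q c x).
Proof.
move=> Px xT; apply/rowP => k; rewrite covE// (star_coordE hact')// (star_coordE hact)//.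
by rewrite !h_bit.
Qed.

Lemma cov_starE s c0 y : star hq s c0 y ->
  star_coord bit' hq' s (h c0) (cov y) = star_coord bit hq s c0 y.
Proof.
have [_ qP _ _] := hq; have [[c x] /= [Px ->]] := qP y.
move=> /(starP hp hact hq _ _ _ Px)[xT _]; exact: cov_star.
Qed.

Lemma cov_in_star s c0 y : star hq s c0 y -> star hq' s (h c0) (cov y).
Proof.
have [_ qP _ _] := hq; have [[c x] /= [Px ->]] := qP y.
move=> /(starP hp hact hq _ _ _ Px)[xT cc]; rewrite covE//.
by apply/(starP hp hact' hq' _ _ _ Px); split=> //; exact: h_conn.
Qed.

Lemma cov_inj s c0 : {in star hq s c0 &, injective cov}.
Proof.
move=> y y' /set_mem Sy /set_mem Sy' e.
rewrite -(star_coordK hp hact Sy) -(star_coordK hp hact Sy').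
by rewrite -(cov_starE Sy) -(cov_starE Sy') e.
Qed.

Definition cov_inv s c0 (b : B) : E := star_inv eps act q s c0 (star_coord bit' hq' s (h c0) b).

Lemma cov_homeo s c0 :
  homeomorphism_between (star hq s c0) (star hq' s (h c0)) cov (cov_inv s c0).
Proof.
have SE b : star hq' s (h c0) b -> star hq s c0 (cov_inv s c0 b).
  by move=> Sb; apply: (star_inv_in hp hact hq); exact: (star_coord_in hp hact').
split; last split.
- split=> [||y|b].
  + apply: cont_within; exact: cov_continuous.
  + apply: continuous_at_within => b Sb; apply: continuous_comp.
      exact: (star_coord_continuous hp hact').
    by apply: (star_inv_continuous hp hact hq); exact: (star_coord_in hp hact').
  + exact: cov_in_star.
  + exact: SE.
- by move=> y Sy; rewrite /cov_inv cov_starE//; exact: (star_coordK hp hact).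
- move=> b Sb; have Scb := SE _ Sb.
  rewrite -[LHS](star_coordK hp hact' (cov_in_star Scb)) cov_starE// /cov_inv.
  rewrite (star_invK hp hact hq); last exact: (star_coord_in hp hact').
  exact: (star_coordK hp hact').
Qed.

(** The sheets over the star of c' are the stars of the cells over c'. Two of these meet only if
    equal, because their bits agree; and a cell over the star is carried to one over c' by changing
    bits across the flag. *)
Lemma cov_finite_sheeted (k : nat) : (0 < k)%N ->
  (forall c', #|[set c | h c == c']%SET| = k) -> finite_sheeted_covering cov.
Proof.
move=> k0 hk; split; first exact: cov_continuous.
exists k; split=> // b; have [_ qP' _ _] := hq'; have [[c' x] /= [Px bE]] := qP' b.
have [s bs] := star_cover hp hact' hq' c' Px.
pose F : {set C} := [set c | h c == c']%SET; pose ci (i : 'I_k) : C := enum_val (cast_ord (esym (hk c')) i).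
have hci i : h (ci i) = c' by have := enum_valP (cast_ord (esym (hk c')) i); rewrite inE => /eqP.
exists (star hq' s c'), (fun i => star hq s (ci i)); split.
- by split; [exact: (star_open hact')|rewrite bE].
- by move=> i; exact: (star_open hact).
- apply/trivIsetP => i j _ _ ij; apply/seteqP; split=> // y [].
  have [_ qP _ _] := hq; have [[c z] /= [Pz ->]] := qP y.
  move=> /(starP hp hact hq _ _ _ Pz)[_ cci] /(starP hp hact hq _ _ _ Pz)[_ ccj].
  have cij : ci i = ci j.
    apply: (@conn_bits _ _ _ _ hact s); first by apply: connect_trans cci _; rewrite -/(conn _ _ _ _) (conn_sym hact).
    by move=> l; rewrite -!h_bit !hci.
  by case/eqP: ij; move: cij => /enum_val_inj/cast_ord_inj.
- apply/seteqP; split=> y.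
    have [_ qP _ _] := hq; have [[c z] /= [Pz ->]] := qP y.
    rewrite /= covE// => /(starP hp hact' hq' _ _ _ Pz)[zT cc].
    pose d := mv act s (fun l => bit' c' l (+) bit c l) c.
    have hd : h d = c'.
      rewrite h_mv; rewrite (conn_sym hact') in cc; rewrite [RHS](connP hact' cc).
      by apply: eq_mv => l; rewrite h_bit.
    have dF : d \in F by rewrite inE hd.
    exists (cast_ord (hk c') (enum_rank_in dF d)) => //.
    apply/(starP hp hact hq _ _ _ Pz); split=> //.
    rewrite /ci cast_ordK enum_rankK_in// (conn_sym hact); exact: (conn_mv hact).
  by move=> [i _ Sy]; rewrite /= -(hci i); exact: cov_in_star.
- by move=> i; exists (cov_inv s (ci i)); rewrite -(hci i); exact: cov_homeo.
Qed.

Hypothesis one_orbit : forall s c d, conn act' (flagset s) c d.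

Lemma cov_orientation_preserving (o : B -> chain n B) (a : int) :
  (forall b, hzero (~` [set b]) (o b - a *: cells eps bit' q')) ->
  forall x : E, exists (U : set E) (c : chain n E),
    [/\ open_nbhs x U, {in U &, injective cov},
        chain_in U c & chain_in (U `\ x) (boundary c)] /\
    homologous_mod (~` [set x]) c (a *: cells eps bit q) /\
    homologous_mod (~` [set cov x]) (push cov c) (o (cov x)).
Proof.
move=> oa x; have [qw qP _ _] := hq; have [[c x0] /= [Px xE]] := qP x.
have hE : hausdorff_space E := glued_hausdorff hact hq.
have [s xs] := star_cover hp hact hq c Px; rewrite -xE in xs.
have xT : fac x0 \subset flagset s.
  by move: xs; rewrite xE => /(starP hp hact hq _ _ _ Px)[].
(* S collects the cells around the flag of s that contains c, and S' the others, which miss x. By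
   [one_orbit] the cells of S correspond to all the cells below, so [push cov S] is the whole cycle
   there. *)
pose S : chain n E := \sum_(d | conn act (flagset s) c d) (-1) ^+ parity bit d *: push (q d) (@zeta R m eps).
pose S' : chain n E := \sum_(d | ~~ conn act (flagset s) c d) (-1) ^+ parity bit d *: push (q d) (@zeta R m eps).
have SS : cells eps bit q = S + S' by rewrite /cells (bigID (conn act (flagset s) c)).
have S'x : chain_in (~` [set x]) S'.
  apply: csupp_sum => d cd; apply: csuppZ.
  apply: (@chain_in_push _ _ _ _ _ Pi) (@zeta_Pi R m eps) => y Py; rewrite xE => e.
  have [_ dc] := q_inj hq Py Px e; move/negP: cd; apply.
  rewrite (conn_sym hact); apply: conn_sub dc; by have [<- _] := q_inj hq Px Py (esym e).
pose A : set E := [set y | exists d z, [/\ Pi z, conn act (flagset s) c d & y = q d z]].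
have SA : chain_in A S.
  apply: csupp_sum => d cd; apply: csuppZ.
  by apply: (@chain_in_push _ _ _ _ _ Pi) (@zeta_Pi R m eps) => y Py; exists d, y.
have oU : open (star hq s c) by exact: (star_open hact).
have ox : open (~` [set x]) by apply: closed_openC; exact: accessible_closed_set1 (hausdorff_accessible hE) _.
(* The cells of S stick out of the star. After subdivision S splits into u in the star, where [cov]
   is injective, and v off x. *)
have [y _|mm [u [v [uv uU vx]]]] := sdIter_split oU ox SA.
  by have [->|yx] := pselect (y = x); [left|right].
have uU' : chain_in (star hq s c) u by apply: chain_in_sub uU => y [].
have vx' : chain_in (~` [set x]) v by apply: chain_in_sub vx => y [].
have dS : chain_in (~` [set x]) (boundary S).
  have -> : boundary S = - boundary S'.
    apply/eqP; rewrite -addr_eq0 -boundaryD -SS; apply/eqP.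
    exact: (boundary_cells hact hq).
  by apply: chain_inN; exact: chain_in_boundary.
(* In the cells of S only x lies over [cov x]: the facets across which two cells differ are read off
   from their bits, which h preserves. *)
have covv : chain_in (~` [set cov x]) (push cov v).
  apply: chain_in_push vx => y [yx [d [z [Pz cd yE]]]] e; apply: yx.
  move: e; rewrite /= yE xE !covE// => e; have [zx cc] := q_inj hq' Pz Px e.
  subst z; apply: (q_eq hq) => //; rewrite (connP hact cd) (conn_sym hact).
  rewrite -{1}(mv0 act s c); apply: (conn_mv2 hact) => [|k]; first exact: xT.
  move=> dc; apply: (conn_bit hact' cc xT); rewrite !h_bit.
  by move: dc; case: (bit d k); case: (bit c k).
have covS : push cov S = cells eps bit' q'.
  rewrite /cells (reindex_onto h (fun d => mv act s (fun k => bit' d k (+) bit c k) c))/=; last first.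
    move=> d _; rewrite h_mv [RHS](connP hact' (one_orbit s (h c) d)).
    by apply: eq_mv => k; rewrite h_bit.
  rewrite /S linear_sum/=; apply: eq_big => [d|d cd].
    apply/idP/eqP => [cd|<-]; last exact: (conn_mv hact).
    rewrite [RHS](connP hact cd); apply: eq_mv => k; by rewrite h_bit.
  rewrite linearZ/= h_parity; congr (_ *: _).
  rewrite (@push_comp _ _ _ _ _ cov Pi setT) //; last first.
  - exact: (@zeta_Pi R m eps).
  - by apply: cont_within; exact: cov_continuous.
  apply: (@eq_push _ _ _ _ _ Pi); last exact: (@zeta_Pi R m eps).
    move=> y; apply: (@continuous_comp (subspace Pi) _ _ (q d) cov y); first exact: qw.
    exact: cov_continuous.
  by move=> y Py; rewrite /= covE.
exists (star hq s c), (a *: u); split; last split.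
- split=> //.
  + exact: cov_inj.
  + exact: chain_inZ.
  + rewrite boundaryZ; apply: chain_inZ.
    have bx : chain_in (~` [set x]) (boundary u).
      have -> : boundary u = sdIter mm (boundary S) - boundary v.
        by rewrite -boundary_sdIter uv boundaryD addrK.
      by apply: chain_inB; [exact: chain_in_sdIter|exact: chain_in_boundary].
    apply: csupp_sub (csupp_and (chain_in_boundary uU') bx) => t [tU tx] y yt.
    by split; [exact: tU|exact: tx].
- change (hzero (~` [set x]) (a *: u - a *: cells eps bit q)).
  rewrite -scalerBr; apply: hzeroZ.
  have -> : u - cells eps bit q = - (S - sdIter mm S) - v - S'.
    by rewrite SS uv opprB opprD addrA [u + v - S]addrAC addrK.
  apply: hzeroB; last exact: hzero_in.
  apply: hzeroB; last exact: hzero_in.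
  by apply: hzeroN; exact: hzero_sdIter.
- change (hzero (~` [set cov x]) (push cov (a *: u) - o (cov x))).
  have pu : push cov u = sdIter mm (cells eps bit' q') - push cov v.
    rewrite -covS -(@push_sdIter _ _ _ cov setT); [|exact: cont_within cov_continuous|exact: chain_inT].
    by rewrite uv pushD addrK.
  have -> : push cov (a *: u) - o (cov x) =
     a *: (sdIter mm (cells eps bit' q') - cells eps bit' q') - a *: push cov v -
     (o (cov x) - a *: cells eps bit' q').
    by rewrite pushZ pu !scalerBr; exact: zmod_shift.
  apply: hzeroB => //; apply: hzeroB; last by apply: hzeroZ; exact: hzero_in.
  apply: hzeroZ; apply: hzero_sym; apply: hzero_sdIter; rewrite (boundary_cells hact' hq').
  exact: csupp0.
Qed.

End Covering.

Section GluedSpace.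
Local Open Scope quotient_scope.
Variables (R : realType) (m : nat) (eps : nat -> R).
Local Notation n := m.+1.
Local Notation W := (omega n).
Local Notation Pi := (@permutahedron R n eps).
Local Notation fac := (@fac R m eps).

Lemma exists_gluing (C : finType) (act : W -> C -> C) (bit : C -> 'I_n -> bool) :
  cell_action act bit ->
  exists (E : topologicalType) (q : C -> 'rV[R]_n.+1 -> E), gluing eps act q.
Proof.
move=> hact; pose S : topologicalType := (Pi * discrete_topology C)%type.
pose r : rel S := fun x y => (x.1 == y.1) && conn act (fac (set_val x.1)) x.2 y.2.
have r_equiv : equiv_class_of r.
  have sym x y : r x y -> r y x.
    by move=> /andP[/eqP e xy]; rewrite /r -e eqxx (conn_sym hact).
  split=> [x|x y|y x z].
  - by rewrite /r eqxx; exact: connect0.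
  - by apply/idP/idP; exact: sym.
  - move=> /andP[/eqP e xy] /andP[/eqP e' yz]; rewrite /r e e' eqxx/=.
    by rewrite -e'; apply: connect_trans yz; rewrite -e.
pose re := EquivRelPack r_equiv.
pose E : topologicalType := quotient_topology {eq_quot re}.
exists E; exists (fun c x => \pi_E ((inPi eps x, c) : S)).
apply: (@gluing_quotient R m eps C E (fun z : S => \pi_E z) C act id id) => //.
- exact: pi_continuous.
- by move=> Z f fc; apply/quotient_continuous.
- by move=> y; exists (repr y); exact: reprK.
- move=> p p' c c'; split=> [/eqmodP/andP[/eqP]//|[pp cc]].
  by apply/eqmodP; rewrite /re /r /= pp eqxx/= -pp.
Qed.

End GluedSpace.

(** * The dominating covering *)

Section Retraction.
Variables (R : realType) (m : nat) (eps : nat -> R).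
Local Notation n := m.+1.
Hypothesis hp : permutahedron_parameters n eps.
Local Notation V := 'rV[R]_n.+1.
Local Notation W := (omega n).
Local Notation simplex := (singular_simplex R).
Local Notation Pi := (@permutahedron R n eps).
Local Notation fac := (@fac R m eps).
Local Notation Delta k := (@std_simplex R k).

(** Coordinate i contains the slacks of all w without i, so that on F_w only the coordinates in w
    survive; dividing by their sum yields the collapse [rho]. *)
Definition alpha (x : V) : V := \row_i wt eps (fun w : W => i \notin val w) x.

Lemma alpha_continuous : continuous alpha.
Proof.
move=> x; apply: continuous_at_rV => i; rewrite /prop_for/continuous_at.
by under eq_cvg do rewrite mxE; rewrite mxE; exact: wt_continuous.
Qed.

Definition orthant : set V := [set y | (forall i, 0 <= y 0 i) /\ 0 < \sum_i y 0 i].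

Lemma orthant_convex : convexe orthant.
Proof.
move=> x y t [x0 x1] [y0 y1] t0 t1; split=> [i|].
  by rewrite !mxE; have := x0 i; have := y0 i; nra.
have -> : \sum_i (x + t *: (y - x)) 0 i =
    \sum_i x 0 i + t * (\sum_i y 0 i - \sum_i x 0 i).
  by rewrite -sumrB mulr_sumr -big_split; apply: eq_bigr => i _; rewrite !mxE.
exact: lt_line.
Qed.

(** The tight sets at x belong to a flag and all contain its first element, whose coordinate is
    therefore positive. *)
Lemma alpha_orthant x : Pi x -> orthant (alpha x).
Proof.
move=> Px; have a0 i : 0 <= alpha x 0 i by rewrite mxE; exact: (wt_ge0 hp).
split=> //; have [s sP] := tight_flag hp (Pi_sub_Hrep hp Px).
rewrite (bigD1 ((s^-1)%g ord0))//=; apply: ltr_wpDr; first by apply: sumr_ge0.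
rewrite mxE; apply/(wt_gt0P hp _ Px) => w; apply: contra; rewrite inE => /eqP/sP ->.
rewrite inE permKV card_gt0.
by have /andP[] := valP w.
Qed.

Lemma alpha_eq0 x w i : w \in fac x -> i \notin val w -> alpha x 0 i = 0.
Proof. by move=> wx iw; rewrite mxE (wt_eq0 _ wx). Qed.

Definition nrm (y : V) : Delta n := retr ((\sum_i y 0 i)^-1 *: y).

Lemma val_nrm y : orthant y -> set_val (nrm y) = (\sum_i y 0 i)^-1 *: y.
Proof.
move=> [y0 y1]; apply: val_retr; split=> [i|].
  by rewrite mxE mulr_ge0// invr_ge0 ltW.
under eq_bigr do rewrite mxE; rewrite -mulr_sumr mulVf// gt_eqF//.
Qed.

Lemma nrm_simplex (x : Delta n) : nrm (set_val x) = x.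
Proof. by rewrite /nrm Delta_sum invr1 scale1r retrK. Qed.

Lemma nrm_continuous : {within orthant, continuous nrm}.
Proof.
apply/subspace_continuousP => y Oy; apply: cvg_set_type; rewrite val_nrm// => N Ny.
have sc : {for y, continuous (fun y : V => (\sum_i y 0 i)^-1 *: y)}.
  apply: continuous_at_rV => j; rewrite /prop_for/continuous_at.
  under eq_cvg do rewrite mxE; rewrite mxE.
  apply: (@cvgM _ _ (nbhs y) (nbhs_filter y)); last exact: coord_continuous.
  apply: (@cvgV _ _ (nbhs y) (nbhs_filter y)); first by case: Oy => _ /gt_eqF ->.
  apply: (@cvg_bigsum R _ _ (nbhs y) (nbhs_filter y) _ _ (fun i y => y 0 i)) => i.
  exact: coord_continuous.
have h : nbhs y [set z : V | N ((\sum_i z 0 i)^-1 *: z)] := sc N Ny.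
rewrite /within/= nbhs_simpl /=.
by apply: (@filterS _ (nbhs y) (nbhs_filter y) _ _ _ h) => z Nz Oz; rewrite /= val_nrm.
Qed.

(* Collapses the facet F_w onto the face of the simplex spanned by w. *)
Definition rho (x : V) : Delta n := nrm (alpha x).

Lemma rho_continuous : {within Pi, continuous rho}.
Proof.
apply/subspace_continuousP => x Px N Nx.
have := nrm_continuous => /subspace_continuousP/(_ _ (alpha_orthant Px))/(_ N Nx) h.
have h2 : nbhs x [set z | orthant (alpha z) -> N (rho z)] := alpha_continuous h.
rewrite /within/= nbhs_simpl /=.
apply: (@filterS _ (nbhs x) (nbhs_filter x) _ _ _ h2) => z hz Pz.
exact/hz/alpha_orthant.
Qed.

Lemma rho_eq0 x w i : Pi x -> w \in fac x -> i \notin val w -> set_val (rho x) 0 i = 0.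
Proof.
move=> Px wx iw; rewrite val_nrm; last exact: alpha_orthant.
by rewrite mxE (alpha_eq0 wx iw) mulr0.
Qed.

Definition side (j : 'I_n.+1) : set V := [set y | orthant y /\ y 0 j = 0].

Lemma side_convex j : convexe (side j).
Proof.
move=> x y t [Ox x0] [Oy y0] t0 t1; split; first exact: orthant_convex.
by rewrite !mxE x0 y0 subrr mulr0 addr0.
Qed.

Lemma orthant_delta l : orthant (row l (1%:M : 'M[R]_n.+1)).
Proof.
split=> [i|]; first by rewrite !mxE ler0n.
by rewrite (bigD1 l)//= big1 ?addr0 => [|i /negPf il]; rewrite !mxE ?eqxx ?ltr01// eq_sym il.
Qed.

(** The argument of [zeta_center], against the standard simplex. [flag_homotopy] asks for a map
    continuous everywhere, such as [alpha] before normalisation; hence the orthant in place of the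
    simplex. *)
Lemma zeta_alpha : relb orthant (@small R _ _ side n)
  (push alpha (@zeta R m eps) - flag_sign m *: << aff (1%:M : 'M[R]_n.+1) >>).
Proof.
have h1 := @flagchain_least R m _ (1%:M : 'M[R]_n.+1) side side_convex.
have {}h1 : csupp (@small R _ _ side n)
    (flagchain (fun G => row (least G) (1%:M : 'M[R]_n.+1)) - flag_sign m *: << aff 1%:M >>).
  apply: h1 => l j /negPf lj; split; first exact: orthant_delta.
  by rewrite !mxE lj.
pose Uw (w : W) : set V := [set y | orthant y /\ forall k, k \notin val w -> y 0 k = 0].
have cUw w : convexe (Uw w).
  move=> x y t [Ox x0] [Oy y0] t0 t1; split; first exact: orthant_convex.
  by move=> k kw; rewrite !mxE x0// y0// subrr mulr0 addr0.
have h2 : relb orthant (@small R _ _ side n)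
    (flagchain (fun G => row (least G) (1%:M : 'M[R]_n.+1)) - push alpha (@zeta R m eps)).
  have := @flag_homotopy R m _ _ (bpt eps) (fun G => row (least G) (1%:M : 'M[R]_n.+1))
    alpha Pi (@Fw R m eps) orthant Uw alpha_continuous (@Pi_convex R n eps)
    (@Fw_convex R m eps) orthant_convex cUw.
  move=> H; apply: relb_sub (H _ _ _ _) => //.
  - move=> s [w sw].
    have /existsP[k kw] : [exists k, k \notin val w].
      have /andP[_ /properP[_ [k _ kw]]] := valP w; by apply/existsP; exists k.
    by exists k => x /sw[Ox x0]; split=> //; exact: x0.
  - move=> G fG; have [PG _] := @bptP R m eps G fG; split=> //; exact: orthant_delta.
  - move=> G w fG wG; split; first exact: bpt_Fw.
    split=> [|k kw]; first exact: orthant_delta.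
    have [s Gs] := fG; have lw : least G \in val w.
      have [|+ _] := @leastP m G ((s^-1)%g ord0).
        by apply/bigcapP => w' /Gs[k' ->]; rewrite inE permKV.
      by move=> /bigcapP; exact.
    rewrite !mxE; case: eqP => // e; by rewrite -e lw in kw.
  - by move=> x; exact: alpha_orthant.
  - move=> w x [Px x0]; split; first exact: alpha_orthant.
    by move=> k kw; apply: (@alpha_eq0 _ w) => //; rewrite inE x0.
have -> : push alpha (@zeta R m eps) - flag_sign m *: << aff (1%:M : 'M[R]_n.+1) >> =
    (flagchain (fun G => row (least G) (1%:M : 'M[R]_n.+1)) - flag_sign m *: << aff 1%:M >>) -
    (flagchain (fun G => row (least G) (1%:M : 'M[R]_n.+1)) - push alpha (@zeta R m eps)).
  by rewrite opprB [RHS]addrC addrA subrK.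
by apply: relbB => //; exact: relb_csupp.
Qed.

Lemma face_of_eq0 (k : 'I_n.+1) (y : Delta n) : set_val y 0 k = 0 -> exists z, y = face k z.
Proof.
move=> y0; pose z : 'rV[R]_n := \row_j set_val y 0 (fintype.lift k j).
have zD : z \in Delta m.
  apply/mem_set; split=> [j|]; first by rewrite mxE Delta_ge0.
  rewrite -[RHS](Delta_sum y) (bigD1 k)//= y0 add0r.
  rewrite [RHS](reindex (fintype.lift k)); last first.
    exists (fun j => odflt ord0 (unlift k j)) => j; rewrite inE => kj.
      by rewrite liftK.
    by case: unliftP kj => [j' -> //|->]; rewrite eqxx.
  apply: eq_big => [j|j _]; first by rewrite eq_sym neq_lift.
  by rewrite mxE.
exists (SigSub zD); apply: val_inj; rewrite /=; apply/rowP => j.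
by rewrite mxE; case: unliftP => [j' ->|->//]; rewrite mxE.
Qed.

End Retraction.

(** * Cells over a cycle and their multiplicity *)

Section Domination.
Variables (R : realType) (m : nat) (eps : nat -> R).
Local Notation n := m.+1.
Hypothesis hp : permutahedron_parameters n eps.
Local Notation V := 'rV[R]_n.+1.
Local Notation W := (omega n).
Local Notation chain := (chain R).
Local Notation simplex := (singular_simplex R).
Local Notation Pi := (@permutahedron R n eps).
Local Notation Delta k := (@std_simplex R k).
Local Notation CM := {ffun 'I_n -> bool}.

Variables (N : topologicalType) (X : finType) (sg : pred X) (phi : X -> simplex n N)
  (tau : 'I_n.+1 -> X -> X).
Hypotheses (tauK : forall k, involutive (tau k)) (tau_sg : forall k v, sg (tau k v) = ~~ sg v)
  (tau_face : forall k v, sface k (phi (tau k v)) = sface k (phi v)).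

Definition tau_step (w : W) : rel X :=
  fun v v' => [exists k : 'I_n.+1, (k \notin val w) && (v' == tau k v)].

(* The maps [phi v] and [phi (L v)] agree on the face spanned by the vertices in [w]. *)
Definition adm (w : W) (L : {perm X}) : bool :=
  [&& (L * L == 1)%g, [forall v, sg (L v) != sg v] & [forall v, connect (tau_step w) v (L v)]].

Definition pre := (X * ({ffun W -> {perm X}} * CM))%type.

Definition bits_parity (e : CM) : bool := parity (@bitM m) e.

Definition adms (L : {ffun W -> {perm X}}) : bool := [forall w, adm w (L w)].

(** With the parity of the bits equal to the sign of the simplex, all cells over one simplex enter
    [cells] with the same sign. *)
Definition good : pred pre := fun x => adms x.2.1 && (bits_parity x.2.2 == sg x.1).

(* Crossing a facet conjugates the involutions attached to the smaller ones, so
   that the moves across nested facets commute. *)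
Definition pre_act (w : W) (x : pre) : pre :=
  (x.2.1 w x.1,
   ([ffun g : W => if val g \proper val w then (x.2.1 w * x.2.1 g * x.2.1 w)%g else x.2.1 g],
    actM w x.2.2)).

Lemma admK w L v : adm w L -> L (L v) = v.
Proof. by move=> /and3P[/eqP LL _ _]; rewrite -permM LL perm1. Qed.

Lemma tau_step_sub (w g : W) v v' : val g \subset val w ->
  connect (tau_step w) v v' -> connect (tau_step g) v v'.
Proof.
move=> gw; apply: connect_sub => u u' /existsP[k /andP[kw e]]; apply: connect1.
by apply/existsP; exists k; rewrite e andbT; apply: contra kw; exact: (fintype.subsetP gw).
Qed.

(** For g inside w, each k outside w is outside g, so conjugating the involution of g by that of w
    leaves it composed of allowed steps; three reversals of the sign make one. *)
Lemma pre_act_good w x : good x -> good (pre_act w x).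
Proof.
move=> /andP[/forallP La /eqP ex]; have Lw := La w; have /and3P[/eqP LL /forallP Ls Lc] := Lw.
apply/andP; split.
  apply/forallP => g; rewrite /= ffunE; case: ifPn => // gw.
  have Lg := La g; have /and3P[/eqP GG /forallP Gs /forallP Gc] := Lg; apply/and3P; split.
  - apply/eqP; rewrite !mulgA -(mulgA _ (x.2.1 w) (x.2.1 w)) LL mulg1.
    by rewrite -(mulgA _ (x.2.1 g) (x.2.1 g)) GG mulg1.
  - apply/forallP => v; rewrite !permM; move: (Ls v) (Gs (x.2.1 w v)) (Ls (x.2.1 g (x.2.1 w v))).
    by case: (sg v); case: (sg _); case: (sg _); case: (sg _).
  - apply/forallP => v; rewrite !permM.
    have cw u : connect (tau_step g) u (x.2.1 w u).
      by apply: tau_step_sub (proper_sub gw) _; exact: (forallP Lc).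
    exact: connect_trans (connect_trans (cw v) (Gc _)) (cw _).
rewrite /= /bits_parity (parity_act (@actM_cell m)) -/(bits_parity _) ex.
by have := Ls x.1; case: (sg _); case: (sg _).
Qed.

Definition cell := {x in good}.

Lemma cell_good (c : cell) : good (val c). Proof. exact: valP. Qed.

Definition cell_act (w : W) (c : cell) : cell := exist _ (pre_act w (val c)) (pre_act_good w (cell_good c)).

Definition cell_bits (c : cell) : CM := (val c).2.2.

Definition cell_bit (c : cell) (k : 'I_n) : bool := cell_bits c k.

Lemma cell_adm (c : cell) w : adm w ((val c).2.1 w).
Proof. by have /andP[/forallP] := cell_good c. Qed.

(** For w inside w', crossing w' first turns L w into L w' L w L w', whose value at L w' v is L w'
    (L w v). This is also where crossing w first leads, as it does not affect L w'. *)
Lemma cell_act_action : cell_action cell_act cell_bit.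
Proof.
have [aK aC aB] := @actM_cell m; split=> [w c|w w' c ww'|w c k]; last first.
- by rewrite /cell_bit /cell_bits /= ffunE.
- have [->//|ne] := eqVneq w w'.
  have pw : val w \proper val w'.
    rewrite finset.properEneq -/(omega_sub _ _) ww' andbT; apply: contra ne => /eqP e; exact/eqP/val_inj.
  have npw : (val w' \proper val w) = false.
    by apply/negbTE; apply/negP => h; move: (proper_trans pw h); rewrite fintype.properxx.
  have Aw := cell_adm c w; have Aw' := cell_adm c w'.
  have /and3P[/eqP LL _ _] := Aw; have /and3P[/eqP LL' _ _] := Aw'.
  apply: val_inj; rewrite /= /pre_act /= !ffunE pw npw; congr (_, (_, _)); last exact: aC.
    by rewrite !permM (admK _ Aw').
  apply/ffunP => g; rewrite !ffunE.
  case: (boolP (val g \proper val w)) => gw.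
    rewrite (proper_trans gw pw) !mulgA -!(mulgA _ ((val c).2.1 w') ((val c).2.1 w')) LL' !mulg1.
    by rewrite ?mulgA.
  by [].
- have Aw := cell_adm c w; have /and3P[/eqP LL _ _] := Aw.
  apply: val_inj; rewrite /= /pre_act /= !ffunE fintype.properxx; rewrite (admK _ Aw) aK.
  rewrite [RHS]surjective_pairing [(val c).2]surjective_pairing; congr (_, (_, _)).
  apply/ffunP => g; rewrite !ffunE; case: ifP => gw; rewrite /= gw//.
  by rewrite !mulgA LL mul1g -mulgA LL mulg1.
Qed.

Lemma tau_phi k v (y : Delta n) : set_val y 0 k = 0 -> phi (tau k v) y = phi v y.
Proof.
by move=> /face_of_eq0[z ->]; exact: (congr1 (fun s : simplex m N => s z) (tau_face k v)).
Qed.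

(** Over F_w the coordinates of [rho] outside w are 0, and a step [tau k] with k outside w does not
    change phi there. *)
Lemma phi_compat : compat eps cell_act (fun c x => phi (val c).1 (rho eps x)).
Proof.
move=> c w x Px wx; have /and3P[_ _ /forallP/(_ (val c).1)] := cell_adm c w.
set v := (val c).1; set v2 := (val (cell_act w c)).1; rewrite -[(val c).2.1 w v]/v2; move: v v2 => v v2 /connectP[p]; elim: p v => [v _ -> //|u p IH v /=].
move=> /andP[/existsP[k /andP[kw /eqP uv]] /IH h] /h ->; rewrite uv tau_phi//.
exact: (rho_eq0 hp Px wx kw).
Qed.

Lemma cell_nonempty (v : X) : exists c : cell, True.
Proof.
have /fin_all_exists[L LP] (w : W) : exists L : {perm X}, adm w L.
  have /properP[_ [k _ kw]] : val w \proper finset.setT by have /andP[] := valP w.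
  (* A single [tau k], with any k outside w, is admissible. *)
  exists (perm (inv_inj (tauK k))); apply/and3P; split.
  - by apply/eqP/permP => u; rewrite permM !permE tauK.
  - by apply/forallP => u; rewrite permE tau_sg; case: (sg u).
  - apply/forallP => u; rewrite permE; apply: connect1; apply/existsP; exists k.
    by rewrite kw eqxx.
pose e0 : CM := [ffun=> false]; pose w0 : W := fl (1%g : 'S_n.+1) ord0.
have p0 : bits_parity e0 = false.
  by rewrite /bits_parity /parity big1// => k _; rewrite /bitM ffunE.
(* Changing one bit adjusts the parity to the sign of v. *)
pose e := if sg v then actM w0 e0 else e0.
have ge : good (v, ([ffun w => L w], e)).
  apply/andP; split=> /=; first by apply/forallP => w; rewrite ffunE.
  rewrite /e; case: ifP => _; rewrite /bits_parity ?(parity_act (@actM_cell m)) -/(bits_parity _) p0//.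
by exists (exist (fun x => x \in good) _ ge).
Qed.

(** K counts the cells over a simplex. This number depends only on the parity prescribed for the
    bits, and flipping one bit shows that both parities give the same number. *)
Lemma sum_cells (M : lmodType int) (F : X -> M) : (exists v : X, True) ->
  exists2 K : int, K != 0 &
    \sum_(c : cell) (-1) ^+ parity cell_bit c *: F (val c).1 = K *: \sum_v (-1) ^+ sg v *: F v.
Proof.
move=> [v0 _].
pose kp b := #|[set y : {ffun W -> {perm X}} * CM | adms y.1 && (bits_parity y.2 == b)]%SET|.
pose w0 : W := fl (1%g : 'S_n.+1) ord0; have [aK _ _] := @actM_cell m.
have kpN b : (kp b <= kp (~~ b))%N.
  rewrite /kp -(card_imset _ (f := fun y => (y.1, actM w0 y.2))); last first.
    by move=> [L e] [L' e'] /= [-> ee]; rewrite -[e](aK w0) ee aK.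
  apply: subset_leq_card; apply/fintype.subsetP => _ /imsetP[y yk ->].
  move: yk; rewrite !inE => /andP[-> /eqP <-].
  by rewrite /bits_parity (parity_act (@actM_cell m)) eqxx.
have kpE b : kp b = kp false.
  case: b => //; apply/eqP; rewrite eqn_leq (kpN false) andbT; exact: (kpN true).
exists (kp false)%:Z.
  have [c _] := cell_nonempty v0; have /andP[c1 c2] := cell_good c.
  rewrite -(kpE (sg (val c).1)) eqz_nat -lt0n /kp card_gt0; apply/set0Pn.
  by exists (val c).2; rewrite inE c1 c2.
rewrite -(big_sub good (fun x : pre => (-1) ^+ bits_parity x.2.2 *: F x.1)).
rewrite (eq_bigl (fun x : pre => xpredT x.1 && (adms x.2.1 && (bits_parity x.2.2 == sg x.1)))) => [|x //].
rewrite -(pair_big_dep xpredT (fun v (y : {ffun W -> {perm X}} * CM) => adms y.1 && (bits_parity y.2 == sg v))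
  (fun v (y : {ffun W -> {perm X}} * CM) => (-1) ^+ bits_parity y.2 *: F v))/=.
rewrite scaler_sumr; apply: eq_bigr => v _.
rewrite (eq_bigr (fun=> (-1) ^+ sg v *: F v)) => [|y /andP[_ /eqP -> //]].
rewrite (eq_bigl (fun y => y \in [set y : {ffun W -> {perm X}} * CM | adms y.1 && (bits_parity y.2 == sg v)]%SET)); last first.
  by move=> y; rewrite inE.
by rewrite sumr_const -/(kp (sg v)) kpE -scaler_nat natz.
Qed.

Lemma zmod_split (U : zmodType) (a b s : U) : s + b = a + (b - (a - s)).
Proof. by rewrite opprB addrCA [a + _]addrC subrK addrC. Qed.

(* Pushing forward by [alpha], the flag chain becomes homologous to the standard
   simplex up to chains in the sides of the orthant, where the [phi v] cancel in
   pairs. *)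
Lemma sum_phi_rho (c : chain n N) : boundary c = 0 -> \sum_v (-1) ^+ sg v *: << phi v >> = Sd c ->
  exists b : chain n.+1 N, \sum_v (-1) ^+ sg v *: push (fun x => phi v (rho eps x)) (@zeta R m eps) =
    flag_sign m *: c + boundary b.
Proof.
move=> c0 cE; have [e Oe] := zeta_alpha hp; pose D := push (alpha eps) (@zeta R m eps) - flag_sign m *: << aff (1%:M : 'M[R]_n.+1) >> - boundary e; move=> De.
pose G v : V -> N := fun y => phi v (nrm y).
have Gc v : {within @orthant R m, continuous (G v)}.
  move=> y; apply: (@continuous_comp (subspace (@orthant R m)) _ _ (@nrm R m) (phi v) y).
    exact: nrm_continuous.
  exact: (@cts_fun _ _ (phi v)).
have pE v : push (fun x => phi v (rho eps x)) (@zeta R m eps) = push (G v) (push (alpha eps) (@zeta R m eps)).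
  apply/esym/(@push_comp _ _ _ _ _ _ Pi (@orthant R m)).
  - by apply: cont_within; exact: alpha_continuous.
  - exact: Gc.
  - by move=> x; exact: alpha_orthant.
  - exact: zeta_Pi.
have aE : push (alpha eps) (@zeta R m eps) = flag_sign m *: << aff (1%:M : 'M[R]_n.+1) >> + boundary e + D.
  by rewrite [RHS]addrC /D -[_ - _ - _]addrA -opprD subrK.
have gE v : push (G v) << aff (1%:M : 'M[R]_n.+1) >> = << phi v >>.
  apply: pushU => x; have ax : aff (1%:M : 'M[R]_n.+1) x = set_val x by exact: mulmx1.
  by rewrite -[LHS]/(phi v (nrm (aff (1%:M : 'M[R]_n.+1) x))) ax nrm_simplex.
have D0 : \sum_v (-1) ^+ sg v *: push (G v) D = 0.
  move: De; rewrite -/D; move: (D); apply: csupp_ind.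
  - by apply: big1 => v _; rewrite raddf0 scaler0.
  - move=> d d' d0 d'0; under eq_bigr => v _ do rewrite pushD scalerDr.
    by rewrite big_split/= d0 d'0 addr0.
  - move=> a d d0; under eq_bigr => v _ do rewrite pushZ scalerA mulrC -scalerA.
    by rewrite -scaler_sumr d0 scaler0.
  - move=> s [j sj]; apply: (@sum_signed_invol _ _ (tau j) sg) => // v.
    rewrite tau_sg signrN scaleNr; congr (- (_ *: _)).
    apply: (@eq_push _ _ _ _ _ (side j)) => [|y [Oy y0]|]; last exact: csuppU.
      by apply: continuous_subspaceW (Gc _) => y [].
    by rewrite /G tau_phi// val_nrm// mxE y0 mulr0.
(* The second term undoes the subdivision, since the [phi v] sum up to [Sd c] and not to c. *)
exists (\sum_v (-1) ^+ sg v *: push (G v) e - flag_sign m *: sdT c).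
have dT : boundary (sdT c) = c - Sd c by rewrite boundary_sdT c0 linear0 subr0.
have pD v : (-1) ^+ sg v *: push (fun x => phi v (rho eps x)) (@zeta R m eps) =
    flag_sign m *: ((-1) ^+ sg v *: << phi v >>) + boundary ((-1) ^+ sg v *: push (G v) e) +
    (-1) ^+ sg v *: push (G v) D.
  rewrite pE {1}aE !pushD pushZ gE !scalerDr scalerA mulrC -scalerA boundaryZ.
  by rewrite (boundary_push (@Gc v) Oe).
rewrite (eq_bigr _ (fun v _ => pD v)) !big_split/= D0 addr0 -scaler_sumr cE.
rewrite boundaryB boundaryZ dT scalerBr linear_sum/=.
exact: zmod_split.
Qed.

End Domination.

(** * The covering of the Tomei manifold and the degree *)

Section Conclusion.
Variables (R : realType) (m : nat) (eps : nat -> R).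
Local Notation n := m.+1.
Hypothesis hp : permutahedron_parameters n eps.
Local Notation W := (omega n).
Local Notation chain := (chain R).
Local Notation Pi := (@permutahedron R n eps).
Local Notation CM := {ffun 'I_n -> bool}.
Local Notation M := (tomei_manifold n eps).

Lemma scale_orientation (Y : topologicalType) (z : chain n Y) (a b : int) : a * b = 1 ->
  is_orientation (fun=> z) -> is_orientation (fun=> a *: z).
Proof.
move=> ab [gz lz]; split=> [y|y].
  have [cz gen] := gz y; split.
    by rewrite /relative_cycle boundaryZ; exact: chain_inZ.
  move=> c /gen[r rz]; exists (r * b).
  by rewrite scalerA -mulrA [b * a]mulrC ab mulr1.
have [U [Uy [c [cU cz]]]] := lz y; exists U; split=> //; exists (a *: c); split.
  by rewrite /relative_cycle boundaryZ; exact: chain_inZ.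
move=> y' /cz; change (hzero (~` [set y']) (c - z) -> hzero (~` [set y']) (a *: c - a *: z)).
by rewrite -scalerBr => h; exact: hzeroZ.
Qed.

Lemma actM_one_orbit s (c d : CM) : conn (@actM m) (flagset s) c d.
Proof.
have -> : d = mv (@actM m) s (fun k => c k (+) d k) c; last exact: (conn_mv (@actM_cell m)).
apply/ffunP => k; rewrite -[RHS]/(bitM _ k) (bit_mv (@actM_cell m)) /bitM.
by rewrite addbAC addbb.
Qed.

Section Fibres.
Variables (C C' : finType) (act : W -> C -> C) (bit : C -> 'I_n -> bool) (act' : W -> C' -> C')
  (bit' : C' -> 'I_n -> bool) (h : C -> C').
Hypotheses (hact : cell_action act bit) (hact' : cell_action act' bit')
  (h_act : forall w c, h (act w c) = act' w (h c))
  (one_orbit : forall s c d, conn act' (flagset s) c d).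

(** The move across w carries the fibre over c' into that over [act' w c'], and there is one orbit
    below. *)
Lemma card_fibre (c' d' : C') : #|[set c | h c == c']%SET| = #|[set c | h c == d']%SET|.
Proof.
have [aK _ _] := hact; have [aK' _ _] := hact'.
have le w c1 : (#|[set c | h c == c1]%SET| <= #|[set c | h c == act' w c1]%SET|)%N.
  rewrite -(card_imset _ (can_inj (aK w))); apply: subset_leq_card.
  by apply/fintype.subsetP => _ /imsetP[c + ->]; rewrite !inE h_act => /eqP ->.
apply: (conn_invariant (h := fun c1 => #|[set c | h c == c1]%SET|) _ (one_orbit (1%g : 'S_n.+1) d' c')).
move=> w c1 _; apply/eqP; rewrite eqn_leq le andbT.
by have := le w (act' w c1); rewrite aK'.
Qed.

End Fibres.

Variables (N : topologicalType) (oN : N -> chain n N).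
Hypotheses (mN : closed_manifold R n N) (neN : [set: N] !=set0) (orN : is_orientation oN).

Lemma tomei_virtually_dominates (oM : M -> chain n M) : is_orientation oM ->
  virtually_dominates oM oN.
Proof.
move=> orM; have [hN _ cN eN] := mN.
have hqM := qM_gluing m eps; have hM := glued_hausdorff (@actM_cell m) hqM.
have eM := glued_locally_euclidean hp (@actM_cell m) hqM.
have orC := cells_orientation hp (@actM_cell m) hqM.
(* Just some point of M: 0 is not in the permutahedron, and [inPi] replaces it with a vertex. *)
pose x0 : M := qM eps ([ffun=> false] : CM) 0.
have [a [b [ab oa]]] := orientation_multiple hM eM x0 (@qM_connected R m eps) orM
  (boundary_cells (@actM_cell m) hqM) orC.1.
have [c fc] := fundamental_cycle_exists hN eN orN cN; have [c0 cP] := fc.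
have [X [sg [phi [tau [tauK tau_sg tau_face cE]]]]] := subdivided_cycle c0.
(* Without simplices c would bound, although it restricts to a generator of infinite order at y0. *)
have [v0 _] : exists v : X, True.
  apply: contrapT => X0; have [y0 _] := neN.
  have Sc0 : Sd c = 0.
    by rewrite -cE; apply: big1 => v _; case: X0; exists v.
  suff : (1 : int) = 0 by [].
  apply: (generator_unit hN eN (orN.1 y0)); rewrite scale1r.
  have cb : c = boundary (sdT c) by rewrite boundary_sdT c0 linear0 subr0 Sc0 subr0.
  have -> : oN y0 = boundary (sdT c) - (c - oN y0) by rewrite -cb opprB addrC subrK.
  by apply: hzeroB; [exact: hzero_boundary|exact: cP].
have hact := cell_act_action sg tau.
have [E [q hq]] := exists_gluing eps hact.
have h_act (w : W) (e : cell sg tau) : cell_bits (cell_act w e) = actM w (cell_bits e) by [].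
have h_bit (e : cell sg tau) k : bitM (cell_bits e) k = cell_bit e k by [].
have hphi := phi_compat (sg := sg) hp tau_face.
have phi_cts (e : cell sg tau) : {within Pi, continuous (fun x => phi (val e).1 (rho eps x))}.
  move=> x; apply: (@continuous_comp (subspace Pi) _ _ (rho eps) (phi (val e).1) x).
    exact: rho_continuous.
  exact: (@cts_fun _ _ (phi (val e).1)).
have hcov := cov_continuous (hq := hq) (@actM_cell m) hqM h_act.
have hf := glift_continuous (hq := hq) hphi phi_cts.
have orE := scale_orientation ab (cells_orientation hp hact hq).
(* The covering is oriented by its own cell cycle, with the sign a that relates [oM] to the cell
   cycle of the Tomei manifold. *)
exists E, (mkcts hcov), (fun=> a *: cells eps (@cell_bit m X sg tau) q), (mkcts hf); split=> //.
- pose c1 : CM := [ffun=> false].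
  apply: (cov_finite_sheeted hp hact hq (@actM_cell m) hqM h_act h_bit (k := #|[set e | @cell_bits m X sg tau e == c1]%SET|)) => [|c'].
    have [e _] := cell_nonempty tauK tau_sg v0.
    rewrite (card_fibre hact (@actM_cell m) h_act actM_one_orbit c1 (cell_bits e)).
    by rewrite card_gt0; apply/set0Pn; exists e; rewrite inE.
  exact: (card_fibre hact (@actM_cell m) h_act actM_one_orbit).
- have := cov_orientation_preserving hp hact hq (@actM_cell m) hqM h_act h_bit actM_one_orbit oa.
  move=> H x; have [U [u [uP [u1 u2]]]] := H x; exists U, u; split=> //; split=> //.
  by rewrite pushforwardE.
have [K K0 KE] := sum_cells tauK tau_sg
  (fun v => push (fun x => phi v (rho eps x)) (@zeta R m eps)) (ex_intro _ v0 I).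
have [e eE] := sum_phi_rho hp tauK tau_sg tau_face c0 cE.
have a0 : a != 0 by apply/eqP => a0; move: ab; rewrite a0 mul0r.
(* a comes from the orientation, K counts the cells over each simplex, and [flag_sign] is the degree
   of [alpha] on [zeta]. *)
exists (a * K * flag_sign m); split.
  rewrite !mulf_neq0//; apply/eqP => f0.
  by have := flag_sign2 m; rewrite f0 mul0r.
exists (a *: cells eps (@cell_bit m X sg tau) q), c; split=> //.
  split=> [|x]; first by rewrite boundaryZ (boundary_cells hact hq) scaler0.
  exact: hzero_refl.
exists ((a * K) *: e); rewrite pushforwardE pushZ boundaryZ.
suff -> : push (mkcts hf) (cells eps (@cell_bit m X sg tau) q) =
    K *: \sum_v (-1) ^+ sg v *: push (fun x => phi v (rho eps x)) (@zeta R m eps).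
  by rewrite eE !scalerA scalerDr scalerA addrAC subrr add0r.
rewrite -KE linear_sum/=; apply: eq_bigr => d _; rewrite linearZ/=; congr (_ *: _).
have [qw _ _ _] := hq.
rewrite (@push_comp _ _ _ _ _ (mkcts hf) Pi setT) //; last first.
- exact: (@zeta_Pi R m eps).
- by apply: cont_within; exact: hf.
apply: (@eq_push _ _ _ _ _ Pi); last exact: (@zeta_Pi R m eps).
  move=> x; apply: (@continuous_comp (subspace Pi) _ _ (q d) (mkcts hf) x); first exact: qw.
  exact: hf.
by move=> x Px; exact: gliftE.
Qed.

End Conclusion.

Theorem corollary5p2 (R : realType) (n : nat) (eps : nat -> R) :
  (1 <= n)%N ->
  permutahedron_parameters n eps ->
  (exists oM : tomei_manifold n eps -> chain R n (tomei_manifold n eps),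
      is_orientation oM) /\
  (forall oM : tomei_manifold n eps -> chain R n (tomei_manifold n eps),
    is_orientation oM ->
    forall (N : topologicalType) (oN : N -> chain R n N),
      closed_manifold R n N -> [set: N] !=set0 -> connected [set: N] ->
      is_orientation oN ->
      virtually_dominates oM oN).
Proof.
case: n => // m _ hp; split.
  by eexists; exact: (cells_orientation hp (@actM_cell m) (qM_gluing m eps)).
move=> oM orM N oN mN neN _ orN; exact: tomei_virtually_dominates.
Qed.
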